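(* Let $m\ge3$ and let $\mathbf P_m=\mathbb{R}Q_m/(R_m^{\mathfrak h})$ be the path algebra of the Hasse graph $Q_m$ of type $I_2(m)$ modulo the dihedral relations, graded by path length. Then $\mathbf P_m$ is Koszul self-dual, i.e. $\mathbf P_m\cong E(\mathbf P_m)\cong\mathbf P_m^!$, where $E(\mathbf P_m)$ is the Koszul dual and $\mathbf P_m^!$ the quadratic dual of $\mathbf P_m$.
   Context: The algebra $\mathbf P_m$. Let $(W,\{s,t\})$ be the dihedral Coxeter system of type $I_2(m)$, $m\ge3$, with length function $\ell$. Write ${}_s k=sts\cdots$ and ${}_t k=tst\cdots$ ($k$ factors) as elements of $W$; ${}_s0={}_t0=e$ and ${}_sm={}_tm=w_0$ is the longest element. Let $\zeta=e^{2\pi i/2m}$ and $[n]_\zeta=\frac{\zeta^n-\zeta^{-n}}{\zeta-\zeta^{-1}}\in\mathbb{R}$. $Q_m$ is the quiver with vertex set $W$ and exactly one arrow $w\to w'$ for each ordered pair with $|\ell(w)-\ell(w')|=1$; $(w,w')$ denotes this arrow and $(w,w',w'')$ the path $w\to w'\to w''$. Paths are composed from right to left, so with $e_x$ the trivial path at $x$, $e_y\mathbb{R}Q_me_x$ is spanned by the paths from $x$ to $y$. $R_m^{\mathfrak h}$ consists of the following relations for all $2\le i\le m-1$ and $0\le j\le m-2$, together with those obtained by interchanging the roles of $s$ and $t$: (1) $(e,s,e)=0$; (2) $(s,st,s)=0$; (3) $({}_si,{}_s(i+1),{}_si)=\frac{[i-1]_\zeta}{[i]_\zeta}({}_si,{}_s(i-1),{}_si)$;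 (4) $(s,ts,s)=-[2]_\zeta(s,e,s)$; (5) $({}_si,{}_t(i+1),{}_si)=([i-1]_\zeta-[i+1]_\zeta)({}_si,{}_s(i-1),{}_si)-\frac{[i+1]_\zeta}{[i]_\zeta}({}_si,{}_t(i-1),{}_si)$; (6) $(s,st,t)=(s,e,t)$; (7) $(s,ts,t)=(s,e,t)$; (8) $({}_si,{}_s(i+1),{}_ti)=\frac1{[i]_\zeta}({}_si,{}_s(i-1),{}_ti)+({}_si,{}_t(i-1),{}_ti)$; (9) $({}_si,{}_t(i+1),{}_ti)=({}_si,{}_s(i-1),{}_ti)+\frac1{[i]_\zeta}({}_si,{}_t(i-1),{}_ti)$; (10) $({}_sj,{}_s(j+1),{}_s(j+2))=({}_sj,{}_t(j+1),{}_s(j+2))$; (11) $({}_sj,{}_s(j+1),{}_t(j+2))=({}_sj,{}_t(j+1),{}_t(j+2))$; (12) $({}_s(j+2),{}_s(j+1),{}_sj)=({}_s(j+2),{}_t(j+1),{}_sj)$; (13) $({}_s(j+2),{}_s(j+1),{}_tj)=({}_s(j+2),{}_t(j+1),{}_tj)$. $\mathbf P_m:=\mathbb{R}Q_m/(R_m^{\mathfrak h})$, graded by path length (all relations are homogeneous of degree 2). Duals. For a graded algebra $A=\bigoplus_{i\ge0}A_i$, the Koszul dual is $E(A)=\operatorname{Ext}_A^\bullet(A_0,A_0)$ (self-extensions of the left $A$-module $A_0$). If $A_0$ is semisimple, all $A_i$ are finitely generated left $A_0$-modules, and $A=T_{A_0}A_1/(R_2)$ with $R_2\subset A_1\otimes_{A_0}A_1$,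 the quadratic dual is $A^!=T_{A_0}A_1^*/(R_2^\perp)$, where $R_2^\perp\subset A_1^*\otimes_{A_0}A_1^*\cong(A_1\otimes_{A_0}A_1)^*$ is the annihilator of $R_2$. *)

(* Defs.v *)
From HB Require Import structures.
From mathcomp Require Import all_boot all_order all_algebra all_fingroup.
From mathcomp Require Import generic_quotient ring_quotient complex.
From mathcomp Require Import boolp classical_sets functions cardinality.
From mathcomp Require Import reals trigo.

Set Implicit Arguments.
Unset Strict Implicit.
Unset Printing Implicit Defensive.

Import GRing.Theory.
Local Open Scope ring_scope.

(* An N-graded associative unital K-algebra.  The K-algebra structure is the
   central ring morphism [gr_scal] (MathComp's [algType] would exclude the zero
   ring), and the decomposition A = (+)_n A_n is given by the projections
   [gr_proj n] onto the summands A_n = {x | gr_proj n x = x}. *)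
Record gralg (K : fieldType) := Gralg {
  gr_sort :> pzRingType;
  gr_scal : {rmorphism K -> gr_sort};
  gr_proj : nat -> gr_sort -> gr_sort;
  gr_scalC : forall c x, gr_scal c * x = x * gr_scal c;
  gr_projD : forall n x y, gr_proj n (x + y) = gr_proj n x + gr_proj n y;
  gr_proj_scal : forall n c,
    gr_proj n (gr_scal c) = if n == 0%N then gr_scal c else 0;
  gr_proj_proj : forall i j x,
    gr_proj i (gr_proj j x) = if i == j then gr_proj j x else 0;
  gr_projM : forall n x y,
    gr_proj n (x * y) = \sum_(i < n.+1) gr_proj i x * gr_proj (n - i)%N y;
  gr_proj_sum : forall x, exists N, x = \sum_(i < N) gr_proj i x
}.
Arguments gr_scal {K} _.
Arguments gr_proj {K} _ n x.

Definition gr_iso (K : fieldType) (A B : gralg K) : Prop :=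
  exists f : {rmorphism A -> B},
    [/\ bijective f,
        forall c, f (gr_scal A c) = gr_scal B c
      & forall n x, f (gr_proj A n x) = gr_proj B n (f x)].

Section HomogeneousComponents.
Variables (K : fieldType) (A : gralg K).

Lemma gr_proj0 n : gr_proj A n 0 = 0.
Proof. by apply: (addrI (gr_proj A n 0)); rewrite -gr_projD !addr0. Qed.

Lemma gr_projN n x : gr_proj A n (- x) = - gr_proj A n x.
Proof. by apply: (addrI (gr_proj A n x)); rewrite -gr_projD !subrr gr_proj0. Qed.

Lemma gr_proj_big n (I : Type) (r : seq I) (F : I -> A) :
  gr_proj A n (\sum_(i <- r) F i) = \sum_(i <- r) gr_proj A n (F i).
Proof.
by elim: r => [|i r IH]; rewrite ?big_nil ?gr_proj0 // !big_cons gr_projD IH.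
Qed.

Lemma gr_projM_hom i j (x y : A) : gr_proj A i x = x -> gr_proj A j y = y ->
  gr_proj A (i + j)%N (x * y) = x * y.
Proof.
move=> hx hy; rewrite gr_projM.
have hi : (i < (i + j).+1)%N by rewrite ltnS leq_addr.
rewrite (bigD1 (Ordinal hi)) //= hx addKn hy big1 ?addr0 // => k nk.
rewrite -hx gr_proj_proj ifF ?mul0r //.
by apply/negbTE; apply: contra nk => /eqP e; apply/eqP/val_inj.
Qed.

Definition gr_homog n : {pred A} := fun x => gr_proj A n x == x.

Lemma gr_homog_closed n : zmod_closed (gr_homog n).
Proof.
split=> [|x y]; rewrite !unfold_in ?gr_proj0 // => /eqP hx /eqP hy.
by rewrite gr_projD gr_projN hx hy.
Qed.
HB.instance Definition _ n :=
  GRing.isZmodClosed.Build A (gr_homog n) (gr_homog_closed n).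

Record gr_comp n := GrComp { gr_val : A; _ : gr_homog n gr_val }.
HB.instance Definition _ n := [isSub for @gr_val n].
HB.instance Definition _ n := [Choice of gr_comp n by <:].
HB.instance Definition _ n := [SubChoice_isSubZmodule of gr_comp n by <:].

Lemma gr_valP n (x : gr_comp n) : gr_proj A n (gr_val x) = gr_val x.
Proof. by case: x => x hx; apply/eqP. Qed.

Lemma gr_mul_subproof i j (x : gr_comp i) (y : gr_comp j) :
  gr_homog (i + j)%N (gr_val x * gr_val y).
Proof. by apply/eqP/gr_projM_hom; exact: gr_valP. Qed.
Definition gr_mul i j (x : gr_comp i) (y : gr_comp j) : gr_comp (i + j)%N :=
  GrComp (gr_mul_subproof x y).

(* A_0 = A / A_{>0} as a left A-module: a acts as multiplication by its
   degree-0 component. *)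
Definition gr0_module := gr_comp 0.
HB.instance Definition _ := GRing.Zmodule.on gr0_module.

Lemma gr0_scale_subproof (a : A) : gr_homog 0 (gr_proj A 0 a).
Proof. by rewrite /gr_homog gr_proj_proj. Qed.
Definition gr0_scale (a : A) (x : gr0_module) : gr0_module :=
  gr_mul (GrComp (gr0_scale_subproof a)) x.

Fact gr0_scaleA a b x : gr0_scale a (gr0_scale b x) = gr0_scale (a * b) x.
Proof.
by apply: val_inj => /=; rewrite gr_projM big_ord1 subn0 mulrA.
Qed.
Fact gr0_scale1 : left_id 1 gr0_scale.
Proof.
move=> x; apply: val_inj => /=.
by rewrite -(rmorph1 (gr_scal A)) gr_proj_scal rmorph1 mul1r.
Qed.
Fact gr0_scaleDr : right_distributive gr0_scale +%R.
Proof. by move=> a x y; apply: val_inj; rewrite /= mulrDr. Qed.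
Fact gr0_scaleDl x : {morph gr0_scale^~ x : a b / a + b}.
Proof. by move=> a b; apply: val_inj; rewrite /= gr_projD mulrDl. Qed.
HB.instance Definition _ := GRing.Zmodule_isLmodule.Build A gr0_module
  gr0_scaleA gr0_scale1 gr0_scaleDr gr0_scaleDl.

End HomogeneousComponents.

Definition projective (A : pzRingType) (P : lmodType A) : Prop :=
  forall (M N : lmodType A) (p : {linear M -> N}) (g : {linear P -> N}),
    (forall y, exists x, p x = y) ->
    exists h : {linear P -> M}, forall x, p (h x) = g x.

Record proj_resolution (A : pzRingType) (M : lmodType A) := ProjResolution {
  res_mod :> nat -> lmodType A;
  res_d : forall n, {linear res_mod n.+1 -> res_mod n};
  res_aug : {linear res_mod 0%N -> M};
  res_projective : forall n, projective (res_mod n);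
  res_aug_surj : forall y, exists x, res_aug x = y;
  res_exact0 : forall x, res_aug x = 0 <-> exists y, x = res_d 0%N y;
  res_exactS : forall n x, res_d n x = 0 <-> exists y, x = res_d n.+1 y
}.
Arguments res_d {A M} _ n.
Arguments res_aug {A M} _.

Section YonedaAlgebra.
Variables (A : pzRingType) (M : lmodType A) (P : proj_resolution M).

(* Ext^n(M, M) is the quotient of the n-cocycles by the n-coboundaries of the
   complex Hom_A(P, M). *)
Definition cocycle n (f : {linear P n -> M}) : Prop :=
  forall x, f (res_d P n x) = 0.

Definition coboundary n : {linear P n -> M} -> Prop :=
  match n with
  | 0%N => fun f => forall x, f x = 0
  | n'.+1 => fun f =>
      exists h : {linear P n' -> M}, forall x, f x = h (res_d P n' x)
  end.

(* A chain map lifting the p-cocycle f along the resolution. *)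
Definition cocycle_lift p (f : {linear P p -> M})
    (F : forall k, {linear P (k + p)%N -> P k}) : Prop :=
  (forall x, res_aug P (F 0%N x) = f x) /\
  (forall k x, res_d P k (F k.+1 x) = F k (res_d P (k + p)%N x)).

End YonedaAlgebra.

(* [ext_algebra A M E]: the graded algebra E is Ext_A(M, M).  For some (hence
   any) projective resolution P of M, [cls n] sends an n-cocycle to its class
   in E_n; it induces a K-linear isomorphism of cocycles modulo coboundaries
   onto E_n, and turns the Yoneda product [g][f] = [g \o F_q], with F a lift of
   f, into the product of E. *)
Definition ext_algebra (K : fieldType) (A : gralg K) (M : lmodType A)
    (E : gralg K) : Prop :=
  exists (P : proj_resolution M) (cls : forall n, {linear P n -> M} -> E),
    (forall n f, cocycle f -> gr_proj E n (cls n f) = cls n f) /\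
    (forall n c (f g h : {linear P n -> M}), cocycle f -> cocycle g ->
       (forall x, h x = gr_scal A c *: f x + g x) ->
       cls n h = gr_scal E c * cls n f + cls n g) /\
    (forall n e, gr_proj E n e = e -> exists2 f, cocycle f & cls n f = e) /\
    (forall n f, cocycle f -> (cls n f = 0 <-> coboundary f)) /\
    cls 0%N (res_aug P) = 1 /\
    (forall p q (f : {linear P p -> M}) (g : {linear P q -> M})
       (h : {linear P (q + p)%N -> M}) F,
       cocycle f -> cocycle g -> cocycle_lift f F ->
       (forall x, h x = g (F q x)) ->
       cls (q + p)%N h = cls q g * cls p f).

Definition koszul_dual (K : fieldType) (A E : gralg K) : Prop :=
  @ext_algebra K A (gr0_module A) E.

Record quiver := Quiver {
  qvert : finType;
  qarr : Type;
  qsrc : qarr -> qvert;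
  qtgt : qarr -> qvert
}.

Section PathAlgebra.
Variables (K : fieldType) (Q : quiver).

(* A pair (x, p) with [walk x p] is the path starting at x and traversing
   successively the arrows listed in p. *)
Fixpoint walk (x : qvert Q) (p : seq (qarr Q)) : bool :=
  if p is a :: p' then (qsrc a == x) && walk (qtgt a) p' else true.

Fixpoint walk_end (x : qvert Q) (p : seq (qarr Q)) : qvert Q :=
  if p is a :: p' then walk_end (qtgt a) p' else x.

Definition pconv := (qvert Q * seq (qarr Q))%type -> K.
HB.instance Definition _ := GRing.Zmodule.on pconv.

Definition pconv1 : pconv := fun u => (nilp u.2)%:R.

(* Paths compose from right to left: in f * g the path of g comes first. *)
Definition pconvM (f g : pconv) : pconv := fun u =>
  \sum_(i < (size u.2).+1)
    f (walk_end u.1 (take i u.2), drop i u.2) * g (u.1, take i u.2).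

Lemma walk_cat x p q : walk x (p ++ q) = walk x p && walk (walk_end x p) q.
Proof. by elim: p x => //= a p IH x; rewrite IH andbA. Qed.

Lemma walk_end_cat x p q : walk_end x (p ++ q) = walk_end (walk_end x p) q.
Proof. by elim: p x => /=. Qed.

Lemma sum_triangle (n : nat) (F : nat -> nat -> K) :
  \sum_(i < n.+1) \sum_(j < (n - i).+1) F i (i + j)%N =
  \sum_(k < n.+1) \sum_(i < k.+1) F i k.
Proof.
transitivity (\sum_(i < n.+1) \sum_(k < n.+1 | (i <= k)%N) F i k).
  apply: eq_bigr => -[i /= hi] _; rewrite ltnS in hi.
  rewrite -(big_mkord (fun k => (i <= k)%N) (F i)).
  rewrite -(big_mkord xpredT (fun j => F i (i + j)%N)).
  rewrite [RHS](big_cat_nat _ (n := i)) //=; last exact: leqW.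
  rewrite [X in _ = X + _]big_nat_cond [X in _ = X + _]big_pred0 ?add0r; last first.
    by move=> k; apply/negP => /andP[/andP[_ h1] h2]; rewrite ltnNge h2 in h1.
  have := @big_addn _ 0 +%R 0 n.+1 i (fun k => i <= k)%N (F i).
  rewrite add0n => ->; rewrite subSn //.
  by apply: eq_big => k; rewrite ?leq_addl // addnC.
rewrite (exchange_big_dep xpredT) //=; apply: eq_bigr => -[k /= hk] _.
rewrite -(big_mkord (fun i => (i <= k)%N) (fun i => F i k)).
rewrite -(big_mkord xpredT (fun i => F i k)).
rewrite [LHS](big_cat_nat _ (n := k.+1)) //=.
rewrite [X in _ + X]big_nat_cond [X in _ + X]big_pred0 ?addr0; last first.
  by move=> i; apply/negP => /andP[/andP[h1 _] h2]; rewrite ltnNge h2 in h1.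
rewrite big_nat_cond [RHS]big_nat_cond; apply: eq_bigl => i.
by case: ltnP => //= h; rewrite andbC.
Qed.

Fact pconvA : associative pconvM.
Proof.
move=> f g h; apply/funext => -[x p]; rewrite /pconvM /=; symmetry.
pose F i k := f (walk_end x (take k p), drop k p) *
  g (walk_end x (take i p), drop i (take k p)) * h (x, take i p).
transitivity (\sum_(i < (size p).+1) \sum_(j < (size p - i).+1) F i (i + j)%N).
  apply: eq_bigr => -[i /= hi] _; rewrite size_drop big_distrl /=.
  apply: eq_bigr => -[j /= hj] _; rewrite /F.
  rewrite drop_drop addnC -walk_end_cat -takeD; congr (_ * g (_, _) * _).
  by rewrite [in RHS]takeD drop_size_cat // size_takel.
rewrite sum_triangle; apply: eq_bigr => -[k /= hk] _; rewrite size_takel //.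
rewrite big_distrr /=; apply: eq_bigr => -[i /= hi] _; rewrite /F mulrA.
by rewrite take_takel.
Qed.

Fact pconv1l : left_id pconv1 pconvM.
Proof.
move=> f; apply/funext => -[x p]; rewrite /pconvM /pconv1 /= big_ord_recr /=.
rewrite drop_size take_size mul1r big1 ?add0r // => -[i hi] _ /=.
by rewrite /nilp size_drop subn_eq0 leqNgt hi mul0r.
Qed.

Fact pconv1r : right_id pconv1 pconvM.
Proof.
move=> f; apply/funext => -[x p]; rewrite /pconvM /pconv1 /= big_ord_recl /=.
rewrite drop0 take0 mulr1 big1 ?addr0 // => -[i hi] _ /=.
by rewrite /nilp size_takel // mulr0.
Qed.

Lemma pconv_addE (f g : pconv) u : (f + g) u = f u + g u. Proof. by []. Qed.
Lemma pconv_oppE (f : pconv) u : (- f) u = - f u. Proof. by []. Qed.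

Fact pconvDl : left_distributive pconvM +%R.
Proof.
move=> f g h; apply/funext => u; rewrite pconv_addE /pconvM -big_split /=.
by apply: eq_bigr => i _; rewrite pconv_addE mulrDl.
Qed.

Fact pconvDr : right_distributive pconvM +%R.
Proof.
move=> f g h; apply/funext => u; rewrite pconv_addE /pconvM -big_split /=.
by apply: eq_bigr => i _; rewrite pconv_addE mulrDr.
Qed.

HB.instance Definition _ := GRing.Zmodule_isPzRing.Build pconv
  pconvA pconv1l pconv1r pconvDl pconvDr.

(* The path algebra: finitely supported functions on paths. *)
Definition pa_supported (f : pconv) : Prop :=
  (forall x p, ~~ walk x p -> f (x, p) = 0) /\
  finite_set [set u | f u != 0].

Definition pa_pred : pred pconv := fun f => `[< pa_supported f >].

Lemma pa_pred_closed : subring_closed pa_pred.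
Proof.
split.
- apply/asboolP; split=> [x [|a p] //|].
  apply: (@sub_finite_set _ _ ((fun x => (x, [::])) @` [set: qvert Q]%classic)).
    move=> [x [|a p]] /=; last by rewrite /1 /= eqxx.
    by move=> _; exists x.
  by apply: finite_image; exact: finite_finset.
- move=> f g /asboolP[f0 ff] /asboolP[g0 gf]; apply/asboolP; split.
    by move=> x p h; rewrite pconv_addE pconv_oppE f0 // g0 // subr0.
  apply: (@sub_finite_set _ _ ([set u | f u != 0] `|` [set u | g u != 0])%classic).
    move=> u /=; case: (eqVneq (f u) 0) => [fu|]; last by left.
    case: (eqVneq (g u) 0) => [gu|]; last by right.
    by rewrite pconv_addE pconv_oppE fu gu subr0 eqxx.
  by rewrite finite_setU.
- move=> f g /asboolP[f0 ff] /asboolP[g0 gf]; apply/asboolP; split.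
    move=> x p h; apply: big1 => -[i hi] _ /=.
    move: h; rewrite -{1}(cat_take_drop i p) walk_cat negb_and.
    by case/orP => h; [rewrite (g0 _ _ h) mulr0|rewrite (f0 _ _ h) mul0r].
  apply: (@sub_finite_set _ _ [set ((v.1, v.2 ++ u.2)) |
      u in [set u | f u != 0] & v in [set u | g u != 0]]%classic).
    move=> [x p] /= h; case: (pselect (exists i : 'I_(size p).+1,
      f (walk_end x (take i p), drop i p) * g (x, take i p) != 0)).
      move=> [i hi].
      exists (walk_end x (take i p), drop i p).
        by apply: contraNneq hi => /= ->; rewrite mul0r.
      exists (x, take i p); last by rewrite /= cat_take_drop.
      by apply: contraNneq hi => /= ->; rewrite mulr0.
    move=> nex; case/eqP: h; apply: big1 => i _; apply/eqP.
    by apply: contrapT => /negP hi; apply: nex; exists i.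
  exact: finite_image2.
Qed.

Record path_alg := PathAlg { pa_coef : pconv; _ : pa_pred pa_coef }.
HB.instance Definition _ := [isSub for pa_coef].
HB.instance Definition _ := [Choice of path_alg by <:].
HB.instance Definition _ :=
  GRing.SubChoice_isSubPzRing.Build pconv pa_pred path_alg pa_pred_closed.

Definition path_elt_fun (x : qvert Q) (p : seq (qarr Q)) : pconv :=
  fun u => if `[< u = (x, p) >] then (walk x p)%:R else 0.
Lemma path_elt_subproof x p : pa_pred (path_elt_fun x p).
Proof.
apply/asboolP; split.
  move=> y q h; rewrite /path_elt_fun; case: asboolP => // -[e1 e2].
  by rewrite -e1 -e2 (negbTE h).
apply: (@sub_finite_set _ _ [set (x, p)]%classic); last exact: finite_set1.
by move=> u /=; rewrite /path_elt_fun; case: asboolP => //; rewrite eqxx.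
Qed.
(* The basis element of the path (x, p); 0 if (x, p) is not a path. *)
Definition path_elt x p : path_alg := PathAlg (path_elt_subproof x p).

Definition pa_scal_fun (c : K) : pconv := fun u => if nilp u.2 then c else 0.
Lemma pa_scal_subproof c : pa_pred (pa_scal_fun c).
Proof.
apply/asboolP; split=> [x [|a p] //|].
apply: (@sub_finite_set _ _ ((fun x => (x, [::])) @` [set: qvert Q]%classic)).
  move=> [x [|a p]] /=; last by rewrite /pa_scal_fun /= eqxx.
  by move=> _; exists x.
by apply: finite_image; exact: finite_finset.
Qed.
Definition pa_scal c : path_alg := PathAlg (pa_scal_subproof c).

Lemma pa_scalMl c f u : pa_coef (pa_scal c * f) u = c * pa_coef f u.
Proof.
case: u => x p; rewrite [LHS]big_ord_recr /= drop_size take_size big1 ?add0r //.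
move=> -[i hi] _ /=.
by rewrite /pa_scal_fun /= /nilp size_drop subn_eq0 leqNgt hi mul0r.
Qed.

Lemma pa_scalMr c f u : pa_coef (f * pa_scal c) u = pa_coef f u * c.
Proof.
case: u => x p; rewrite [LHS]big_ord_recl /= drop0 take0 big1 ?addr0 //.
by move=> -[i hi] _ /=; rewrite /pa_scal_fun /= /nilp size_takel // mulr0.
Qed.

Fact pa_scal_is_zmod_morphism : zmod_morphism pa_scal.
Proof.
move=> c d; apply: val_inj; apply/funext => -[x [|a p]] //=.
by rewrite pconv_addE pconv_oppE /pa_scal_fun /= subr0.
Qed.
Fact pa_scal_is_monoid_morphism : monoid_morphism pa_scal.
Proof.
split=> [|c d]; apply: val_inj; apply/funext => u.
  by rewrite /= [RHS](_ : _ = (nilp u.2)%:R) // /pa_scal_fun; case: nilp.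
rewrite [RHS](pa_scalMl c (pa_scal d)) /= /pa_scal_fun.
by case: nilp => //; rewrite mulr0.
Qed.
HB.instance Definition _ :=
  GRing.isZmodMorphism.Build K path_alg pa_scal pa_scal_is_zmod_morphism.
HB.instance Definition _ :=
  GRing.isMonoidMorphism.Build K path_alg pa_scal pa_scal_is_monoid_morphism.

(* The grading for which an arrow a has degree wt a. *)
Variable wt : qarr Q -> nat.
Definition pweight (p : seq (qarr Q)) : nat := sumn (map wt p).

Definition pa_proj_fun n (f : pconv) : pconv :=
  fun u => if pweight u.2 == n then f u else 0.
Lemma pa_proj_subproof n (f : path_alg) : pa_pred (pa_proj_fun n (pa_coef f)).
Proof.
case: f => f /= /asboolP[f0 ff]; apply/asboolP; split.
  by move=> x p h; rewrite /pa_proj_fun f0 // if_same.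
apply: sub_finite_set ff => u /=.
by rewrite /pa_proj_fun; case: ifP => //; rewrite eqxx.
Qed.
Definition pa_proj n (f : path_alg) : path_alg := PathAlg (pa_proj_subproof n f).

Lemma pa_coef_sum (I : Type) (r : seq I) (F : I -> path_alg) u :
  pa_coef (\sum_(i <- r) F i) u = \sum_(i <- r) pa_coef (F i) u.
Proof. by elim: r => [|i r IH]; rewrite ?big_nil // !big_cons -IH. Qed.

Fact pa_scalC c f : pa_scal c * f = f * pa_scal c.
Proof.
apply: val_inj; apply/funext => u.
by rewrite [LHS]pa_scalMl [RHS]pa_scalMr mulrC.
Qed.
Fact pa_projD n f g : pa_proj n (f + g) = pa_proj n f + pa_proj n g.
Proof.
apply: val_inj; apply/funext => u; rewrite /= pconv_addE.
by rewrite /pa_proj_fun; case: ifP => //; rewrite addr0.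
Qed.
Fact pa_proj_scal n c : pa_proj n (pa_scal c) = if n == 0%N then pa_scal c else 0.
Proof.
apply: val_inj; apply/funext => -[x p] /=; rewrite /pa_proj_fun /pa_scal_fun /=.
case: p => [|a p] /=; rewrite /pweight /= 1?eq_sym; last first.
  by rewrite if_same; case: (n == 0%N).
by case: (n == 0%N).
Qed.
Fact pa_proj_proj i j f : pa_proj i (pa_proj j f) = if i == j then pa_proj j f else 0.
Proof.
apply: val_inj; apply/funext => u; rewrite /= /pa_proj_fun.
case: (eqVneq i j) => [->|ne] /=.
  by rewrite /pa_proj_fun; case: (_ == j).
by case: eqP => // ->; rewrite (negbTE ne).
Qed.
Fact pa_projM n f g :
  pa_proj n (f * g) = \sum_(i < n.+1) pa_proj i f * pa_proj (n - i)%N g.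
Proof.
apply: val_inj; apply/funext => -[x p].
rewrite [RHS]pa_coef_sum /= /pa_proj_fun /=.
under eq_bigr do rewrite /GRing.mul /= /pconvM /=.
rewrite exchange_big /=.
have E (k : 'I_(size p).+1) :
    pweight p = (pweight (drop k p) + pweight (take k p))%N.
  by rewrite addnC /pweight -sumn_cat -map_cat cat_take_drop.
case: eqP => [en|en].
  apply: eq_bigr => k _; rewrite /pa_proj_fun /=.
  have hk : (pweight (drop k p) < n.+1)%N by rewrite ltnS -en (E k) leq_addr.
  rewrite (bigD1 (Ordinal hk)) //= eqxx.
  have -> : (n - pweight (drop k p))%N = pweight (take k p).
    by rewrite -en (E k) addKn.
  rewrite eqxx big1 ?addr0 // => i ni.
  case: eqP => [e|]; last by rewrite mul0r.
  by case/eqP: ni; apply: val_inj; rewrite /= e.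
symmetry; apply: big1 => k _; apply: big1 => -[i /= hi] _; rewrite /pa_proj_fun /=.
case: eqP => [e1|]; last by rewrite mul0r.
case: eqP => [e2|]; last by rewrite mulr0.
by case: en; rewrite (E k) e1 e2 subnKC.
Qed.
Fact pa_proj_sum f : exists N, f = \sum_(i < N) pa_proj i f.
Proof.
have [N hN] : exists N, forall u, pa_coef f u != 0 -> (pweight u.2 < N)%N.
  case: f => f /= /asboolP[_ /finite_setP ff].
  have {ff} ff : finite_set [set u | f u != 0]%classic by apply/finite_setP.
  have [s hs] : exists s : seq nat, forall u, f u != 0 -> pweight u.2 \in s.
    have /finite_seqP[s hs] :=
      finite_image (fun u : qvert Q * seq (qarr Q) => pweight u.2) ff.
    exists s => u fu.
    have : ((fun u => pweight u.2) @` [set u | f u != 0])%classic (pweight u.2).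
      by exists u.
    by rewrite hs.
  exists (\max_(i <- s) i).+1 => u /hs us; rewrite ltnS.
  exact: (@leq_bigmax_seq _ _ xpredT id).
exists N; apply: val_inj; apply/funext => u; rewrite [RHS]pa_coef_sum /=.
case: (eqVneq (pa_coef f u) 0) => [fu|fu].
  by rewrite big1 // => i _; rewrite /pa_proj_fun fu if_same.
rewrite (bigD1 (Ordinal (hN _ fu))) //= /pa_proj_fun eqxx big1 ?addr0 //.
move=> i ni; case: eqP => // e; case/eqP: ni.
by apply: val_inj; rewrite /= e.
Qed.

Definition path_gralg : gralg K :=
  @Gralg K path_alg pa_scal pa_proj
    pa_scalC pa_projD pa_proj_scal pa_proj_proj pa_projM pa_proj_sum.

End PathAlgebra.

Inductive ideal_gen (A : pzRingType) (S : set A) : A -> Prop :=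
| ideal_gen_in x : S x -> ideal_gen S x
| ideal_gen0 : ideal_gen S 0
| ideal_genD x y : ideal_gen S x -> ideal_gen S y -> ideal_gen S (x + y)
| ideal_genMl a x : ideal_gen S x -> ideal_gen S (a * x)
| ideal_genMr a x : ideal_gen S x -> ideal_gen S (x * a).

Section Quotient.
Variables (A : pzRingType) (S : set A).

Definition ideal_pred : {pred A} := fun x => `[< ideal_gen S x >].
Lemma ideal_pred_closed : zmod_closed ideal_pred.
Proof.
split; first by apply/asboolP; exact: ideal_gen0.
move=> x y /asboolP hx /asboolP hy; apply/asboolP; apply: ideal_genD => //.
by rewrite -mulN1r; exact: ideal_genMl.
Qed.
HB.instance Definition _ :=
  GRing.isZmodClosed.Build A ideal_pred ideal_pred_closed.

Definition quot_ring := Quotient.quot (ideal_pred : zmodClosed A).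
HB.instance Definition _ := GRing.Zmodule.on quot_ring.
Definition quot_pi (x : A) : quot_ring := \pi_(quot_ring)%qT x.

Lemma quot_pi_eq x y : quot_pi x = quot_pi y <-> ideal_gen S (x - y).
Proof.
split=> [/eqP|h]; last apply/eqP.
  by rewrite /quot_pi -Quotient.idealrBE => /asboolP.
by rewrite /quot_pi -Quotient.idealrBE; apply/asboolP.
Qed.

Lemma quot_piD x y : quot_pi (x + y) = quot_pi x + quot_pi y.
Proof. exact: (Quotient.pi_add ideal_pred). Qed.
Lemma quot_pi0 : quot_pi 0 = 0.
Proof. by apply: (addrI (quot_pi 0)); rewrite -quot_piD !addr0. Qed.
Lemma quot_piN x : quot_pi (- x) = - quot_pi x.
Proof. by apply: (addrI (quot_pi x)); rewrite -quot_piD !subrr quot_pi0. Qed.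

Definition quot_repr (x : quot_ring) : A := repr x.
Lemma quot_reprK x : quot_pi (quot_repr x) = x.
Proof. exact: reprK. Qed.
Lemma quot_piK x : ideal_gen S (quot_repr (quot_pi x) - x).
Proof. by apply/quot_pi_eq; rewrite quot_reprK. Qed.

Definition quot_mul (x y : quot_ring) : quot_ring :=
  quot_pi (quot_repr x * quot_repr y).
Lemma quot_pi_mul x y : quot_mul (quot_pi x) (quot_pi y) = quot_pi (x * y).
Proof.
apply/quot_pi_eq.
set x' := quot_repr _; set y' := quot_repr _.
have -> : x' * y' - x * y = (x' - x) * y' + x * (y' - y).
  by rewrite mulrBl mulrBr addrA subrK.
by apply: ideal_genD; [apply: ideal_genMr|apply: ideal_genMl]; exact: quot_piK.
Qed.

Fact quot_mulA : associative quot_mul.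
Proof.
move=> x y z; rewrite -[x]quot_reprK -[y]quot_reprK -[z]quot_reprK.
by rewrite !quot_pi_mul mulrA.
Qed.
Fact quot_mul1l : left_id (quot_pi 1) quot_mul.
Proof. by move=> x; rewrite -[x]quot_reprK quot_pi_mul mul1r. Qed.
Fact quot_mul1r : right_id (quot_pi 1) quot_mul.
Proof. by move=> x; rewrite -[x]quot_reprK quot_pi_mul mulr1. Qed.
Fact quot_mulDl : left_distributive quot_mul +%R.
Proof.
move=> x y z; rewrite -[x]quot_reprK -[y]quot_reprK -[z]quot_reprK.
by rewrite -quot_piD !quot_pi_mul -quot_piD mulrDl.
Qed.
Fact quot_mulDr : right_distributive quot_mul +%R.
Proof.
move=> x y z; rewrite -[x]quot_reprK -[y]quot_reprK -[z]quot_reprK.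
by rewrite -quot_piD !quot_pi_mul -quot_piD mulrDr.
Qed.
HB.instance Definition _ := GRing.Zmodule_isPzRing.Build quot_ring
  quot_mulA quot_mul1l quot_mul1r quot_mulDl quot_mulDr.

Lemma quot_piM x y : quot_pi (x * y) = quot_pi x * quot_pi y.
Proof. by rewrite -quot_pi_mul. Qed.

End Quotient.

Section GradedQuotient.
Variables (K : fieldType) (A : gralg K) (S : set A).
Hypothesis homogS : forall x, S x -> exists n, gr_proj A n x = x.

Local Notation Q := (quot_ring S).
Local Notation pi := (@quot_pi A S).

Lemma ideal_gen_proj n x : ideal_gen S x -> ideal_gen S (gr_proj A n x).
Proof.
have bigI (I : Type) (r : seq I) (F : I -> A) :
    (forall i, ideal_gen S (F i)) -> ideal_gen S (\sum_(i <- r) F i).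
  by move=> h; apply: big_ind => //; [exact: ideal_gen0|exact: ideal_genD].
move=> hx; elim: hx n => {x} [x Sx|| x y _ hx _ hy | a x _ hx | a x _ hx] n.
- have [d hd] := homogS Sx; rewrite -hd gr_proj_proj.
  by case: ifP => _; [rewrite hd; exact: ideal_gen_in|exact: ideal_gen0].
- by rewrite gr_proj0; exact: ideal_gen0.
- by rewrite gr_projD; exact: ideal_genD.
- by rewrite gr_projM; apply: bigI => i; exact: ideal_genMl.
- by rewrite gr_projM; apply: bigI => i; exact: ideal_genMr.
Qed.

Definition quot_scal c : Q := pi (gr_scal A c).
Fact quot_scal_is_zmod_morphism : zmod_morphism quot_scal.
Proof. by move=> c d; rewrite /quot_scal rmorphB quot_piD quot_piN. Qed.
Fact quot_scal_is_monoid_morphism : monoid_morphism quot_scal.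
Proof. by split=> [|c d]; rewrite /quot_scal ?rmorph1 // rmorphM quot_piM. Qed.
HB.instance Definition _ :=
  GRing.isZmodMorphism.Build K Q quot_scal quot_scal_is_zmod_morphism.
HB.instance Definition _ :=
  GRing.isMonoidMorphism.Build K Q quot_scal quot_scal_is_monoid_morphism.

Definition quot_proj n (x : Q) : Q := pi (gr_proj A n (quot_repr x)).

Lemma quot_proj_pi n x : quot_proj n (pi x) = pi (gr_proj A n x).
Proof.
apply/quot_pi_eq; rewrite -gr_projN -gr_projD.
by apply: ideal_gen_proj; exact: quot_piK.
Qed.

Lemma quot_pi_sum (I : Type) (r : seq I) (F : I -> A) :
  pi (\sum_(i <- r) F i) = \sum_(i <- r) pi (F i).
Proof.
by elim: r => [|i r IH]; rewrite ?big_nil ?quot_pi0 // !big_cons quot_piD IH.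
Qed.

Fact quot_scalC c x : quot_scal c * x = x * quot_scal c.
Proof. by rewrite -[x]quot_reprK -!quot_piM gr_scalC. Qed.
Fact quot_projD n x y : quot_proj n (x + y) = quot_proj n x + quot_proj n y.
Proof.
rewrite -[x]quot_reprK -[y]quot_reprK -quot_piD !quot_proj_pi.
by rewrite gr_projD quot_piD.
Qed.
Fact quot_proj_scal n c :
  quot_proj n (quot_scal c) = if n == 0%N then quot_scal c else 0.
Proof. by rewrite quot_proj_pi gr_proj_scal; case: ifP; rewrite ?quot_pi0. Qed.
Fact quot_proj_proj i j x :
  quot_proj i (quot_proj j x) = if i == j then quot_proj j x else 0.
Proof.
rewrite -[x]quot_reprK !quot_proj_pi gr_proj_proj.
by case: ifP; rewrite ?quot_pi0.
Qed.
Fact quot_projM n x y :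
  quot_proj n (x * y) = \sum_(i < n.+1) quot_proj i x * quot_proj (n - i)%N y.
Proof.
rewrite -[x]quot_reprK -[y]quot_reprK -quot_piM quot_proj_pi gr_projM quot_pi_sum.
by apply: eq_bigr => i _; rewrite quot_piM !quot_proj_pi.
Qed.
Fact quot_proj_sum x : exists N, x = \sum_(i < N) quot_proj i x.
Proof.
have [N hN] := gr_proj_sum (quot_repr x); exists N.
rewrite -[LHS]quot_reprK {1}hN quot_pi_sum.
by apply: eq_bigr => i _; rewrite -{2}[x]quot_reprK quot_proj_pi.
Qed.

Definition quot_gralg : gralg K :=
  @Gralg K Q quot_scal quot_proj quot_scalC quot_projD quot_proj_scal
    quot_proj_proj quot_projM quot_proj_sum.

End GradedQuotient.

Section QuadraticDual.
Variables (K : fieldType) (A : gralg K).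

(* A_1^* = Hom_{A_0}(A_1, A_0), the left A_0-linear maps.  It is an
   A_0-bimodule by (a f)(v) = f(v a) and (f a)(v) = f(v) a. *)
Record gr1_dual := Gr1Dual {
  dual_fun :> {additive gr_comp A 1 -> gr_comp A 0};
  dual_linear : forall (a : gr_comp A 0) (v : gr_comp A 1),
    dual_fun (gr_mul a v) = gr_mul a (dual_fun v)
}.

(* The free algebra on the disjoint union of A_0 (in degree 0) and A_1^* (in
   degree 1) is the path algebra of the quiver with one vertex and these
   loops. *)
Definition dual_quiver : quiver :=
  @Quiver unit (gr_comp A 0 + gr1_dual)%type (fun=> tt) (fun=> tt).
Definition dual_weight (a : qarr dual_quiver) : nat :=
  if a is inr _ then 1 else 0.
Definition dual_free : gralg K := path_gralg K dual_weight.

Definition dual_gen0 (a : gr_comp A 0) : dual_free :=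
  path_elt K (Q := dual_quiver) tt [:: inl a].
Definition dual_gen1 (f : gr1_dual) : dual_free :=
  path_elt K (Q := dual_quiver) tt [:: inr f].

(* Relations presenting the tensor algebra T_{A_0} A_1^*. *)
Inductive tensor_rel : dual_free -> dual_free -> Prop :=
| tensor_scal c a : gr_val a = gr_scal A c ->
    tensor_rel (dual_gen0 a) (gr_scal dual_free c)
| tensor_add0 a b : tensor_rel (dual_gen0 (a + b)) (dual_gen0 a + dual_gen0 b)
| tensor_mul0 (a b : gr_comp A 0) :
    tensor_rel (dual_gen0 (gr_mul a b)) (dual_gen0 a * dual_gen0 b)
| tensor_add1 (f g h : gr1_dual) : (forall v, h v = f v + g v) ->
    tensor_rel (dual_gen1 h) (dual_gen1 f + dual_gen1 g)
| tensor_mull a (f h : gr1_dual) : (forall v, h v = f (gr_mul v a)) ->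
    tensor_rel (dual_gen1 h) (dual_gen0 a * dual_gen1 f)
| tensor_mulr a (f h : gr1_dual) : (forall v, h v = gr_mul (f v) a) ->
    tensor_rel (dual_gen1 h) (dual_gen1 f * dual_gen0 a).

(* A_1^* (x) A_1^* = (A_1 (x) A_1)^* by (f (x) g)(v (x) w) = g (v f(w)), the
   pairing compatible with the above bimodule structure.  R_2 is the kernel of
   the multiplication A_1 (x)_{A_0} A_1 -> A_2, so r ranges over
   representatives of its elements. *)
Definition dual_pairing (f g : gr1_dual) (v w : gr_comp A 1) : gr_comp A 0 :=
  g (gr_mul v (f w)).
Definition quad_relation (r : seq (gr_comp A 1 * gr_comp A 1)) : Prop :=
  \sum_(vw <- r) gr_mul vw.1 vw.2 = 0.
Definition annihilates (u : seq (gr1_dual * gr1_dual)) : Prop :=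
  forall r, quad_relation r ->
    \sum_(fg <- u) \sum_(vw <- r) dual_pairing fg.1 fg.2 vw.1 vw.2 = 0.

Definition quad_dual_relations : set dual_free := [set x |
  (exists l r, tensor_rel l r /\ x = l - r) \/
  (exists2 u, annihilates u &
     x = \sum_(fg <- u) dual_gen1 fg.1 * dual_gen1 fg.2)]%classic.

Lemma dual_gen_proj n p :
  gr_proj dual_free n (path_elt K (Q := dual_quiver) tt p : dual_free) =
  if pweight dual_weight p == n then path_elt K (Q := dual_quiver) tt p else 0.
Proof.
apply: val_inj; apply/funext => -[[] q] /=.
rewrite /pa_proj_fun /= /path_elt_fun; case: asboolP => [[->]|ne].
  by case: ifP => //= _; rewrite /path_elt_fun; case: asboolP.
rewrite if_same; case: ifP => // _ /=; rewrite /path_elt_fun.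
by case: asboolP.
Qed.
Lemma dual_gen0_hom a : gr_proj dual_free 0 (dual_gen0 a) = dual_gen0 a.
Proof. by rewrite dual_gen_proj. Qed.
Lemma dual_gen1_hom f : gr_proj dual_free 1 (dual_gen1 f) = dual_gen1 f.
Proof. by rewrite dual_gen_proj. Qed.

Lemma quad_dual_relations_homog x :
  quad_dual_relations x -> exists n, gr_proj dual_free n x = x.
Proof.
have hB n (l r : dual_free) : gr_proj _ n l = l -> gr_proj _ n r = r ->
    exists n, gr_proj dual_free n (l - r) = l - r.
  by move=> hl hr; exists n; rewrite gr_projD gr_projN hl hr.
have h0 := dual_gen0_hom; have h1 := dual_gen1_hom.
have hD n (l r : dual_free) : gr_proj _ n l = l -> gr_proj _ n r = r ->
    gr_proj dual_free n (l + r) = l + r.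
  by move=> hl hr; rewrite gr_projD hl hr.
case=> [[l [r [lr ->]]]|[u _ ->]].
  case: lr => *.
  - by apply: (hB 0%N); rewrite ?h0 ?gr_proj_scal.
  - by apply: (hB 0%N); rewrite ?h0 //; apply: hD; rewrite h0.
  - by apply: (hB 0%N); rewrite ?h0 //; apply: (gr_projM_hom (i := 0) (j := 0)).
  - by apply: (hB 1%N); rewrite ?h1 //; apply: hD; rewrite h1.
  - by apply: (hB 1%N); rewrite ?h1 //; apply: (gr_projM_hom (i := 0) (j := 1)).
  - by apply: (hB 1%N); rewrite ?h1 //; apply: (gr_projM_hom (i := 1) (j := 0)).
exists 2%N; rewrite gr_proj_big; apply: eq_bigr => fg _.
exact: (gr_projM_hom (i := 1) (j := 1)).
Qed.

Definition quadratic_dual : gralg K :=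
  quot_gralg (A := dual_free) quad_dual_relations_homog.

End QuadraticDual.

Section DihedralAlgebra.
Variables (R : realType) (m : nat).

(* zeta = exp (2 i pi / 2m) *)
Definition zeta : R[i] :=
  let theta := 2 * pi / (2 * m)%N%:R in Complex (cos theta) (sin theta).

(* [n]_zeta; the quotient is real, which is why taking the real part is
   harmless. *)
Definition qint (n : nat) : R :=
  complex.Re ((zeta ^+ n - zeta ^- n) / (zeta - zeta^-1)).

Variable W : finGroupType.

(* (W, {s, t}) is the Coxeter system of type I_2(m): W is the dihedral group of
   order 2m generated by the involutions s and t, with st of order m. *)
Definition dihedral_coxeter_system (s t : W) : Prop :=
  [/\ #[s]%g = 2%N, #[t]%g = 2%N, #[s * t]%g = m & <<[set s; t]>>%g = [set: W]].

(* The alternating product x y x .. of k factors: _s k is [alt s t k] and _t k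
   is [alt t s k]. *)
Fixpoint alt (x y : W) (k : nat) : W :=
  if k is k'.+1 then (x * alt y x k')%g else 1%g.

Variables s t : W.

(* The least n such that w is a product of n elements of {s, t}; it is less
   than #|W| when s and t generate W. *)
Definition cox_length (w : W) : nat :=
  find (fun n => w \in ([set s; t] ^+ n)%g) (iota 0 #|W|).

Definition hasse_adj (w w' : W) : bool :=
  (cox_length w == (cox_length w').+1) || (cox_length w' == (cox_length w).+1).

Definition hasse_arrow := {a : W * W | hasse_adj a.1 a.2}.
Definition hasse_quiver : quiver :=
  @Quiver W hasse_arrow (fun a => (val a).1) (fun a => (val a).2).

Definition hasse_path_alg : gralg R := path_gralg R (fun _ : qarr hasse_quiver => 1%N).

(* The path (w, w', w''), as a product of arrows from right to left. *)
Definition arrow (w w' : W) : hasse_path_alg :=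
  if insub (w, w') is Some a
  then path_elt R (Q := hasse_quiver) w [:: a] else 0.
Definition path2 (w w' w'' : W) : hasse_path_alg := arrow w' w'' * arrow w w'.

Local Notation "c *' p" := (gr_scal hasse_path_alg c * p) (at level 40).

Inductive half_rel (a b : W) : hasse_path_alg -> hasse_path_alg -> Prop :=
| rel1 : half_rel a b (path2 1%g a 1%g) 0
| rel2 : half_rel a b (path2 a (a * b)%g a) 0
| rel3 i : (2 <= i <= m.-1)%N ->
    half_rel a b (path2 (alt a b i) (alt a b i.+1) (alt a b i))
      ((qint i.-1 / qint i) *' path2 (alt a b i) (alt a b i.-1) (alt a b i))
| rel4 : half_rel a b (path2 a (b * a)%g a) (- qint 2 *' path2 a 1%g a)
| rel5 i : (2 <= i <= m.-1)%N ->
    half_rel a b (path2 (alt a b i) (alt b a i.+1) (alt a b i))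
      ((qint i.-1 - qint i.+1) *' path2 (alt a b i) (alt a b i.-1) (alt a b i)
       - (qint i.+1 / qint i) *' path2 (alt a b i) (alt b a i.-1) (alt a b i))
| rel6 : half_rel a b (path2 a (a * b)%g b) (path2 a 1%g b)
| rel7 : half_rel a b (path2 a (b * a)%g b) (path2 a 1%g b)
| rel8 i : (2 <= i <= m.-1)%N ->
    half_rel a b (path2 (alt a b i) (alt a b i.+1) (alt b a i))
      ((qint i)^-1 *' path2 (alt a b i) (alt a b i.-1) (alt b a i)
       + path2 (alt a b i) (alt b a i.-1) (alt b a i))
| rel9 i : (2 <= i <= m.-1)%N ->
    half_rel a b (path2 (alt a b i) (alt b a i.+1) (alt b a i))
      (path2 (alt a b i) (alt a b i.-1) (alt b a i)
       + (qint i)^-1 *' path2 (alt a b i) (alt b a i.-1) (alt b a i))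
| rel10 j : (j <= m - 2)%N ->
    half_rel a b (path2 (alt a b j) (alt a b j.+1) (alt a b j.+2))
      (path2 (alt a b j) (alt b a j.+1) (alt a b j.+2))
| rel11 j : (j <= m - 2)%N ->
    half_rel a b (path2 (alt a b j) (alt a b j.+1) (alt b a j.+2))
      (path2 (alt a b j) (alt b a j.+1) (alt b a j.+2))
| rel12 j : (j <= m - 2)%N ->
    half_rel a b (path2 (alt a b j.+2) (alt a b j.+1) (alt a b j))
      (path2 (alt a b j.+2) (alt b a j.+1) (alt a b j))
| rel13 j : (j <= m - 2)%N ->
    half_rel a b (path2 (alt a b j.+2) (alt a b j.+1) (alt b a j))
      (path2 (alt a b j.+2) (alt b a j.+1) (alt b a j)).

Definition dihedral_relations : set hasse_path_alg := [set x |
  exists l r, (half_rel s t l r \/ half_rel t s l r) /\ x = l - r]%classic.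

Lemma arrow_hom w w' : gr_proj hasse_path_alg 1 (arrow w w') = arrow w w'.
Proof.
rewrite /arrow; case: insub => [a|]; last exact: gr_proj0.
apply: val_inj; apply/funext => -[x p] /=; rewrite /pa_proj_fun /= /path_elt_fun.
by case: ifP => //; case: asboolP => // -[_ ->].
Qed.

Lemma path2_hom w w' w'' :
  gr_proj hasse_path_alg 2 (path2 w w' w'') = path2 w w' w''.
Proof. by apply: (gr_projM_hom (i := 1) (j := 1)); exact: arrow_hom. Qed.

Lemma dihedral_relations_homog x :
  dihedral_relations x -> exists n, gr_proj hasse_path_alg n x = x.
Proof.
have hD (l r : hasse_path_alg) : gr_proj _ 2 l = l -> gr_proj _ 2 r = r ->
    gr_proj hasse_path_alg 2 (l + r) = l + r.
  by move=> hl hr; rewrite gr_projD hl hr.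
have hN (l : hasse_path_alg) : gr_proj _ 2 l = l ->
    gr_proj hasse_path_alg 2 (- l) = - l.
  by move=> hl; rewrite gr_projN hl.
have hZ c (l : hasse_path_alg) : gr_proj _ 2 l = l ->
    gr_proj hasse_path_alg 2 (c *' l) = c *' l.
  by move=> hl; apply: (gr_projM_hom (i := 0)) => //; rewrite gr_proj_scal.
have h a b l r : half_rel a b l r ->
    gr_proj hasse_path_alg 2 l = l /\ gr_proj hasse_path_alg 2 r = r.
  by case=> *; split; do ?[exact: path2_hom | exact: gr_proj0
                          | apply: hD | apply: hN | apply: hZ].
case=> l [r [lr ->]]; exists 2%N.
by case: lr => /h[hl hr]; apply: hD => //; apply: hN.
Qed.

Definition dihedral_alg : gralg R := quot_gralg dihedral_relations_homog.

End DihedralAlgebra.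

(* Main.v *)
Require Import Defs.
From HB Require Import structures.
From mathcomp Require Import all_boot all_order all_algebra all_fingroup cyclic.
From mathcomp Require Import generic_quotient ring_quotient complex.
From mathcomp Require Import boolp classical_sets cardinality.
From mathcomp Require Import reals trigo.
From mathcomp Require Import zify ring.

(** The dihedral group, in its strong Bruhat order, is a ladder: one element at
   the bottom and at the top, two on each level in between, and all elements of
   different levels comparable. The relations say that a monotone path depends
   only on its ends, and they rewrite a path over a peak as a combination of
   paths through valleys. So the paths which descend from x to q and then
   ascend to z, for q below x and z, span the algebra.

   They are a basis because the coefficients of the peak relations come from
   the Chevalley formula: the algebra acts on the span of the pairs (x, a) with
   a <= x, where an ascending arrow fixes the class a and a descending one
   multiplies it by a weight attached to the edge (rep_ladder_relations,
   ladder_algebra_exists). Everything else is proved for any ladder_algebra,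
   the axiomatic description of such a basis, and uses only two symmetries of
   the coordinates of peaks in terms of valleys: they are invariant under
   reversal of paths, and under the duality of the ladder, which exchanges peaks
   and valleys, the matrix of coordinates is transposed up to signs.

   Quadratic duality. With a sign on each edge, the second symmetry says that
   the relations at a pair of vertices and those at the dual pair are orthogonal
   (path2_orth, path2_relations_orth). Therefore sending the arrow from x to y
   to the signed functional of the arrow from dual y to dual x respects
   relations, and so does the inverse map (ladder_algebra_self_dual).

   Koszulness. The Koszul complex has in degree n one summand A e_(dual z)
   for each basis element of degree n, where z is the end of its path; its
   differential squares to zero by the same orthogonality (kdiff_kdiff). In
   coordinates it splits according to two vertices x and y, and is indexed by q,
   z and w with q <= x, q <= z <= w and y <= w. One part of the differential
   moves z in the interval from q to w, the other lowers q. Intervals in a ladder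
   are acyclic unless they have one element, so that only the terms with
   q = z = w are left, on which the differential is that of the interval from y
   to x (dbl_exact). The complex is thus a minimal projective resolution of A_0,
   and Ext in degree n is the space of forms on its n-th term, which has the
   basis of A in degree n. Any lift of a cocycle is determined to the extent
   needed by the lifting equations, and it gives the product of A (khead_lift,
   koszul_dual_self). So the algebra is its own Koszul dual. *)

Set Implicit Arguments.
Unset Strict Implicit.
Unset Printing Implicit Defensive.

Import Order.TTheory GRing.Theory Num.Theory.
Local Open Scope ring_scope.

(** * Sums and graded algebras *)

Lemma big_only (M : nmodType) (I : finType) (i : I) (F : I -> M) :
  (forall j, j != i -> F j = 0) -> \sum_j F j = F i.
Proof. by move=> h; rewrite (bigD1 i) //= big1 ?addr0 // => j /h. Qed.

Lemma sum_enum_val (M : nmodType) (V : finType) (F : V -> M) :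
  \sum_(j < #|V|) F (enum_val j) = \sum_w F w.
Proof.
by rewrite -big_enum_val.
Qed.

(** This is the inclusion criterion for row spaces: k lies in the row space of N
   as soon as it vanishes on the kernel of N. *)
Lemma functional_factor (K : fieldType) (V Q : finType) (N : V -> Q -> K) (k : V -> K) :
  (forall r : V -> K, (forall q, \sum_w r w * N w q = 0) -> \sum_w r w * k w = 0) ->
  exists c : Q -> K, forall w, k w = \sum_q c q * N w q.
Proof.
move=> h.
pose M : 'M[K]_(#|Q|, #|V|) := \matrix_(i, j) N (enum_val j) (enum_val i).
pose kv : 'rV[K]_#|V| := \row_j k (enum_val j).
have /submxP[D kD] : (kv <= M)%MS.
  rewrite submxE; apply/eqP/rowP => j; rewrite !mxE.
  rewrite -[RHS](h (fun w => cokermx M (enum_rank w) j)) => [|q].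
    rewrite -[RHS]sum_enum_val; apply: eq_bigr => i _.
    by rewrite mxE enum_valK mulrC.
  have := congr1 (fun X : 'M[K]_(_, _) => X (enum_rank q) j) (mulmx_coker M).
  rewrite !mxE => e; rewrite -[RHS]e -[LHS]sum_enum_val; apply: eq_bigr => i _.
  by rewrite [M _ _]mxE !enum_valK enum_rankK mulrC.
exists (fun q => D 0 (enum_rank q)) => w.
have := congr1 (fun X : 'rV[K]_(_) => X 0 (enum_rank w)) kD.
rewrite !mxE enum_rankK => ->; rewrite -[RHS]sum_enum_val; apply: eq_bigr => i _.
by rewrite !mxE enum_rankK enum_valK.
Qed.

Lemma scalCA (K : fieldType) (B : gralg K) c (a b : B) :
  a * (gr_scal B c * b) = gr_scal B c * (a * b).
Proof. by rewrite mulrA -gr_scalC -mulrA. Qed.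

Lemma gr_projZ (K : fieldType) (B : gralg K) n c (a : B) :
  gr_proj B n (gr_scal B c * a) = gr_scal B c * gr_proj B n a.
Proof.
rewrite gr_projM big_ord_recl subn0 gr_proj_scal eqxx big1 ?addr0 // => i _.
by rewrite gr_proj_scal mul0r.
Qed.

(** * Universal properties of quotients and path algebras *)

Lemma rmorphism_of (A B : pzRingType) (f : A -> B) :
  zmod_morphism f -> monoid_morphism f -> exists g : {rmorphism A -> B}, g =1 f.
Proof.
move=> fB fM.
pose F1 := GRing.isZmodMorphism.Build A B f fB.
pose F2 := GRing.isMonoidMorphism.Build A B f fM.
pose g : {rmorphism A -> B} := HB.pack f F1 F2.
by exists g.
Qed.

Lemma linear_of (A : pzRingType) (U V : lmodType A) (f : U -> V) :
  linear f -> exists g : {linear U -> V}, g =1 f.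
Proof.
move=> fL; pose F := GRing.isLinear.Build A U V _ f fL.
pose g : {linear U -> V} := HB.pack f F.
by exists g.
Qed.

Lemma quot_lift (A B : pzRingType) (S : set A) (f : {rmorphism A -> B}) :
  (forall x, S x -> f x = 0) ->
  exists g : {rmorphism quot_ring S -> B}, forall x, g (quot_pi S x) = f x.
Proof.
move=> fS.
have f0 x : ideal_gen S x -> f x = 0.
  elim=> [y /fS//||y z _ hy _ hz|a y _ hy|a y _ hy]; rewrite ?rmorph0 //.
  - by rewrite rmorphD hy hz addr0.
  - by rewrite rmorphM hy mulr0.
  - by rewrite rmorphM hy mul0r.
have gE x : f (quot_repr (quot_pi S x)) = f x.
  by apply/eqP; rewrite -subr_eq0 -rmorphB; apply/eqP/f0/quot_piK.
have [||g hg] := @rmorphism_of (quot_ring S) B (fun y => f (quot_repr y)).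
- move=> x y; rewrite -[x]quot_reprK -[y]quot_reprK -quot_piN -quot_piD !gE.
  by rewrite rmorphB.
- split; first by rewrite -[1]/(quot_pi S 1) gE rmorph1.
  move=> x y; rewrite -[x]quot_reprK -[y]quot_reprK -quot_piM !gE.
  by rewrite rmorphM.
by exists g => x; rewrite hg gE.
Qed.

Section PathAlgebraUniversal.
Variables (K : fieldType) (Q : quiver).
Local Notation pa := (path_alg K Q).
Local Notation elt := (path_elt K (Q := Q)).

Lemma pa_coef_elt x p u :
  pa_coef (elt x p) u = if `[< u = (x, p) >] then (walk x p)%:R else 0.
Proof. by []. Qed.

Lemma path_elt_cat x p q : walk x p ->
  elt (walk_end x p) q * elt x p = elt x (p ++ q).
Proof.
move=> wp; apply: val_inj; apply/funext => -[y r].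
rewrite /= /path_elt_fun [LHS]/GRing.mul /= /pconvM /= walk_cat wp /=.
case: asboolP => [[-> ->]|ne].
  have hp : (size p < (size (p ++ q)).+1)%N by rewrite ltnS size_cat leq_addr.
  rewrite (bigD1 (Ordinal hp)) //= take_size_cat // drop_size_cat //.
  rewrite /path_elt_fun !asboolT //= mulr1 big1 ?addr0 // => -[i hi] ni.
  case: (asboolP (_ = (x, p))) => [[e]|]; last by rewrite mulr0.
  by case/eqP: ni; apply: val_inj; rewrite /= -[in RHS]e size_takel.
rewrite big1 // => -[i hi] _ /=; rewrite /path_elt_fun.
case: (asboolP ((y, take i r) = (x, p))) => [[e1 e2]|]; last by rewrite mulr0.
rewrite asboolF ?mul0r // => -[e3 e4]; apply: ne.
by rewrite -(cat_take_drop i r) e1 e2 e4.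
Qed.

Lemma path_elt_neq x p y q : walk_end x p != y -> elt y q * elt x p = 0.
Proof.
move=> ne; apply: val_inj; apply/funext => -[z r].
rewrite /= [LHS]/GRing.mul /= /pconvM /= big1 // => -[i hi] _ /=; rewrite /path_elt_fun.
case: (asboolP ((z, take i r) = (x, p))) => [[e1 e2]|]; last by rewrite mulr0.
rewrite asboolF ?mul0r // => -[e3 e4].
by case/eqP: ne; rewrite -e1 -e2.
Qed.

Lemma path_elt0 x p : ~~ walk x p -> elt x p = 0.
Proof.
move=> h; apply: val_inj; apply/funext => u.
by rewrite /= /path_elt_fun (negbTE h) if_same.
Qed.

Local Notation T := {classic (qvert Q * seq (qarr Q))%type}.

Lemma pa_support (f : pa) :
  exists2 s : seq T, uniq s & forall u : T, (u \in s) = (pa_coef f u != 0).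
Proof.
case: f => f /= h; have /asboolP[_ ff] := h.
have /(@finite_seqP T)[s hs] := ff.
exists (undup s); first exact: undup_uniq.
move=> u; rewrite mem_undup; apply/idP/idP => hu.
  by have : [set` s]%classic u by []; rewrite -hs.
by have : [set u | f u != 0]%classic u by []; rewrite hs.
Qed.

Lemma pa_decomp (f : pa) (s : seq T) : uniq s ->
  (forall u : T, pa_coef f u != 0 -> u \in s) ->
  f = \sum_(u <- s) pa_scal Q (pa_coef f u) * elt u.1 u.2.
Proof.
move=> us hs; apply: val_inj; apply/funext => v /=; rewrite pa_coef_sum.
under eq_bigr do rewrite pa_scalMl pa_coef_elt.
have [vs|vs] := boolP ((v : T) \in s); last first.
  have -> : pa_coef f v = 0 by apply/eqP; apply: contraNT vs => /hs.
  rewrite big_seq big1 // => u us'; rewrite asboolF ?mulr0 // => e.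
  by case/negP: vs; rewrite e -surjective_pairing.
rewrite (bigD1_seq (v : T)) //= asboolT -?surjective_pairing //.
rewrite big1 ?addr0 => [|u ne]; last first.
  by rewrite asboolF ?mulr0 // -surjective_pairing => e; rewrite e eqxx in ne.
case: (boolP (walk v.1 v.2)) => w; first by rewrite mulr1.
case: f {hs} => f /= h; have /asboolP[f0 _] := h.
by rewrite [v]surjective_pairing /= f0 // mul0r.
Qed.

(** The path algebra is the span of the trivial paths closed under composition
   with one more arrow on the left, which is the end of the path. *)
Lemma path_alg_ind (P : pa -> Prop) :
  P 0 -> (forall f g, P f -> P g -> P (f + g)) ->
  (forall c f, P f -> P (pa_scal Q c * f)) ->
  (forall x, P (elt x [::])) ->
  (forall a f, P f -> P (elt (qsrc a) [:: a] * f)) ->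
  forall f, P f.
Proof.
move=> P0 PD PZ Pe Pa f.
have Pp x p : P (elt x p).
  elim/last_ind: p => [|p a IH]; first exact: Pe.
  case: (boolP (walk x (rcons p a))) => [|/path_elt0 ->] //.
  rewrite -cats1 walk_cat /= andbT => /andP[wp /eqP e].
  by rewrite -path_elt_cat // -e; exact: Pa.
have [s us hs] := pa_support f.
rewrite (@pa_decomp f s us) => [|u]; last by rewrite hs.
by apply: big_ind => // u _; apply: PZ.
Qed.

Variables (B : pzRingType) (sc : {rmorphism K -> B}).
Hypothesis scC : forall c x, sc c * x = x * sc c.
Variables (e : qvert Q -> B) (a : qarr Q -> B).
Hypothesis eM : forall x y, e x * e y = if x == y then e x else 0.
Hypothesis e1 : \sum_x e x = 1.
Hypothesis eal : forall i, e (qtgt i) * a i = a i.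
Hypothesis ear : forall i, a i * e (qsrc i) = a i.

Fixpoint path_value x p : B :=
  if p is i :: p' then
    if qsrc i == x then path_value (qtgt i) p' * a i else 0
  else e x.

Lemma path_valueMr x p : path_value x p * e x = path_value x p.
Proof.
case: p => [|i p] /=; first by rewrite eM eqxx.
by case: eqP => [<-|]; rewrite ?mul0r // -mulrA ear.
Qed.

Lemma path_valueMl x p : e (walk_end x p) * path_value x p = path_value x p.
Proof.
elim: p x => [|i p IH] x /=; first by rewrite eM eqxx.
by case: eqP => _; rewrite ?mulr0 // mulrA IH.
Qed.

Lemma path_value_cat x p q :
  path_value x (p ++ q) = path_value (walk_end x p) q * path_value x p.
Proof.
elim: p x => [|i p IH] x /=; first by rewrite path_valueMr.
by case: eqP => _; rewrite ?mulr0 // IH mulrA.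
Qed.

Lemma path_value0 x p : ~~ walk x p -> path_value x p = 0.
Proof.
elim: p x => [|i p IH] x //=; case: eqP => //= _ /IH ->.
by rewrite mul0r.
Qed.

(** The support comes as an existential statement; path_evalE shows that any
   finite set of paths containing it gives the same value. *)
Definition path_supp (f : pa) : seq T := sval (cid2 (pa_support f)).

Definition path_eval (f : pa) : B :=
  \sum_(u <- path_supp f) sc (pa_coef f u) * path_value u.1 u.2.

Lemma path_evalE (f : pa) (s : seq T) : uniq s ->
  (forall u : T, pa_coef f u != 0 -> u \in s) ->
  path_eval f = \sum_(u <- s) sc (pa_coef f u) * path_value u.1 u.2.
Proof.
move=> us hs; rewrite /path_eval /path_supp; case: cid2 => r /= ur hr.
rewrite [RHS](bigID (fun u : T => pa_coef f u != 0)) /= [X in _ + X]big1 ?addr0.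
  rewrite -[RHS]big_filter; apply: perm_big; apply: uniq_perm => //.
    exact: filter_uniq.
  move=> u; rewrite mem_filter hr; case: (boolP (_ != 0)) => //= h.
  by rewrite hs.
by move=> u /negbNE/eqP->; rewrite rmorph0 mul0r.
Qed.

Lemma path_evalD (f g : pa) : path_eval (f + g) = path_eval f + path_eval g.
Proof.
have [r ur hr] := pa_support f; have [s us hs] := pa_support g.
have hu := undup_uniq (r ++ s).
have i1 (u : T) : pa_coef f u != 0 -> u \in undup (r ++ s).
  by rewrite mem_undup mem_cat hr => ->.
have i2 (u : T) : pa_coef g u != 0 -> u \in undup (r ++ s).
  by rewrite mem_undup mem_cat hs => ->; rewrite orbT.
rewrite (path_evalE hu i1) (path_evalE hu i2) (@path_evalE (f + g) _ hu).
  rewrite -big_split /=; apply: eq_bigr => u _.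
  by rewrite -mulrDl -rmorphD.
move=> u /= h; case: (eqVneq (pa_coef f u) 0) => [fu|/i1 //].
by apply: i2; apply: contraNN h => /eqP gu; rewrite pconv_addE fu gu addr0.
Qed.

Lemma path_eval0 : path_eval 0 = 0.
Proof. by apply: (addrI (path_eval 0)); rewrite -path_evalD !addr0. Qed.

Lemma path_eval_sum (I : Type) (r : seq I) (F : I -> pa) :
  path_eval (\sum_(i <- r) F i) = \sum_(i <- r) path_eval (F i).
Proof.
by elim: r => [|i r IH]; rewrite ?big_nil ?path_eval0 // !big_cons path_evalD IH.
Qed.

Lemma path_evalZ c (f : pa) : path_eval (pa_scal Q c * f) = sc c * path_eval f.
Proof.
have cE (u : T) : pa_coef (pa_scal Q c * f) u = c * pa_coef f u by exact: pa_scalMl.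
have [s us hs] := pa_support f.
rewrite (@path_evalE f s) => [|//|u]; last by rewrite hs.
rewrite (@path_evalE (pa_scal Q c * f) s) => [|//|u]; last first.
  move=> h; rewrite hs; apply: contraNN h => /eqP h; apply/eqP.
  by apply: etrans (cE u) _; rewrite h mulr0.
rewrite big_distrr /=; apply: eq_bigr => u _.
by rewrite mulrA -rmorphM -(cE u).
Qed.

Lemma path_eval_elt x p : path_eval (elt x p) = path_value x p.
Proof.
rewrite (@path_evalE _ [:: (x, p) : T]) //.
  rewrite big_seq1 /= /path_elt_fun asboolT //=.
  case: (boolP (walk x p)) => w; first by rewrite rmorph1 mul1r.
  by rewrite path_value0 // mulr0.
by move=> u; rewrite /= /path_elt_fun inE; case: asboolP => [->|]; rewrite ?eqxx.
Qed.

Lemma pa_one : (1 : pa) = \sum_x elt x [::].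
Proof.
apply: val_inj; apply/funext => -[y r] /=.
rewrite pa_coef_sum (bigD1 y) //= big1 ?addr0 => [|x ne]; last first.
  by rewrite /= /path_elt_fun asboolF // => -[e']; rewrite e' eqxx in ne.
rewrite /= /path_elt_fun; case: r => [|i r]; first by rewrite asboolT.
by rewrite asboolF.
Qed.

Lemma path_evalM (f g : pa) : path_eval (f * g) = path_eval f * path_eval g.
Proof.
have [r ur hr] := pa_support f; have [s us hs] := pa_support g.
have fE : f = \sum_(u <- r) pa_scal Q (pa_coef f u) * elt u.1 u.2.
  by apply: pa_decomp => // u; rewrite hr.
have gE : g = \sum_(u <- s) pa_scal Q (pa_coef g u) * elt u.1 u.2.
  by apply: pa_decomp => // u; rewrite hs.
rewrite fE gE big_distrl /= !path_eval_sum big_distrl /=; apply: eq_bigr => u _.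
rewrite !big_distrr /= path_eval_sum; apply: eq_bigr => v _.
rewrite mulrA -[_ * elt _ _ * pa_scal Q _]mulrA -pa_scalC !mulrA -!mulrA.
rewrite !path_evalZ -!mulrA; congr (_ * _); rewrite !mulrA.
rewrite -scC -[RHS]mulrA; congr (_ * _); rewrite !path_eval_elt.
case: (eqVneq (walk_end v.1 v.2) u.1) => [eu|ne].
  case: (boolP (walk v.1 v.2)) => w.
    by rewrite -{1}eu path_elt_cat // path_eval_elt path_value_cat eu.
  by rewrite (path_elt0 w) mulr0 path_eval0 (path_value0 w) mulr0.
rewrite path_elt_neq // path_eval0 -(path_valueMr u.1) -(path_valueMl v.1).
by rewrite -mulrA (mulrA (e u.1)) eM eq_sym (negbTE ne) mul0r mulr0.
Qed.

(** A path goes to the product of the images of its arrows, and an element is a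
   finite combination of paths. Products of paths which do not compose go to 0
   because the idempotents are orthogonal. *)
Lemma path_alg_lift : exists f : {rmorphism pa -> B},
  [/\ forall c, f (pa_scal Q c) = sc c,
      forall x, f (elt x [::]) = e x
    & forall i, f (elt (qsrc i) [:: i]) = a i].
Proof.
have ev1 : path_eval 1 = 1.
  rewrite pa_one path_eval_sum -e1; apply: eq_bigr => x _.
  by rewrite path_eval_elt.
have [||f hf] := @rmorphism_of pa B path_eval.
- move=> f g; rewrite path_evalD; congr (_ + _).
  by apply: (addrI (path_eval g)); rewrite -path_evalD !subrr path_eval0.
- by split => // f g; exact: path_evalM.
exists f; split=> [c|x|i]; rewrite hf.
- by rewrite -[pa_scal Q c]mulr1 path_evalZ ev1 mulr1.
- by rewrite path_eval_elt.
- by rewrite path_eval_elt /= eqxx eal.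
Qed.

End PathAlgebraUniversal.

(** * Quantum integers at a root of unity *)

Section QuantumIntegers.
Variables (R : realType) (m : nat).
Hypothesis m3 : (3 <= m)%N.
Let theta : R := pi / m%:R.
Local Notation q := (qint R m).

Let thetaE : 2 * pi / (2 * m)%N%:R = theta.
Proof. by rewrite natrM /theta -mulf_div divff ?mul1r // pnatr_eq0. Qed.

Let m_gt0 : 0 < m%:R :> R. Proof. by rewrite ltr0n; lia. Qed.

Lemma sin_theta_gt0 n : (0 < n < m)%N -> 0 < sin (theta *+ n).
Proof.
move=> /andP[n0 nm]; apply: sin_gt0_pi; rewrite -mulr_natl /theta; apply/andP; split.
  by apply: mulr_gt0; [rewrite ltr0n | apply: divr_gt0; [exact: pi_gt0|]].
by rewrite mulrCA gtr_pMr ?pi_gt0 // ltr_pdivrMr // mul1r ltr_nat.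
Qed.

Lemma zetaX n : zeta R m ^+ n = Complex (cos (theta *+ n)) (sin (theta *+ n)).
Proof.
elim: n => [|n IH]; first by rewrite expr0 mulr0n cos0 sin0.
rewrite exprS IH /zeta thetaE mulrS cosD sinD.
by apply/eqP; rewrite eq_complex /=; apply/andP; split; apply/eqP; ring.
Qed.

Lemma zetaXN n : zeta R m ^- n = Complex (cos (theta *+ n)) (- sin (theta *+ n)).
Proof.
have h : zeta R m ^+ n * Complex (cos (theta *+ n)) (- sin (theta *+ n)) = 1.
  rewrite zetaX; apply/eqP; rewrite eq_complex /=; apply/andP; split; apply/eqP.
    by rewrite mulrN opprK -!expr2 cos2Dsin2.
  by ring.
have nz : zeta R m ^+ n != 0.
  by apply: contraTneq isT => e; move: h; rewrite e mul0r => /eqP; rewrite eq_sym oner_eq0.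
by apply: (mulfI nz); rewrite h divff.
Qed.

Let s0 : sin theta != 0 :> R.
Proof. by rewrite gt_eqF // (@sin_theta_gt0 1%N) //; lia. Qed.

(** The powers of zeta are points of the unit circle, so that both differences
   are purely imaginary and their quotient is a quotient of sines. All the
   properties of the quantum integers then come from trigonometric identities. *)
Lemma qintE n : q n = sin (theta *+ n) / sin theta.
Proof.
have D k : zeta R m ^+ k - zeta R m ^- k = Complex 0 (2 * sin (theta *+ k)).
  rewrite zetaXN zetaX; apply/eqP; rewrite eq_complex /=; apply/andP.
  by split; apply/eqP; ring.
have D1 : zeta R m - (zeta R m)^-1 = Complex 0 (2 * sin theta).
  by have := D 1%N; rewrite expr1 mulr1n.
rewrite /qint D D1.
have nz : Complex 0 (2 * sin theta) != 0 :> R[i].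
  by rewrite eq_complex /= eqxx /= mulf_eq0 (negbTE s0) orbF pnatr_eq0.
suff -> : Complex 0 (2 * sin (theta *+ n)) =
    Complex (sin (theta *+ n) / sin theta) 0 * Complex 0 (2 * sin theta) :> R[i].
  by rewrite mulfK.
by apply/eqP; rewrite eq_complex /=; apply/andP; split; apply/eqP; field.
Qed.

Lemma qint0 : q 0 = 0. Proof. by rewrite qintE mulr0n sin0 mul0r. Qed.
Lemma qint1 : q 1 = 1. Proof. by rewrite qintE mulr1n divff. Qed.

Lemma qint_sym n : (n <= m)%N -> q (m - n) = q n.
Proof.
move=> nm; rewrite !qintE mulrnBr // [theta *+ m](_ : _ = pi).
  by rewrite sinB sinpi cospi mul0r sub0r mulN1r opprK.
by rewrite -mulr_natr /theta divfK // gt_eqF.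
Qed.

Lemma qintSS n : q n.+2 = q 2 * q n.+1 - q n.
Proof.
rewrite !qintE !mulrS mulr0n addr0 !sinD !cosD.
have e : cos theta ^+ 2 = 1 - sin theta ^+ 2 :> R by rewrite -(cos2Dsin2 theta) addrK.
set a := sin (theta *+ n); set b := cos (theta *+ n).
have d0 := s0; set c := cos theta in e *; set d := sin theta in e d0 *.
apply/eqP; rewrite -subr_eq0; apply/eqP.
transitivity (a * (1 - d ^+ 2 - c ^+ 2) / d); first by field.
by rewrite e subrr mulr0 mul0r.
Qed.

Lemma qint_gt0 n : (0 < n < m)%N -> 0 < q n.
Proof.
move=> h; rewrite qintE divr_gt0 ?sin_theta_gt0 //.
by rewrite (@sin_theta_gt0 1%N) //; lia.
Qed.

End QuantumIntegers.

(** * Words and lengths in a dihedral group *)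

Section DihedralGroup.
Variables (m : nat) (W : finGroupType) (s t : W).
Hypothesis m3 : (3 <= m)%N.
Hypothesis hW : dihedral_coxeter_system m s t.
Local Open Scope group_scope.

Let order2 (x : W) : #[x] = 2%N -> x * x = 1.
Proof. by move=> h; have := expg_order x; rewrite h. Qed.
Let ss : s * s = 1. Proof. by case: hW => /order2. Qed.
Let tt : t * t = 1. Proof. by case: hW => _ /order2. Qed.

Definition letter (b : bool) : W := if b then t else s.
(** The two elements of length k, for 0 < k < m, are told apart by their first
   letter, which is t when b is true. *)
Definition word (b : bool) k : W := alt (letter b) (letter (~~ b)) k.

Lemma wordS b k : word b k.+1 = letter b * word (~~ b) k.
Proof. by rewrite /word /= negbK. Qed.
Lemma word0 b : word b 0 = 1. Proof. by []. Qed.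

Lemma letterK b x : letter b * (letter b * x) = x.
Proof. by rewrite mulgA /letter; case: b; rewrite ?ss ?tt mul1g. Qed.

Lemma letter_word b c k : letter b * word c k.+1 =
  if b == c then word (~~ b) k else word b k.+2.
Proof.
case: eqP => [<-|ne]; first by rewrite wordS letterK.
by rewrite [RHS]wordS; case: b c ne => [] [].
Qed.

(** Changing the first letter of an alternating word amounts to multiplying it
   by a power of a rotation, because conjugation by a reflection inverts the
   rotation st. *)
Lemma word_flip b k : word b k = (letter b * letter (~~ b)) ^+ k * word (~~ b) k.
Proof.
elim: k b => [|k IH] b; first by rewrite mul1g.
rewrite !wordS negbK IH negbK mulgA expgSr -!mulgA letterK !mulgA.
congr (_ * _); elim: (k) => [|n IHn]; first by rewrite mulg1 mul1g.
by rewrite !expgSr !mulgA IHn -!mulgA.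
Qed.

Lemma rotation_order b : #[letter b * letter (~~ b)] = m.
Proof.
have e : t * s = (s * t)^-1.
  by apply: (mulgI (s * t)); rewrite mulgV -mulgA (mulgA t) tt mul1g ss.
by case: hW => _ _ h _; case: b; rewrite /= ?e ?orderV h.
Qed.

Lemma letters_not_comm b : letter b * letter (~~ b) <> letter (~~ b) * letter b.
Proof.
move=> c; have : (letter b * letter (~~ b)) ^+ 2 = 1.
  by rewrite expgS expg1 {2}c -!mulgA letterK -[letter b * _]mulg1 -mulgA letterK.
move/eqP; rewrite -order_dvdn rotation_order => h.
by have : (m <= 2)%N; [apply: dvdn_leq => //; lia|lia].
Qed.

Lemma word_even b k : word b k.*2 = (letter b * letter (~~ b)) ^+ k.
Proof.
by elim: k => [//|k IH]; rewrite doubleS !wordS negbK IH expgS mulgA.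
Qed.

(** An even word is a power of a rotation, of order m; an odd word equal to 1
   would make a reflection a power of a rotation, and then the two letters
   would commute. *)
Lemma word_neq1 b n : (0 < n < 2 * m)%N -> word b n <> 1.
Proof.
move=> /andP[n0 nm]; have := odd_double_half n; set p := n./2; case: (odd n) => /= nE; last first.
  rewrite -nE add0n word_even => /eqP; rewrite -order_dvdn rotation_order.
  by move=> h; have : (m <= p)%N; [apply: dvdn_leq => //; lia|lia].
rewrite -nE.
rewrite add1n wordS word_even negbK => e.
apply: (@letters_not_comm b); set x := letter b in e *; set y := letter _ in e *.
have xE : x = ((y * x) ^+ p)^-1 by apply/eqP; rewrite eq_mulgV1 invgK; exact/eqP.
have c : commute x (y * x).
  by apply: commute_sym; rewrite {2}xE; apply/commuteV/commuteX.
have xx : x * x = 1 by rewrite /x /letter; case: (b); rewrite ?ss ?tt.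
by move: c; rewrite /commute -[RHS]mulgA xx mulg1 => /(congr1 (mulg x)); rewrite !mulgA xx mul1g.
Qed.

Lemma word_length_inj b c j k : (j < k)%N -> (j + k < 2 * m)%N -> word b k <> word c j.
Proof.
elim: j b c k => [|j IH] b c k jk jkm; first by apply: word_neq1; lia.
case: k jk jkm => // k jk jkm e.
case: (eqVneq b c) => [bc|ne].
  apply: (IH (~~ b) (~~ b) k); [lia|lia|].
  by have := congr1 (mulg (letter b)) e; rewrite bc !letter_word !eqxx.
apply: (IH c (~~ c) k.+2); [lia|lia|].
have := congr1 (mulg (letter c)) e; rewrite !letter_word eqxx.
by rewrite eq_sym (negbTE ne).
Qed.

Lemma word_type k : (0 < k < m)%N -> word true k <> word false k.
Proof.
move=> h e; have := word_flip true k; rewrite e -[LHS]mul1g => /mulIg/esym/eqP.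
rewrite -order_dvdn rotation_order => d.
by have : (m <= k)%N; [apply: dvdn_leq => //; lia|lia].
Qed.

Lemma word_top b : word b m = word (~~ b) m.
Proof. by rewrite word_flip -{1}(rotation_order b) expg_order mul1g. Qed.

(** Multiplying an alternating word on the left by a letter either cancels its
   first letter or lengthens it; the only word that becomes too long is the
   longest one, which can be rewritten so as to start with the letter. *)
Lemma word_cover w : exists b k, (k <= m)%N /\ w = word b k.
Proof.
have : w \in <<[set s; t]>> by case: hW => _ _ _ ->; rewrite inE.
move/gen_prodgP => [n [c hc ->]] {w}.
elim: n c hc => [|n IH] c hc; first by exists false, 0%N; rewrite big_ord0.
have [//|b [k [km e]]] := IH (fun i => c (lift ord0 i)).
rewrite big_ord_recl e; have [a ->] : exists a, c ord0 = letter a.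
  by have := hc ord0; rewrite !inE => /orP[] /eqP->; [exists false|exists true].
case: (eqVneq a b) => [->|ne].
  case: k km {e} => [|k] km; first by exists b, 1%N; split; [lia|].
  by exists (~~ b), k; rewrite letter_word eqxx; split; [lia|].
have bE : b = ~~ a by move: ne; case: (a); case: (b).
case: (ltnP k m) => h; first by exists a, k.+1; rewrite wordS bE.
have -> : k = m by apply/eqP; rewrite eqn_leq km.
exists (~~ a), m.-1; split; first lia.
have mE : m = m.-1.+1 by lia.
by rewrite bE -word_top [in LHS]mE letter_word eqxx.
Qed.

Lemma word_in_power b k : word b k \in [set s; t] ^+ k.
Proof.
elim: k b => [|k IH] b; first by rewrite expg0 set11.
rewrite wordS expgS; apply/mulsgP; exists (letter b) (word (~~ b) k) => //.
by rewrite !inE /letter; case: b; rewrite eqxx ?orbT.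
Qed.

Lemma power_word n w : w \in [set s; t] ^+ n -> exists b j, (j <= n)%N /\ w = word b j.
Proof.
elim: n w => [|n IH] w; first by rewrite expg0 => /set1P ->; exists false, 0%N.
rewrite expgS => /mulsgP[x y xS /IH[b [k [kn ->]]] ->].
have [a ->] : exists a, x = letter a.
  by move: xS; rewrite !inE => /orP[] /eqP->; [exists false|exists true].
case: (eqVneq a b) => [->|ne].
  case: k kn => [|k] kn; first by exists b, 1%N; split; [lia|].
  by exists (~~ b), k; rewrite letter_word eqxx; split; [lia|].
by exists a, k.+1; rewrite wordS; split; [lia|congr (_ * word _ _); move: ne; case: (a); case: (b)].
Qed.

Lemma order_gt : (m < #|W|)%N.
Proof.
rewrite ltnNge -(rotation_order false) -cardsT; apply/negP => h.
have eW : <[s * t]> = [set: W] by apply/eqP; rewrite eqEcard finset.subsetT.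
apply: (@letters_not_comm false); apply: (centsP (cycle_abelian (s * t))).
  by rewrite eW inE.
by rewrite eW inE.
Qed.

(** A shorter product of generators reduces to an alternating word which is
   strictly shorter, and alternating words of different lengths of sum less
   than 2m are different. *)
Lemma cox_length_word b k : (k <= m)%N -> cox_length s t (word b k) = k.
Proof.
move=> km; rewrite /cox_length; set p := fun n => _.
have kW : (k < #|W|)%N by apply: leq_ltn_trans km order_gt.
have hp : has p (iota 0 #|W|).
  by apply/hasP; exists k; rewrite ?mem_iota //; exact: word_in_power.
have fW := hp; rewrite has_find size_iota in fW.
have := nth_find 0%N hp; rewrite nth_iota // add0n.
move/power_word => [c [j [jf e]]].
apply/eqP; rewrite eqn_leq; apply/andP; split.
  rewrite leqNgt; apply/negP => h; have := before_find 0%N h.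
  by rewrite nth_iota // add0n /p word_in_power.
rewrite leqNgt; apply/negP => h; apply: (@word_length_inj b c j k) => //; lia.
Qed.

End DihedralGroup.

(** * Ladders *)

(** The strong Bruhat order of a dihedral group of order 2m, where m is the
   height. There are two vertices on each level 0 < k < m, told apart by their
   type, and one vertex at the bottom and at the top, where the type has no
   meaning: vtx is total in the type, and both types give the same vertex at
   the two ends. *)
Record ladder := Ladder {
  vertex :> finType;
  height : nat;
  lvl : vertex -> nat;
  typ : vertex -> bool;
  vtx : bool -> nat -> vertex;
  height_ge3 : (3 <= height)%N;
  lvl_le : forall x, (lvl x <= height)%N;
  vtxK : forall x, vtx (typ x) (lvl x) = x;
  lvl_vtx : forall b k, (k <= height)%N -> lvl (vtx b k) = k;
  typ_vtx : forall b k, (0 < k < height)%N -> typ (vtx b k) = b;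
  vtx_bot : forall b, vtx b 0 = vtx false 0;
  vtx_top : forall b, vtx b height = vtx false height
}.

Section LadderTheory.
Variable L : ladder.
Local Notation m := (height L).

(** Two elements of a dihedral group are comparable in the strong Bruhat order
   exactly when they are equal or of different lengths. *)
Definition lad_le (x y : L) : bool := (x == y) || (lvl x < lvl y)%N.
Definition lad_adj (x y : L) : bool :=
  (lvl x == (lvl y).+1) || (lvl y == (lvl x).+1).

Lemma lad_le_refl x : lad_le x x. Proof. by rewrite /lad_le eqxx. Qed.
Lemma lad_le_lvl x y : lad_le x y -> (lvl x <= lvl y)%N.
Proof. by case/orP => [/eqP->|/ltnW]. Qed.
Lemma lad_lt_le x y : (lvl x < lvl y)%N -> lad_le x y.
Proof. by rewrite /lad_le => ->; rewrite orbT. Qed.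
Lemma lad_le_eq x y : lad_le x y -> (lvl y <= lvl x)%N -> x = y.
Proof. by case/orP => [/eqP //|]; lia. Qed.
Lemma lad_le_trans y x z : lad_le x y -> lad_le y z -> lad_le x z.
Proof.
case/orP => [/eqP->//|h1] /orP[/eqP<-|h2]; apply: lad_lt_le; lia.
Qed.

Lemma vtxP x k : lvl x = k -> exists b, x = vtx L b k.
Proof. by move=> <-; exists (typ x); rewrite vtxK. Qed.

Lemma vtx_inj k b c : (0 < k < m)%N -> (vtx L b k == vtx L c k) = (b == c).
Proof.
by move=> h; apply/eqP/eqP => [/(congr1 (@typ L))|->//]; rewrite !typ_vtx.
Qed.

Lemma sum_lvl (M : nmodType) k (F : L -> M) : (0 < k < m)%N ->
  \sum_(x | lvl x == k) F x = F (vtx L false k) + F (vtx L true k).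
Proof.
move=> h; have km : (k <= m)%N by lia.
rewrite (bigD1 (vtx L false k)) ?lvl_vtx //=; congr (_ + _).
rewrite (bigD1 (vtx L true k)) ?lvl_vtx //= ?eqxx ?vtx_inj // big1 ?addr0 // => x.
case/andP=> /andP[/eqP <-]; rewrite -{1 3}(vtxK x).
by case: (typ x); rewrite !eqxx ?andbF.
Qed.

Lemma sum_lvl_end (M : nmodType) k (F : L -> M) : k = 0%N \/ k = m ->
  \sum_(x | lvl x == k) F x = F (vtx L false k).
Proof.
move=> h; have km : (k <= m)%N by case: h => ->.
rewrite (bigD1 (vtx L false k)) ?lvl_vtx //= big1 ?addr0 // => x /andP[/eqP e].
rewrite -(vtxK x) e; have -> : vtx L (typ x) k = vtx L false k.
  by case: h => ->; rewrite ?vtx_bot ?vtx_top.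
by rewrite eqxx.
Qed.

(** An anti-automorphism of the ladder. Any bijection between opposite levels
   would reverse the order; the parity twist of the types is the one for which
   the coefficients of the relations at dual vertices are transposed up to
   sign, as in the field co_dual of ladder_algebra below. *)
Definition dual (x : L) : L := vtx L (typ x (+) odd (lvl x)) (m - lvl x).

Lemma dual_vtx b k : (k <= m)%N -> dual (vtx L b k) = vtx L (b (+) odd k) (m - k).
Proof.
move=> km; rewrite /dual lvl_vtx //; case: (posnP k) => [->|k0].
  by rewrite subn0 !(vtx_top L (_ (+) _)).
case: (ltngtP k m) => h; last by rewrite h subnn !(vtx_bot L (_ (+) _)).
  by rewrite typ_vtx // k0.
by lia.
Qed.

Lemma lvl_dual x : lvl (dual x) = (m - lvl x)%N.
Proof. by rewrite lvl_vtx // leq_subr. Qed.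

Lemma lvl_dualE x : (lvl (dual x) + lvl x = m)%N.
Proof. by rewrite lvl_dual subnK // lvl_le. Qed.

Lemma dual_inj : injective dual.
Proof.
move=> x y e; have h : lvl x = lvl y.
  by have := lvl_dualE x; rewrite e -(lvl_dualE y) => /addnI.
move: e; rewrite -(vtxK x) -(vtxK y) h !dual_vtx ?lvl_le //.
have := lvl_le y; case: (posnP (lvl y)) => [->|h0]; first by rewrite (vtx_bot L (typ x)) (vtx_bot L (typ y)).
rewrite leq_eqVlt => /orP[/eqP->|h1]; first by rewrite (vtx_top L (typ x)) (vtx_top L (typ y)).
move/eqP; rewrite vtx_inj; last by lia.
by move=> /eqP /addIb ->.
Qed.

Lemma dual_le x y : lad_le (dual x) (dual y) = lad_le y x.
Proof.
rewrite /lad_le (inj_eq dual_inj) eq_sym !lvl_dual; congr (_ || _).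
by have := lvl_le x; have := lvl_le y; lia.
Qed.

Lemma sum_dualE (M : nmodType) (F : L -> M) : \sum_x F (dual x) = \sum_x F x.
Proof.
rewrite [RHS](reindex (dual)) //; exists (invF (dual_inj)) => x _.
  exact: invF_f.
exact: f_invF.
Qed.

End LadderTheory.

(** * Weights and the Chevalley formula *)

(** What the proof uses of the quantum integers at a 2m-th root of unity, over
   any field. *)
Record qnumbers (K : fieldType) (m : nat) := QNumbers {
  qn :> nat -> K;
  qn0 : qn 0 = 0;
  qn1 : qn 1 = 1;
  qnSS : forall n, qn n.+2 = qn 2 * qn n.+1 - qn n;
  qn_neq0 : forall n, (0 < n < m)%N -> qn n != 0;
  qn_sym : forall n, (n <= m)%N -> qn (m - n) = qn n
}.

Section Chevalley.
Variables (K : fieldType) (L : ladder) (q : qnumbers K (height L)).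
Local Notation m := (height L).
Let m3 := height_ge3 L.

(** The determinant of consecutive pairs is invariant under the recursion. *)
Lemma qn_norm n : q n.+1 ^+ 2 - q n * q n.+2 = 1.
Proof.
elim: n => [|n IH]; first by rewrite qn0 qn1 mul0r subr0 expr1n.
by rewrite -[RHS]IH (qnSS q n.+1) (qnSS q n); ring.
Qed.
Lemma qn_m : q m = 0.
Proof. by have := qn_sym q (leq0n m); rewrite subn0 qn0. Qed.
Lemma qn_m1 : q m.-1 = 1.
Proof. by have := qn_sym q (ltnW (ltnW m3)); rewrite subn1 qn1. Qed.

(** Weights are written as their values on the two simple coroots, here the two
   types. This one is attached to the descending edge from the vertex of type b
   on level i+1 to the vertex of type c on level i. For a given b and i > 0 the
   two weights are the basis which is dual to the two forms chev _ b i.+1 (see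
   chev_weight). For i = 0 only one edge exists, and then q 0 = 0 and x / 0 = 0
   make both values of c give a fundamental weight. *)
Definition weight (b c : bool) (i : nat) : bool -> K := fun a =>
  if (c == b) && (i != 0)%N then if a == b then 0 else (q i)^-1
  else if a == b then 1 else - q i.+1 / q i.

(** The Chevalley formula: the coefficient of the Schubert class of type c on
   level k - 1 in the product of the weight l with the class of type b on level
   k. It is the value of l on the positive coroot whose reflection carries one
   vertex to the other, expressed by quantum integers in the simple coroots. *)
Definition chev (l : bool -> K) (b : bool) (k : nat) (c : bool) : K :=
  if c == b then q k * l b + q k.-1 * l (~~ b) else l b.

(** Unlike weight and chev, the versions on vertices take types from the
   vertices, hence arbitrary ones at the bottom and at the top. The next two
   lemmas say that both types give the same value there. *)
Definition weightv (x y : L) := weight (typ x) (typ y) (lvl y).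
Definition chevv l (x y : L) := chev l (typ x) (lvl x) (typ y).

Lemma weightE b c i : (i < m)%N -> weightv (vtx L b i.+1) (vtx L c i) =1 weight b c i.
Proof.
move=> im a; rewrite /weightv lvl_vtx; last by lia.
case: (posnP i) => [i0|i0].
  rewrite /weight {}i0 !andbF typ_vtx //; lia.
rewrite (typ_vtx c); last by lia.
case: (ltnP i.+1 m) => h; first by rewrite typ_vtx.
have e : i.+1 = m by lia.
have -> : i = m.-1 by lia.
rewrite /weight prednK ?qn_m ?qn_m1 ?invr1 ?mul0r ?oppr0; last by lia.
have -> : m.-1 != 0%N by lia.
by rewrite !andbT !mul0r; move: (typ _) => d; case: a b c d => [] [] [] [].
Qed.

Lemma chevE l b c k : (k < m)%N -> chevv l (vtx L b k.+1) (vtx L c k) = chev l b k.+1 c.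
Proof.
move=> km; rewrite /chevv lvl_vtx //.
case: (ltnP k.+1 m) => h.
  rewrite typ_vtx //; case: (posnP k) => [k0|k0]; last by rewrite typ_vtx //; lia.
  rewrite {}k0 /chev /= qn1 qn0 mul1r mul0r addr0.
  by case: ifP; case: ifP.
have e : k.+1 = m by lia.
rewrite (typ_vtx c); last by lia.
rewrite /chev e qn_m qn_m1 !mul0r !add0r !mul1r; move: (typ _) => d.
by case: b c d => [] [] [].
Qed.

Lemma chev_weight b c d i : (i < m)%N ->
  chev (weight b c i) b i.+1 d = (vtx L d i == vtx L c i)%:R.
Proof.
move=> im; rewrite /chev /weight /=; case: (posnP i) => [->|i0].
  by rewrite !andbF eqxx !vtx_bot eqxx qn0 qn1 mul0r addr0 mulr1 if_same.
have nz : q i != 0 by apply: qn_neq0; lia.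
rewrite vtx_inj; last by lia.
rewrite andbT; case: b c d => [] [] [] /=; try by [].
all: by field.
Qed.

Definition chev2 (l2 l1 : bool -> K) (a : bool) k (c : bool) : K :=
  \sum_b chev l2 b k.+1 c * chev l1 a k.+2 b.

Lemma chev2E l2 l1 a c k : chev2 l2 l1 a k c =
  q k.+1 * (if c == a then q k.+2 * (l2 a * l1 a) + q k * (l2 (~~ a) * l1 (~~ a))
                 + q k.+1 * (l2 a * l1 (~~ a) + l2 (~~ a) * l1 a)
            else q 2 * (l2 a * l1 a) + (l2 a * l1 (~~ a) + l2 (~~ a) * l1 a)).
Proof.
have n1 : q k * q k.+2 = q k.+1 ^+ 2 - 1 by rewrite -(qn_norm k); ring.
rewrite /chev2 big_bool /chev; case: a c => [] [] /=.
- transitivity (q k.+1 * q k.+2 * (l2 true * l1 true)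
    + q k.+1 ^+ 2 * (l2 true * l1 false) + q k.+1 * q k * (l2 false * l1 false)
    + (q k * q k.+2 + 1) * (l2 false * l1 true)); first by ring.
  by rewrite n1; ring.
- by rewrite (qnSS q k); ring.
- by rewrite (qnSS q k); ring.
transitivity (q k.+1 * q k.+2 * (l2 false * l1 false)
    + q k.+1 ^+ 2 * (l2 false * l1 true) + q k.+1 * q k * (l2 true * l1 true)
    + (q k * q k.+2 + 1) * (l2 true * l1 false)); first by ring.
by rewrite n1; ring.
Qed.

(** The action of two weights on a class depends on them only through their
   symmetric product modulo the invariant quadratic form, that is through the
   two expressions D and S in the hypotheses. *)
Lemma chev2_eq b (l2 l1 l2' l1' : bool -> K) a c k :
  l2 (~~ b) * l1 (~~ b) - l2 b * l1 b = l2' (~~ b) * l1' (~~ b) - l2' b * l1' b ->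
  l2 (~~ b) * l1 b + l2 b * l1 (~~ b) + q 2 * (l2 b * l1 b) =
  l2' (~~ b) * l1' b + l2' b * l1' (~~ b) + q 2 * (l2' b * l1' b) ->
  chev2 l2 l1 a k c = chev2 l2' l1' a k c.
Proof.
move=> hD hS; rewrite !chev2E (qnSS q k); congr (_ * _).
set D := l2 (~~ b) * l1 (~~ b) - _ in hD.
set S := l2 (~~ b) * l1 b + _ + _ in hS.
case: (eqVneq a b) => [->|ne].
  (* D and S are the coordinates of the symmetric product modulo the invariant
     form. *)
  transitivity (if c == b then q k * D + q k.+1 * S else S).
    by case: ifP => _; rewrite /D /S; ring.
  by rewrite hD hS; case: ifP => _; ring.
have -> : a = ~~ b by move: ne; case: (a); case: (b).
rewrite negbK.
transitivity (if c == ~~ b then - q k * D + q k.+1 * (S + q 2 * D) else S + q 2 * D).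
  by case: ifP => _; rewrite /D /S; ring.
by rewrite hD hS; case: ifP => _; ring.
Qed.

(** The weights along the two descending paths of a square of the ladder have
   the same symmetric product modulo the invariant form when the square ends
   above the bottom. When it ends at the bottom, the only class to which this
   is applied is the top of the square. *)
Lemma chev2_weight b c r r' a d j k : (j.+1 < m)%N ->
  (0 < j)%N || (a == b) && (k == 0)%N ->
  chev2 (weight r c j) (weight b r j.+1) a k d =
  chev2 (weight r' c j) (weight b r' j.+1) a k d.
Proof.
move=> jm.
suff main : (0 < j)%N || (a == b) && (k == 0)%N ->
    chev2 (weight b c j) (weight b b j.+1) a k d =
    chev2 (weight (~~ b) c j) (weight b (~~ b) j.+1) a k d.
  move=> /main e.
  have h x : chev2 (weight x c j) (weight b x j.+1) a k d =
      chev2 (weight b c j) (weight b b j.+1) a k d.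
    by case: (eqVneq x b) => [->//|ne]; rewrite e; move: ne {e main}; case: (x); case: (b).
  by rewrite !h.
have nbb : (~~ b == b) = false by case: (b).
have bnb : (b == ~~ b) = false by case: (b).
case: (posnP j) => [->|j0] /=.
  move=> /andP[/eqP-> /eqP->]; rewrite !chev2E qn0 qn1 /weight !andbF !andbT.
  rewrite !eqxx !nbb !bnb qn0 qn1 ?invr0 ?invr1 ?mulr0 ?divr1.
  by case: ifP => _; ring.
move=> _; apply: (chev2_eq (b := b)).
  all: rewrite /weight !nbb !bnb !eqxx !andbT (_ : (j != 0)%N); last by lia.
  all: have n0 : q j != 0 by apply: qn_neq0; lia.
  all: have n1 : q j.+1 != 0 by apply: qn_neq0; lia.
  all: have [/eqP cb|cb] := boolP (c == b); rewrite ?cb ?eqxx /=.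
  all: rewrite ?bnb ?nbb /=.
  all: have nE : q j.+1 ^+ 2 - q j * q j.+2 = 1 by exact: qn_norm.
  - apply/eqP; rewrite -subr_eq0; apply/eqP.
    transitivity ((1 - (q j.+1 ^+ 2 - q j * q j.+2)) / (q j * q j.+1)).
      by field; apply/andP.
    by rewrite nE subrr mul0r.
  - have -> : (c == ~~ b) by move: cb; case: (b); case: (c).
    by rewrite /=; field; apply/andP.
  - by rewrite (qnSS q j); field; apply/andP.
  - have -> : (c == ~~ b) by move: cb; case: (b); case: (c).
    by rewrite /= (qnSS q j); field; apply/andP.
Qed.

(** These are the coefficients of the relations which rewrite a path over a
   peak: the weight of the descending edge out of the peak, evaluated on the
   start of the path. *)
Lemma chev_weight_peak a p z d j : (j.+1 < m)%N ->
  chev (weight p z j.+1) a j.+1 d =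
  if a == z then
    if p == a then if d == a then q j / q j.+1 else 0
    else if d == a then q j - q j.+2 else - q j.+2 / q j.+1
  else if p == d then (q j.+1)^-1 else 1.
Proof.
move=> jm; have n1 : q j.+1 != 0 by apply: qn_neq0; lia.
have nE : q j.+1 ^+ 2 - q j * q j.+2 = 1 by exact: qn_norm.
have E : q j.+1 - q j * q j.+2 / q j.+1 = (q j.+1)^-1.
  transitivity ((q j.+1 ^+ 2 - q j * q j.+2) / q j.+1); first by field.
  by rewrite nE mul1r.
have E1 : q j.+1 + q j * (- q j.+2 / q j.+1) = (q j.+1)^-1 by apply: etrans E; field.
rewrite /chev /weight /= andbT.
by case: a p z d => [] [] [] [] /=; rewrite ?mulr1 ?E1 //; field.
Qed.

End Chevalley.

(** * Ladder algebras *)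

(** The triples (x, q, z) which index a basis: the path descends from x to q and
   then ascends to z. *)
Definition is_tri (L : ladder) (x q z : L) : bool := lad_le q x && lad_le q z.

Definition tri_deg (L : ladder) (x q z : L) : nat := (lvl x + lvl z - 2 * lvl q)%N.

(** An algebra generated by idempotents and by arrows between adjacent levels,
   together with the basis cb of the paths which descend from x to q and ascend
   to z, and the coordinates co in this basis. The index of cb and co ranges
   over all triples for uniformity, and those which fail is_tri give 0. The
   four multiplication rules from ar_up_cb to cb_up_ar are the products with an
   arrow which stay in the basis; all other products are determined by the
   coordinates of the peaks, paths which go up and then down, about which only
   the symmetries co_sym and co_dual are used. The field la_univ says that the
   relations are quadratic. Quadratic duality and Koszulness follow from these
   properties alone. *)
Record ladder_algebra (K : fieldType) (L : ladder) := LadderAlgebra {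
  la_alg :> gralg K;
  ev : L -> la_alg;
  ar : L -> L -> la_alg;
  cb : L -> L -> L -> la_alg;
  co : la_alg -> L -> L -> L -> K;
  evM : forall x y, ev x * ev y = if x == y then ev x else 0;
  ev_sum : \sum_x ev x = 1;
  ar_evl : forall x y, ev y * ar x y = ar x y;
  ar_evr : forall x y, ar x y * ev x = ar x y;
  ar_nadj : forall x y, ~~ lad_adj x y -> ar x y = 0;
  ev_hom : forall x, gr_proj la_alg 0 (ev x) = ev x;
  ar_hom : forall x y, gr_proj la_alg 1 (ar x y) = ar x y;
  cb_ev : forall x, cb x x x = ev x;
  cb_ntri : forall x q z, ~~ is_tri x q z -> cb x q z = 0;
  ar_up_cb : forall x q y z, is_tri x q y -> lvl z = (lvl y).+1 ->
    ar y z * cb x q y = cb x q z;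
  ar_dn_cb : forall x y z, lad_le y x -> lvl y = (lvl z).+1 ->
    ar y z * cb x y y = cb x z z;
  cb_dn_ar : forall x y q z, is_tri x q z -> lvl y = (lvl x).+1 ->
    cb x q z * ar y x = cb y q z;
  cb_up_ar : forall x y z, lad_le x z -> lvl x = (lvl y).+1 ->
    cb x x z * ar y x = cb y y z;
  coD : forall a b x q z, co (a + b) x q z = co a x q z + co b x q z;
  coZ : forall c a x q z, co (gr_scal la_alg c * a) x q z = c * co a x q z;
  co_cb : forall x q z x' q' z', co (cb x q z) x' q' z' =
    (is_tri x q z && [&& x' == x, q' == q & z' == z])%:R;
  co_span : forall a,
    a = \sum_x \sum_q \sum_z gr_scal la_alg (co a x q z) * cb x q z;
  co_sym : forall x p z q,
    lvl x = lvl z -> lvl p = (lvl x).+1 -> lvl x = (lvl q).+1 ->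
    co (ar p z * ar x p) x q z = co (ar p x * ar z p) z q x;
  co_dual : forall x p z q,
    lvl x = lvl z -> lvl p = (lvl x).+1 -> lvl x = (lvl q).+1 ->
    co (ar (dual q) (dual z) * ar (dual x) (dual q)) (dual x) (dual p) (dual z) =
    - (-1) ^+ (x != z) * co (ar p z * ar x p) x q z;
  la_univ : forall (B : pzRingType) (sc : {rmorphism K -> B})
      (e : L -> B) (a : L -> L -> B),
    (forall c b, sc c * b = b * sc c) ->
    (forall x y, e x * e y = if x == y then e x else 0) ->
    \sum_x e x = 1 ->
    (forall x y, e y * a x y = a x y) -> (forall x y, a x y * e x = a x y) ->
    (forall x y, ~~ lad_adj x y -> a x y = 0) ->
    (forall x z (r : L -> K),
       \sum_w gr_scal la_alg (r w) * (ar w z * ar x w) = 0 ->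
       \sum_w sc (r w) * (a w z * a x w) = 0) ->
    exists f : {rmorphism la_alg -> B},
      [/\ forall c, f (gr_scal la_alg c) = sc c, forall x, f (ev x) = e x
        & forall x y, f (ar x y) = a x y]
}.
Arguments ev {K L l} x.
Arguments ar {K L l} x y.
Arguments cb {K L l} x q z.
Arguments co {K L l} a x q z.

Section LadderAlgebraTheory.
Variables (K : fieldType) (L : ladder) (A : ladder_algebra K L).
Local Notation "c %:S" := (gr_scal A c) (at level 2, format "c %:S").
Local Notation m := (height L).

Lemma is_triP (x q z : L) : is_tri x q z ->
  [/\ lad_le q x, lad_le q z, (lvl q <= lvl x)%N & (lvl q <= lvl z)%N].
Proof. by move=> /andP[h1 h2]; split => //; apply: lad_le_lvl. Qed.

Lemma is_tri_xx (x : L) : is_tri x x x.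
Proof. by rewrite /is_tri lad_le_refl. Qed.

Lemma is_tri_up (x q y z : L) : is_tri x q y -> lvl z = (lvl y).+1 -> is_tri x q z.
Proof.
move=> /andP[h1 h2] e; rewrite /is_tri h1 (@lad_le_trans _ y) // lad_lt_le //.
by rewrite e.
Qed.

(** Makes induction on the degree of a basis element possible: the last arrow of
   the path can be split off. *)
Lemma cb_factor (x q z : L) : is_tri x q z -> tri_deg x q z != 0%N ->
  exists y, [/\ is_tri x (if q == z then y else q) y,
     (tri_deg x (if q == z then y else q) y).+1 = tri_deg x q z &
     cb x q z = ar y z * cb x (if q == z then y else q) y :> A].
Proof.
move=> t d; have [h1 h2 h3 h4] := is_triP t.
have lz := lvl_le z; have lx := lvl_le x.
case: (eqVneq q z) => [e|ne].
  have lt : (lvl z < lvl x)%N by move: d; rewrite /tri_deg e; rewrite e in h3; lia.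
  pose y := if lvl x == (lvl z).+1 then x else vtx L false (lvl z).+1.
  have ly : lvl y = (lvl z).+1.
    by rewrite /y; case: eqP => [//|_]; rewrite lvl_vtx //; lia.
  have yx : lad_le y x.
    rewrite /y; case: eqP => [_|ne]; first exact: lad_le_refl.
    by apply: lad_lt_le; rewrite lvl_vtx; lia.
  exists y; split; first by rewrite /is_tri yx lad_le_refl.
    by rewrite /tri_deg e ly; have := lad_le_lvl yx; lia.
  by rewrite e ar_dn_cb.
have lt : (lvl q < lvl z)%N.
  by case/orP: h2 => // /eqP e; rewrite e eqxx in ne.
pose y := if lvl z == (lvl q).+1 then q else vtx L false (lvl z).-1.
have ly : (lvl y).+1 = lvl z.
  by rewrite /y; case: eqP => [//|_]; rewrite lvl_vtx //; lia.
have qy : lad_le q y.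
  rewrite /y; case: eqP => [_|ne']; first exact: lad_le_refl.
  by apply: lad_lt_le; rewrite lvl_vtx; lia.
have t' : is_tri x q y by rewrite /is_tri h1 qy.
exists y; split => //; last by rewrite ar_up_cb.
by rewrite /tri_deg -ly; have := lad_le_lvl qy; lia.
Qed.

Lemma cb_hom (x q z : L) : is_tri x q z ->
  gr_proj A (tri_deg x q z) (cb x q z) = cb x q z.
Proof.
have [n] := ubnP (tri_deg x q z); elim: n x q z => // n IH x q z hn t.
case: (eqVneq (tri_deg x q z) 0%N) => [e|ne].
  have [h1 h2 h3 h4] := is_triP t; rewrite e.
  have ex : q = x by apply: lad_le_eq => //; rewrite /tri_deg in e; lia.
  have ez : q = z by apply: lad_le_eq => //; rewrite /tri_deg in e; lia.
  by rewrite -ex -ez cb_ev ev_hom.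
have [y [t' d ->]] := cb_factor t ne.
rewrite -d -[_.+1]/(1 + _)%N; apply: gr_projM_hom; first exact: ar_hom.
by apply: IH => //; rewrite d.
Qed.

Lemma ev_cb (y x q z : L) : ev y * cb x q z = if y == z then cb x q z else 0 :> A.
Proof.
case: (boolP (is_tri x q z)) => [t|/cb_ntri ->]; last by rewrite mulr0 if_same.
have h (a : A) : ev z * a = a -> ev y * a = if y == z then a else 0.
  by move=> e; rewrite -{1}e mulrA evM; case: eqP => [->|]; rewrite ?mul0r.
apply: h; case: (eqVneq (tri_deg x q z) 0%N) => [e|ne].
  have [h1 h2 h3 h4] := is_triP t.
  have ex : q = x by apply: lad_le_eq => //; rewrite /tri_deg in e; lia.
  have ez : q = z by apply: lad_le_eq => //; rewrite /tri_deg in e; lia.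
  by rewrite -ex -ez cb_ev evM eqxx.
by have [w [_ _ ->]] := cb_factor t ne; rewrite mulrA ar_evl.
Qed.

Lemma cb_evr (y x q z : L) : cb x q z * ev y = if x == y then cb x q z else 0 :> A.
Proof.
suff h : cb x q z * ev x = cb x q z :> A.
  by rewrite -{1}h -mulrA evM; case: eqP => _ //; rewrite mulr0.
have [n] := ubnP (tri_deg x q z); elim: n q z => // n IH q z hn.
case: (boolP (is_tri x q z)) => [t|/cb_ntri ->]; last by rewrite mul0r.
case: (eqVneq (tri_deg x q z) 0%N) => [e|ne].
  have [h1 h2 h3 h4] := is_triP t.
  have ex : q = x by apply: lad_le_eq => //; rewrite /tri_deg in e; lia.
  have ez : q = z by apply: lad_le_eq => //; rewrite /tri_deg in e; lia.
  by rewrite -ex -ez cb_ev evM eqxx.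
by have [w [t' d ->]] := cb_factor t ne; rewrite -mulrA IH // d.
Qed.

Lemma co0 (x q z : L) : co (0 : A) x q z = 0.
Proof. by apply: (addrI (co (0 : A) x q z)); rewrite -coD !addr0. Qed.
Lemma co_sum (I : Type) (r : seq I) (P : pred I) (F : I -> A) (x q z : L) :
  co (\sum_(i <- r | P i) F i) x q z = \sum_(i <- r | P i) co (F i) x q z.
Proof.
by elim/big_rec2: _ => [|i a b _ <-]; rewrite ?co0 // coD.
Qed.
Lemma coN (a : A) x q z : co (- a) x q z = - co a x q z.
Proof. by apply: (addrI (co a x q z)); rewrite -coD !subrr co0. Qed.

(** A single index for the basis; the flattened coordinates cot turn co_span
   into one sum. *)
Definition tri := (L * L * L)%type.
Definition cbt (b : tri) : A := cb b.1.1 b.1.2 b.2.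
Definition cot (a : A) (b : tri) : K := co a b.1.1 b.1.2 b.2.
Definition tok (b : tri) : bool := is_tri b.1.1 b.1.2 b.2.
Definition tdeg (b : tri) : nat := tri_deg b.1.1 b.1.2 b.2.

Lemma cot_span a : a = \sum_(b : tri) (cot a b)%:S * cbt b.
Proof.
rewrite {1}(co_span a) pair_bigA pair_bigA /=; apply: eq_bigr => -[[x q] z] _.
by [].
Qed.
Lemma cot_cbt b b' : cot (cbt b) b' = (tok b && (b' == b))%:R.
Proof.
case: b b' => [[x q] z] [[x' q'] z']; rewrite /cot /cbt co_cb /=.
by rewrite !xpair_eqE -[in RHS]andbA.
Qed.
Lemma cot0 b : cot 0 b = 0. Proof. exact: co0. Qed.
Lemma cotD a a' b : cot (a + a') b = cot a b + cot a' b. Proof. exact: coD. Qed.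
Lemma cotZ c a b : cot (c%:S * a) b = c * cot a b. Proof. exact: coZ. Qed.
Lemma cot_sum (I : Type) (r : seq I) (P : pred I) (F : I -> A) b :
  cot (\sum_(i <- r | P i) F i) b = \sum_(i <- r | P i) cot (F i) b.
Proof. exact: co_sum. Qed.
Lemma cot_inj a a' : (forall b, cot a b = cot a' b) -> a = a'.
Proof. by move=> h; rewrite (cot_span a) (cot_span a'); apply: eq_bigr => b _; rewrite h. Qed.
Lemma cot_ntri a b : ~~ tok b -> cot a b = 0.
Proof.
move=> h; rewrite (cot_span a) cot_sum big1 // => b' _.
rewrite cotZ cot_cbt; case: eqP => [<-|]; last by rewrite andbF mulr0.
by rewrite (negbTE h) mulr0.
Qed.
Lemma cbt_ntri b : ~~ tok b -> cbt b = 0. Proof. exact: cb_ntri. Qed.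
Lemma cbt_hom n b : gr_proj A n (cbt b) = if n == tdeg b then cbt b else 0.
Proof.
case: (boolP (tok b)) => [t|/cbt_ntri->]; last by rewrite gr_proj0 if_same.
by rewrite /cbt -{1}(cb_hom t) gr_proj_proj cb_hom.
Qed.
(** The basis is homogeneous, so the components of an element are read off its
   coordinates. *)
Lemma cot_proj n a b : cot (gr_proj A n a) b = if n == tdeg b then cot a b else 0.
Proof.
rewrite {1}(cot_span a) gr_proj_big cot_sum.
transitivity (\sum_(b' : tri) (if n == tdeg b then cot a b' * cot (cbt b') b else 0)).
  apply: eq_bigr => b' _; rewrite gr_projZ cbt_hom; case: (eqVneq b b') => [<-|ne].
    by case: ifP; rewrite ?mulr0 ?cot0 // cotZ.
  rewrite cot_cbt (negbTE ne) andbF mulr0 if_same.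
  by case: ifP; rewrite ?mulr0 ?cot0 // cotZ cot_cbt (negbTE ne) andbF mulr0.
case: ifP => _; last by rewrite big1.
rewrite {2}(cot_span a) cot_sum; apply: eq_bigr => b' _.
by rewrite cotZ.
Qed.
Lemma cot_hom n a b : gr_proj A n a = a -> n != tdeg b -> cot a b = 0.
Proof. by move=> <- h; rewrite cot_proj (negbTE h). Qed.
Lemma cot_evl x a b : cot (ev x * a) b = if x == b.2 then cot a b else 0.
Proof.
rewrite {1}(cot_span a) big_distrr /= cot_sum.
transitivity (\sum_(b' : tri) (if x == b.2 then cot a b' * cot (cbt b') b else 0)).
  apply: eq_bigr => b' _; rewrite scalCA cotZ ev_cb; case: (eqVneq b b') => [<-|ne].
    by rewrite -[cb _ _ _]/(cbt b); case: ifP; rewrite ?mulr0 ?cot0 ?mulr0.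
  rewrite cot_cbt (negbTE ne) andbF mulr0 if_same -[cb _ _ _]/(cbt b').
  by case: ifP; rewrite ?mulr0 ?cot0 ?mulr0 // cot_cbt (negbTE ne) andbF mulr0.
case: ifP => _; last by rewrite big1.
rewrite {2}(cot_span a) cot_sum; apply: eq_bigr => b' _.
by rewrite cotZ.
Qed.
Lemma cot_evr x a b : cot (a * ev x) b = if x == b.1.1 then cot a b else 0.
Proof.
rewrite {1}(cot_span a) big_distrl /= cot_sum.
transitivity (\sum_(b' : tri) (if x == b.1.1 then cot a b' * cot (cbt b') b else 0)).
  apply: eq_bigr => b' _; rewrite -mulrA cotZ cb_evr; case: (eqVneq b b') => [<-|ne].
    by rewrite eq_sym -[cb _ _ _]/(cbt b); case: ifP; rewrite ?mulr0 ?cot0 ?mulr0.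
  rewrite cot_cbt (negbTE ne) andbF mulr0 if_same -[cb _ _ _]/(cbt b').
  by case: ifP; rewrite ?mulr0 ?cot0 ?mulr0 // cot_cbt (negbTE ne) andbF mulr0.
case: ifP => _; last by rewrite big1.
rewrite {2}(cot_span a) cot_sum; apply: eq_bigr => b' _.
by rewrite cotZ.
Qed.

End LadderAlgebraTheory.

(** * Orthogonality of the relations at dual vertices *)

Section Orthogonality.
Variables (K : fieldType) (L : ladder) (A : ladder_algebra K L).
Local Notation "c %:S" := (gr_scal A c) (at level 2, format "c %:S").
Local Notation m := (height L).

Definition path2l (x w z : L) : A := ar w z * ar x w.

(** The sign of an edge is the type of its lower end: the two paths across a
   square of the ladder then carry opposite signs. *)
Definition edge_sign (x y : L) : K := (-1) ^+ (if (lvl x < lvl y)%N then typ x else typ y).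

Lemma edge_signM x y : edge_sign x y * edge_sign x y = 1.
Proof. by rewrite -expr2 sqrr_sign. Qed.

Lemma ar_cb_up (x y : L) : lvl y = (lvl x).+1 -> ar x y = cb x x y :> A.
Proof. by move=> e; rewrite -(ar_evr A) -cb_ev ar_up_cb ?is_tri_xx. Qed.
Lemma ar_cb_dn (x y : L) : lvl x = (lvl y).+1 -> ar x y = cb x y y :> A.
Proof. by move=> e; rewrite -(ar_evr A) -cb_ev ar_dn_cb ?lad_le_refl. Qed.

Lemma path2_up x w z : lvl w = (lvl x).+1 -> lvl z = (lvl w).+1 ->
  path2l x w z = cb x x z.
Proof.
by move=> e1 e2; rewrite /path2l (ar_cb_up e1) ar_up_cb // (is_tri_up (is_tri_xx x) e1).
Qed.
Lemma path2_dn x w z : lvl x = (lvl w).+1 -> lvl w = (lvl z).+1 ->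
  path2l x w z = cb x z z.
Proof.
move=> e1 e2; rewrite /path2l (ar_cb_dn e1) ar_dn_cb // lad_lt_le //; lia.
Qed.
Lemma path2_valley x w z : lvl x = (lvl w).+1 -> lvl z = (lvl w).+1 ->
  path2l x w z = cb x w z.
Proof.
move=> e1 e2; rewrite /path2l (ar_cb_dn e1) ar_up_cb //.
by rewrite /is_tri lad_le_refl lad_lt_le //; lia.
Qed.

Lemma path2_nadj x w z : ~~ lad_adj x w || ~~ lad_adj w z -> path2l x w z = 0.
Proof. by case/orP=> /(ar_nadj A) h; rewrite /path2l h ?mul0r ?mulr0. Qed.

Lemma path2_evl x w z : ev z * path2l x w z = path2l x w z.
Proof. by rewrite /path2l mulrA ar_evl. Qed.
Lemma path2_evr x w z : path2l x w z * ev x = path2l x w z.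
Proof. by rewrite /path2l -mulrA ar_evr. Qed.
Lemma path2_proj x w z : gr_proj A 2 (path2l x w z) = path2l x w z.
Proof. by apply: (gr_projM_hom (i := 1) (j := 1)); exact: ar_hom. Qed.

Lemma cot_path2 x w z b : cot (path2l x w z) b =
  if (x == b.1.1) && (z == b.2) then co (path2l x w z) x b.1.2 z else 0.
Proof.
rewrite -{1}path2_evl cot_evl -{1}path2_evr cot_evr.
by rewrite /cot; case: (eqVneq x b.1.1) => [->|_]; case: (eqVneq z b.2) => [->|_].
Qed.

Lemma co_path2_deg x w z q : tri_deg x q z != 2%N -> co (path2l x w z) x q z = 0.
Proof.
move=> h; rewrite -[LHS]/(cot (path2l x w z) (x, q, z)).
by apply: (cot_hom (n := 2)); rewrite ?path2_proj // eq_sym.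
Qed.

(** The reversal of paths is an anti-automorphism of the algebra, which is seen
   here in degree 2 only. *)
Lemma co_rev x w z q : co (path2l x w z) x q z = co (path2l z w x) z q x.
Proof.
case: (boolP (lad_adj x w)) => [a1|h]; last first.
  by rewrite !path2_nadj ?co0 //; apply/orP; [right|left]; move: h; rewrite /lad_adj orbC.
case: (boolP (lad_adj w z)) => [a2|h]; last first.
  by rewrite !path2_nadj ?co0 //; apply/orP; [left|right]; move: h; rewrite /lad_adj orbC.
case/orP: a1 => /eqP e1; case/orP: a2 => /eqP e2.
- rewrite path2_dn // path2_up // !co_cb !eqxx !andbT /=.
  have -> : is_tri x z z by rewrite /is_tri lad_le_refl andbT lad_lt_le; lia.
  by have -> : is_tri z z x by rewrite /is_tri lad_le_refl lad_lt_le; lia.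
- rewrite path2_valley // path2_valley // !co_cb !eqxx !andbT /=.
  by have -> : is_tri x w z = is_tri z w x by rewrite /is_tri andbC.
- case: (eqVneq (lvl x) (lvl q).+1) => e; first by apply: (co_sym A); lia.
  by rewrite !co_path2_deg //; rewrite /tri_deg; lia.
- rewrite path2_up // path2_dn // !co_cb !eqxx !andbT /=.
  have -> : is_tri x x z by rewrite /is_tri lad_le_refl lad_lt_le; lia.
  by have -> : is_tri z x x by rewrite /is_tri lad_le_refl andbT lad_lt_le; lia.
Qed.

(** In a path over a peak the signs of the two edges are those of its ends,
   through a valley they are equal; this is the quotient of the two cases. *)
Lemma edge_sign_level (x z : L) : lvl x = lvl z -> (0 < lvl x < m)%N ->
  (-1) ^+ (typ x) * (-1) ^+ (typ z) = (-1) ^+ (x != z) :> K.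
Proof.
move=> e h; have -> : (x != z) = typ x (+) typ z.
  rewrite -(vtxK x) -(vtxK z) -e vtx_inj // !typ_vtx //.
  by case: (typ x); case: (typ z).
by rewrite signr_addb.
Qed.

(** The relations at (x, z) and at the dual pair are orthogonal. Between levels
   which differ by two there is one relation on both sides, and the edge signs
   are opposite. On one level, the coordinates of a peak p on a valley q and
   those of the dual of q on the dual of p are opposite up to a sign by
   co_dual, and only the terms w = p and w = q of the sum survive: w is a
   valley on the one side and a peak on the other. *)
Lemma path2_orth x z q q' :
  \sum_w edge_sign x w * edge_sign w z * co (path2l x w z) x q z *
     co (path2l (dual x) (dual w) (dual z)) (dual x) q' (dual z) = 0.
Proof.
have lx := lvl_le x; have lz := lvl_le z.
have dx := lvl_dualE x; have dz := lvl_dualE z.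
have F0 w : ~~ lad_adj x w || ~~ lad_adj w z -> edge_sign x w * edge_sign w z * co (path2l x w z) x q z *
     co (path2l (dual x) (dual w) (dual z)) (dual x) q' (dual z) = 0.
  by move=> h; rewrite path2_nadj // co0 mulr0 mul0r.
case: (eqVneq (lvl z) (lvl x).+2) => [e|ne1].
  rewrite (bigID (fun w => lvl w == (lvl x).+1)) /= [X in _ + X]big1 ?addr0 => [|w h]; last first.
    by apply: F0; rewrite /lad_adj; lia.
  pose C : K := (-1) ^+ typ x * (co (cb x x z : A) x q z *
      co (cb (dual x) (dual z) (dual z) : A) (dual x) q' (dual z)).
  rewrite (eq_bigr (fun w => (-1) ^+ typ w * C)) => [|w /eqP h].
    rewrite sum_lvl; last lia.
    by rewrite !typ_vtx; [rewrite /= expr0 expr1; ring | lia | lia].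
  have dw := lvl_dualE w.
  rewrite path2_up //; last by lia.
  rewrite path2_dn; [|lia|lia].
  have h1 : (lvl x < lvl w)%N by lia.
  have h2 : (lvl w < lvl z)%N by lia.
  by rewrite /edge_sign h1 h2 /C; ring.
case: (eqVneq (lvl x) (lvl z).+2) => [e|ne2].
  rewrite (bigID (fun w => lvl w == (lvl z).+1)) /= [X in _ + X]big1 ?addr0 => [|w h]; last first.
    by apply: F0; rewrite /lad_adj; lia.
  pose C : K := (-1) ^+ typ z * (co (cb x z z : A) x q z *
      co (cb (dual x) (dual x) (dual z) : A) (dual x) q' (dual z)).
  rewrite (eq_bigr (fun w => (-1) ^+ typ w * C)) => [|w /eqP h].
    rewrite sum_lvl; last lia.
    by rewrite !typ_vtx; [rewrite /= expr0 expr1; ring | lia | lia].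
  have dw := lvl_dualE w.
  rewrite path2_dn //; last by lia.
  rewrite path2_up; [|lia|lia].
  have h1 : (lvl x < lvl w)%N = false by lia.
  have h2 : (lvl w < lvl z)%N = false by lia.
  by rewrite /edge_sign h1 h2 /C; ring.
case: (eqVneq (lvl x) (lvl z)) => [e|ne3]; last first.
  by rewrite big1 // => w _; apply: F0; rewrite /lad_adj; lia.
case: (eqVneq (tri_deg x q z) 2%N) => [d|nd]; last first.
  by rewrite big1 // => w _; rewrite co_path2_deg // mulr0 mul0r.
case: (eqVneq (tri_deg (dual x) q' (dual z)) 2%N) => [d'|nd]; last first.
  by rewrite big1 // => w _; rewrite (co_path2_deg _ nd) mulr0.
rewrite /tri_deg in d d'.
(* From here on x and z are on one level, q is a valley and q' is the dual of a
   peak p; the coordinates at w vanish unless w is p or q. *)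
have [p q'E] : exists p, q' = dual p.
  exists (invF (@dual_inj L) q'); by rewrite f_invF.
have dp := lvl_dualE p; rewrite {}q'E in d' F0 *.
have pq : p != q by apply: contraTneq isT => pE; rewrite pE in dp d'; lia.
have lp : lvl p = (lvl x).+1 by lia.
have lq : lvl x = (lvl q).+1 by lia.
have dq := lvl_dualE q.
have tp : is_tri (dual x) (dual p) (dual z) by rewrite /is_tri !lad_lt_le //; lia.
have tq : is_tri x q z by rewrite /is_tri !lad_lt_le //; lia.
rewrite (bigD1 p) //= (bigD1 q) //=; last by rewrite eq_sym.
rewrite big1 ?addr0 => [|w /andP[wp wq]]; last first.
  case: (boolP (lad_adj x w)) => [/orP[]/eqP a1|h]; last by apply: F0; rewrite h.
    rewrite path2_valley; [|lia|lia].
    by rewrite co_cb [q == w]eq_sym (negbTE wq) !andbF mulr0 mul0r.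
  have dw := lvl_dualE w.
  rewrite [path2l (dual x) _ _]path2_valley; [|lia|lia].
  have pw : (dual p == dual w) = false.
    by rewrite (inj_eq (@dual_inj L)) eq_sym (negbTE wp).
  by rewrite co_cb pw !andbF mulr0.
rewrite [path2l x q z]path2_valley; [|lia|lia].
rewrite [path2l _ (dual p) _]path2_valley; [|lia|lia].
rewrite !co_cb !eqxx tp tq !mulr1 /= (co_dual A e lp lq).
have h1 : (lvl x < lvl p)%N by lia.
have h2 : (lvl p < lvl z)%N = false by lia.
have h3 : (lvl x < lvl q)%N = false by lia.
have h4 : (lvl q < lvl z)%N by lia.
rewrite /edge_sign h1 h2 h3 h4 edge_sign_level //; last by lia.
by rewrite -expr2 sqrr_sign; ring.
Qed.

Lemma path2_span x w z :
  path2l x w z = \sum_q (co (path2l x w z) x q z)%:S * cb x q z.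
Proof.
have h x' q z' : co (path2l x w z) x' q z' =
    if (x == x') && (z == z') then co (path2l x w z) x q z else 0.
  exact: (cot_path2 x w z (x', q, z')).
rewrite {1}[path2l x w z]co_span (bigD1 x) //= [X in _ + X]big1 ?addr0 => [|x' ne].
  apply: eq_bigr => q _; rewrite (bigD1 z) //= [X in _ + X]big1 ?addr0 // => z' ne.
  by rewrite h [z == z']eq_sym (negbTE ne) andbF rmorph0 mul0r.
rewrite big1 // => q _; rewrite big1 // => z' _.
by rewrite h [x == x']eq_sym (negbTE ne) rmorph0 mul0r.
Qed.

(** The same orthogonality, in the form in which it is used: the element of A
   (x) A attached to the pair (x, z), the signed sum of the paths tensor their
   duals, vanishes under every bilinear map. It gives that the Koszul
   differential squares to zero and that the relations of the quadratic dual
   hold in A. *)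
Lemma path2_tensor (Phi : A -> A -> A) x z :
  (forall u u' v, Phi (u + u') v = Phi u v + Phi u' v) ->
  (forall u v v', Phi u (v + v') = Phi u v + Phi u v') ->
  (forall c u v, Phi (c%:S * u) v = c%:S * Phi u v) ->
  (forall c u v, Phi u (c%:S * v) = c%:S * Phi u v) ->
  \sum_w (edge_sign x w * edge_sign w z)%:S *
     Phi (path2l x w z) (path2l (dual x) (dual w) (dual z)) = 0.
Proof.
move=> D1 D2 Z1 Z2.
have P0l v : Phi 0 v = 0 by apply: (addrI (Phi 0 v)); rewrite -D1 !addr0.
have P0r u : Phi u 0 = 0 by apply: (addrI (Phi u 0)); rewrite -D2 !addr0.
have Sl (F : L -> A) v : Phi (\sum_i F i) v = \sum_i Phi (F i) v.
  by elim/big_rec2: _ => [|i a b _ <-]; rewrite ?D1.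
have Sr (F : L -> A) u : Phi u (\sum_i F i) = \sum_i Phi u (F i).
  by elim/big_rec2: _ => [|i a b _ <-]; rewrite ?D2.
transitivity (\sum_w \sum_q \sum_q' (edge_sign x w * edge_sign w z * co (path2l x w z) x q z *
    co (path2l (dual x) (dual w) (dual z)) (dual x) q' (dual z))%:S *
    Phi (cb x q z) (cb (dual x) q' (dual z))).
  apply: eq_bigr => w _; rewrite {1}path2_span Sl big_distrr /=; apply: eq_bigr => q _.
  rewrite Z1 {1}[path2l (dual x) _ _]path2_span Sr !big_distrr /=; apply: eq_bigr => q' _.
  by rewrite Z2 !mulrA -!rmorphM.
rewrite exchange_big big1 //= => q _; rewrite exchange_big big1 //= => q' _.
by rewrite -big_distrl /= -rmorph_sum path2_orth rmorph0 mul0r.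
Qed.

Lemma co_path2_sum x z (r : L -> K) q :
  \sum_w (r w)%:S * path2l x w z = 0 ->
  \sum_w r w * co (path2l x w z) x q z = 0.
Proof.
move=> /(congr1 (fun a : A => co a x q z)); rewrite co_sum co0 => h.
by rewrite -[RHS]h; apply: eq_bigr => w _; rewrite coZ.
Qed.

(** Across a square both relations say that the sum of the coefficients is zero,
   and the signs of the two paths are opposite. *)
Lemma path2_relations_orth_square x z (r k : L -> K) c :
  (forall w, lad_adj x w && lad_adj w z = (lvl w == c)) -> (0 < c < m)%N ->
  (forall w, lvl w = c -> co (path2l x w z) x (if (lvl x < lvl z)%N then x else z) z = 1) ->
  (forall w, lvl w = c -> co (path2l (dual x) (dual w) (dual z)) (dual x)
     (if (lvl x < lvl z)%N then dual z else dual x) (dual z) = 1) ->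
  \sum_w (r w)%:S * path2l x w z = 0 ->
  \sum_w (k w)%:S * path2l (dual x) (dual w) (dual z) = 0 ->
  (exists C : K, forall w, lvl w = c -> edge_sign x w * edge_sign w z = C * (-1) ^+ typ w) ->
  \sum_(w | lad_adj x w && lad_adj w z) edge_sign x w * edge_sign w z * (r w * k w) = 0.
Proof.
move=> adjE hc h1 h2 hr hk [C hC].
have nadj w : (lvl w == c) = false -> ~~ lad_adj x w || ~~ lad_adj w z.
  by rewrite -adjE => h; rewrite -negb_and h.
have R0 : r (vtx L false c) + r (vtx L true c) = 0.
  rewrite -(sum_lvl r hc).
  apply: etrans (co_path2_sum (if (lvl x < lvl z)%N then x else z) hr).
  rewrite [LHS]big_mkcond; apply: eq_bigr => w _.
  by case: eqP => [/h1->|/eqP/negbTE/nadj h]; rewrite ?mulr1 // path2_nadj // co0 mulr0.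
have K0 : k (vtx L false c) + k (vtx L true c) = 0.
  have := congr1 (fun a : A => co a (dual x) (if (lvl x < lvl z)%N then dual z else dual x) (dual z)) hk.
  rewrite co_sum co0 -(sum_lvl k hc) => h; apply: etrans h; rewrite big_mkcond; apply: eq_bigr => w _.
  rewrite coZ; case: eqP => [/h2->|/eqP/negbTE/nadj h]; rewrite ?mulr1 // path2_nadj ?co0 ?mulr0 //.
  have dx := lvl_dualE x; have dz := lvl_dualE z; have dw := lvl_dualE w.
  by move: h; rewrite /lad_adj; lia.
rewrite (eq_bigl _ _ adjE) (eq_bigr (fun w => C * (-1) ^+ typ w * (r w * k w))); last first.
  by move=> w /eqP/hC ->.
rewrite sum_lvl // !typ_vtx // expr0 expr1.
have -> : r (vtx L true c) = - r (vtx L false c) by apply/eqP; rewrite -addr_eq0 addrC R0.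
have -> : k (vtx L true c) = - k (vtx L false c) by apply/eqP; rewrite -addr_eq0 addrC K0.
by ring.
Qed.

(** A relation on one level is determined by its coefficients on the peaks,
   which give those on the valleys through the coordinates M; the dual relation
   is determined by its coefficients on the valleys through the transposed
   matrix, up to signs. The two halves of the sum are then opposite. *)
Lemma path2_relations_orth_level x z (r k : L -> K) : lvl x = lvl z ->
  \sum_w (r w)%:S * path2l x w z = 0 ->
  \sum_w (k w)%:S * path2l (dual x) (dual w) (dual z) = 0 ->
  \sum_(w | lad_adj x w && lad_adj w z) edge_sign x w * edge_sign w z * (r w * k w) = 0.
Proof.
move=> e hr hk.
have lx := lvl_le x; have dx := lvl_dualE x; have dz := lvl_dualE z.
pose P (w : L) := lvl w == (lvl x).+1; pose Q (w : L) := lvl x == (lvl w).+1.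
pose M p q := co (path2l x p z) x q z.
pose s : K := (-1) ^+ (x != z).
have ss : s * s = 1 by rewrite -expr2 sqrr_sign.
have adjE w : lad_adj x w && lad_adj w z = Q w || P w by rewrite /lad_adj /P /Q; lia.
have split (F : L -> K) : (forall w, ~~ (Q w || P w) -> F w = 0) ->
    \sum_w F w = \sum_(w | Q w) F w + \sum_(w | P w) F w.
  move=> F0; rewrite (bigID Q) /=; congr (_ + _).
  rewrite big_mkcond [RHS]big_mkcond; apply: eq_bigr => w _ /=.
  case: (boolP (P w)) => [/eqP hP|hP].
    by have -> : Q w = false by rewrite /Q; lia.
  by case: (boolP (Q w)) => //= hQ; apply: F0; rewrite negb_or hQ.
have nadj w : ~~ (Q w || P w) -> ~~ lad_adj x w || ~~ lad_adj w z by rewrite -adjE negb_and.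
have hR q : Q q -> r q = - \sum_(p | P p) r p * M p q.
  move=> Qq; have /eqP lq := Qq; have := co_path2_sum q hr; rewrite split; last first.
    by move=> w /nadj h; rewrite path2_nadj // co0 mulr0.
  rewrite (bigD1 q) //= big1 ?addr0 => [|w /andP[/eqP Qw ne]]; last first.
    rewrite path2_valley //; last by lia.
    by rewrite co_cb [q == w]eq_sym (negbTE ne) !andbF mulr0.
  rewrite path2_valley //; last by lia.
  rewrite co_cb !eqxx !andbT (_ : is_tri x q z) ?mulr1; last first.
    by rewrite /is_tri !lad_lt_le //; lia.
  by move/eqP; rewrite addr_eq0 => /eqP.
have hK p : P p -> k p = \sum_(q | Q q) k q * (s * M p q).
  move=> Pp; have /eqP lp := Pp; have dp := lvl_dualE p.
  have := congr1 (fun a : A => co a (dual x) (dual p) (dual z)) hk.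
  rewrite co_sum co0 split; last first.
    move=> w /nadj h; rewrite path2_nadj ?mulr0 ?co0 //.
    by have dw := lvl_dualE w; move: h; rewrite /lad_adj; lia.
  rewrite [X in _ + X](bigD1 p) //= [X in _ + (_ + X)]big1 ?addr0 => [|w /andP[/eqP Pw ne]]; last first.
    have dw := lvl_dualE w.
    rewrite path2_valley; [|lia|lia].
    have pw : (dual p == dual w) = false.
      by rewrite (inj_eq (@dual_inj L)) eq_sym (negbTE ne).
    by rewrite coZ co_cb pw !andbF mulr0.
  rewrite [path2l _ (dual p) _]path2_valley; [|lia|lia].
  rewrite coZ co_cb !eqxx !andbT (_ : is_tri _ _ _) ?mulr1; last first.
    by rewrite /is_tri !lad_lt_le //; lia.
  move/eqP; rewrite addrC addr_eq0 => /eqP ->; rewrite -sumrN; apply: eq_bigr => q /eqP Qq.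
  by rewrite coZ (co_dual A e lp Qq) -/(path2l x p z) -/(M p q) -/s; ring.
rewrite (eq_bigl _ _ adjE) big_mkcond split /=; last by move=> w /negbTE ->.
rewrite (eq_bigr (fun q => - \sum_(p | P p) r p * M p q * k q)); last first.
  move=> q Qq; rewrite Qq /=; have /eqP lq := Qq.
  have e1 : (lvl x < lvl q)%N = false by lia.
  have e2 : (lvl q < lvl z)%N by lia.
  by rewrite /edge_sign e1 e2 -expr2 sqrr_sign mul1r (hR q Qq) mulNr big_distrl.
rewrite [X in _ + X](eq_bigr (fun p => \sum_(q | Q q) r p * M p q * k q)); last first.
  move=> p Pp; rewrite Pp orbT; have /eqP lp := Pp.
  have e1 : (lvl x < lvl p)%N by lia.
  have e2 : (lvl p < lvl z)%N = false by lia.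
  rewrite /edge_sign e1 e2 (hK p Pp) !big_distrr /=; apply: eq_bigr => q Qq.
  have /eqP lq := Qq.
  rewrite edge_sign_level //; last by have := lvl_le p; lia.
  by rewrite -/s; transitivity (s * s * (r p * M p q * k q)); [ring | rewrite ss mul1r].
by rewrite sumrN exchange_big addNr.
Qed.

(** Dual to path2_orth, as it pairs the relations between the paths instead of
   their coordinates. On one level each relation is determined by one half of
   its coefficients; across a square there is one relation up to scalars. *)
Lemma path2_relations_orth x z (r k : L -> K) :
  \sum_w (r w)%:S * path2l x w z = 0 ->
  \sum_w (k w)%:S * path2l (dual x) (dual w) (dual z) = 0 ->
  \sum_(w | lad_adj x w && lad_adj w z) edge_sign x w * edge_sign w z * (r w * k w) = 0.
Proof.
move=> hr hk; case: (eqVneq (lvl x) (lvl z)) => [e|ne3].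
  exact: path2_relations_orth_level.
have lx := lvl_le x; have lz := lvl_le z.
have dx := lvl_dualE x; have dz := lvl_dualE z.
case: (eqVneq (lvl z) (lvl x).+2) => [e|ne1].
  have e' : (lvl x < lvl z)%N by lia.
  apply: (path2_relations_orth_square (c := (lvl x).+1) (r := r) (k := k)) => // [w||w lw|w lw|].
  - by rewrite /lad_adj; lia.
  - by lia.
  - rewrite e' path2_up //; last by lia.
    by rewrite co_cb !eqxx !andbT (_ : is_tri _ _ _) // /is_tri lad_le_refl lad_lt_le.
  - have dw := lvl_dualE w; rewrite e' path2_dn; [|lia|lia].
    rewrite co_cb !eqxx !andbT (_ : is_tri _ _ _) // /is_tri lad_le_refl lad_lt_le //; lia.
  exists ((-1) ^+ typ x) => w lw; rewrite /edge_sign.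
  have -> : (lvl x < lvl w)%N by lia.
  by have -> : (lvl w < lvl z)%N by lia.
case: (eqVneq (lvl x) (lvl z).+2) => [e|ne2].
  have e' : (lvl x < lvl z)%N = false by lia.
  apply: (path2_relations_orth_square (c := (lvl z).+1) (r := r) (k := k)) => // [w||w lw|w lw|].
  - by rewrite /lad_adj; lia.
  - by lia.
  - rewrite e' path2_dn //; last by lia.
    by rewrite co_cb !eqxx !andbT (_ : is_tri _ _ _) // /is_tri lad_le_refl lad_lt_le //; lia.
  - have dw := lvl_dualE w; rewrite e' path2_up; [|lia|lia].
    rewrite co_cb !eqxx !andbT (_ : is_tri _ _ _) // /is_tri lad_le_refl lad_lt_le //; lia.
  exists ((-1) ^+ typ z) => w lw; rewrite /edge_sign mulrC.
  have -> : (lvl x < lvl w)%N = false by lia.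
  by have -> : (lvl w < lvl z)%N = false by lia.
by rewrite big1 // => w; rewrite /lad_adj; lia.
Qed.

End Orthogonality.

(** * Acyclicity of intervals and of the filtered complex *)

Section LadderIntervals.
Variables (K : fieldType) (L : ladder).
Local Notation m := (height L).
Local Notation sg z := ((-1) ^+ typ z : K).

Lemma sum_above (z w : L) (F : L -> K) : (lvl z < lvl w)%N ->
  \sum_(z' | (lvl z' == (lvl z).+1) && lad_le z' w) F z' =
  if ((lvl z).+1 == lvl w)%N then F w
  else F (vtx L false (lvl z).+1) + F (vtx L true (lvl z).+1).
Proof.
move=> h; have lw := lvl_le w; case: eqP => e.
  rewrite (big_pred1 w) // => z'; rewrite /lad_le e /=.
  by case: (eqVneq z' w) => [->|ne] /=; rewrite ?eqxx //; lia.
rewrite -sum_lvl; last lia.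
apply: eq_bigl => z'; case: eqP => //= l; rewrite lad_lt_le //; lia.
Qed.

Lemma sum_below (y q : L) (F : L -> K) : (lvl y < lvl q)%N ->
  \sum_(q' | (lvl q == (lvl q').+1) && lad_le y q') F q' =
  if (lvl q == (lvl y).+1)%N then F y
  else F (vtx L false (lvl q).-1) + F (vtx L true (lvl q).-1).
Proof.
move=> h; have lq := lvl_le q; case: eqP => e.
  rewrite (big_pred1 y) // => q'; rewrite /lad_le e /=.
  by rewrite eq_sym; case: (eqVneq q' y) => [->|ne] /=; rewrite ?eqxx //; lia.
rewrite -sum_lvl; last lia.
apply: eq_big => // q'; apply/idP/idP => [|/eqP l]; first by lia.
by rewrite lad_lt_le; lia.
Qed.

Lemma sgM (z : L) (c : K) : sg z * (sg z * c) = c.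
Proof. by rewrite mulrA -expr2 sqrr_sign mul1r. Qed.

Lemma sg_eq0 (z : L) (c : K) : sg z * c = 0 -> c = 0.
Proof. by move=> e; rewrite -(sgM z c) e mulr0. Qed.

Definition interval (a b z : L) : bool := lad_le a z && lad_le z b.

Lemma interval_level (a b : L) k : (lvl a < lvl b)%N -> (lvl a <= k <= lvl b)%N ->
  exists2 z, interval a b z & lvl z = k.
Proof.
move=> h hk; have lb := lvl_le b.
case: (eqVneq k (lvl a)) => [->|na].
  by exists a; rewrite // /interval lad_le_refl lad_lt_le.
case: (eqVneq k (lvl b)) => [->|nb].
  by exists b; rewrite // /interval lad_le_refl lad_lt_le.
exists (vtx L false k); rewrite ?lvl_vtx //; last by lia.
by rewrite /interval !lad_lt_le ?lvl_vtx //; lia.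
Qed.

(** The alternating complex of a nontrivial interval is acyclic: its levels have
   one element at each end and two in between, and each differential is a sum
   over the next level, with a sign. The hypothesis says that the sum of f over
   each level above the lowest one is zero. The value of g at the bottom can be
   taken to be 0. *)
Lemma interval_exact_down (q w : L) (f : L -> K) : (lvl q < lvl w)%N ->
  (forall z, interval q w z ->
     \sum_(z' | (lvl z' == (lvl z).+1) && lad_le z' w) f z' = 0) ->
  exists g : L -> K, g q = 0 /\ forall z, interval q w z ->
    f z = sg z * \sum_(z' | (lvl z' == (lvl z).+1) && lad_le z' w) g z'.
Proof.
move=> qw hf; have lw := lvl_le w.
(* g lives on one vertex of each level, so that its sum over a level is a
   single value, chosen to be that of f one level below. *)
pose low (z : L) := if lvl z == (lvl q).+1 then q else vtx L false (lvl z).-1.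
pose g (z : L) := if (lvl q < lvl z)%N && ((z == w) || typ z) then sg (low z) * f (low z) else 0.
exists g; split; first by rewrite /g ltnn.
move=> z; case/andP => qz zw.
case: (ltnP (lvl z) (lvl w)) => lzw; last first.
  have {zw} -> : z = w by apply: lad_le_eq.
  rewrite big_pred0 ?mulr0; last first.
    by move=> z'; apply/negP => /andP[/eqP e /lad_le_lvl]; lia.
  have [] := @interval_level q w (lvl w).-1 qw; first by lia.
  move=> u iu lu; have := hf u iu; rewrite sum_above; last by lia.
  by have -> : ((lvl u).+1 == lvl w)%N by lia.
pose first := if lvl z == lvl q then q else vtx L false (lvl z).
have lqz := lad_le_lvl qz.
have -> : \sum_(z' | (lvl z' == (lvl z).+1) && lad_le z' w) g z' = sg first * f first.
  rewrite sum_above //.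
  have lowE u : lvl u = (lvl z).+1 -> low u = first.
    by move=> e; rewrite /low /first e eqSS.
  case: eqP => e; first by rewrite /g eqxx /= (_ : (lvl q < lvl w)%N) // lowE // e.
  have lv b : lvl (vtx L b (lvl z).+1) = (lvl z).+1 by rewrite lvl_vtx; lia.
  have nw b : (vtx L b (lvl z).+1 == w) = false.
    by apply/eqP => E; have := lv b; rewrite E; lia.
  rewrite /g !nw /= !typ_vtx; [|lia|lia].
  rewrite andbF add0r lv andbT (lowE _ (lv true)).
  by have -> : (lvl q < (lvl z).+1)%N by lia.
case: (eqVneq (lvl z) (lvl q)) => e.
  rewrite /first e eqxx.
  have -> : z = q by symmetry; apply: lad_le_eq => //; rewrite e.
  by rewrite sgM.
have E : f (vtx L false (lvl z)) + f (vtx L true (lvl z)) = 0.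
  have [] := @interval_level q w (lvl z).-1 qw; first by lia.
  move=> u iu lu; have := hf u iu; rewrite sum_above; last by lia.
  have -> : (lvl u).+1 = lvl z by lia.
  by have -> : (lvl z == lvl w) = false by lia.
rewrite /first (negbTE e) typ_vtx; last by lia.
rewrite expr0 mul1r.
have := vtxK z; case: (typ z) => /= zE; rewrite -{1}zE ?expr0 ?mul1r //.
by rewrite expr1 mulN1r; apply/eqP; rewrite -addr_eq0 addrC E.
Qed.

(** The same for the complex whose differential sums over the level below, with
   the sign inside the sum. *)
Lemma interval_exact_up (y x : L) (f : L -> K) : (lvl y < lvl x)%N ->
  (forall q, interval y x q ->
     \sum_(q' | (lvl q == (lvl q').+1) && lad_le y q') sg q' * f q' = 0) ->
  exists g : L -> K, forall q, interval y x q ->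
    f q = \sum_(q' | (lvl q == (lvl q').+1) && lad_le y q') sg q' * g q'.
Proof.
move=> yx hf; have lx := lvl_le x.
(* Again g lives on one vertex of each level, now one level below the value of
   f which it produces. *)
pose up (q : L) := if (lvl q).+1 == lvl x then x else vtx L true (lvl q).+1.
pose g (q : L) := if (q == y) || ~~ typ q then sg q * f (up q) else 0.
exists g => q /andP[yq qx].
case: (ltnP (lvl y) (lvl q)) => lyq; last first.
  have <- : y = q by apply: lad_le_eq.
  rewrite big_pred0; last first.
    by move=> q'; apply/negP => /andP[/eqP e /lad_le_lvl]; lia.
  have [] := @interval_level y x (lvl y).+1 yx; first by lia.
  move=> u iu lu; have := hf u iu; rewrite sum_below; last by lia.
  by rewrite lu eqxx => /sg_eq0.
have lqx := lad_le_lvl qx.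
pose last := if lvl q == lvl x then x else vtx L true (lvl q).
have -> : \sum_(q' | (lvl q == (lvl q').+1) && lad_le y q') sg q' * g q' = f last.
  rewrite sum_below //.
  have upE u : (lvl u).+1 = lvl q -> up u = last by move=> e; rewrite /up /last e.
  case: eqP => e; first by rewrite /g eqxx /= sgM upE.
  have lv b : (lvl (vtx L b (lvl q).-1)).+1 = lvl q by rewrite lvl_vtx; lia.
  have nw b : (vtx L b (lvl q).-1 == y) = false.
    by apply/eqP => E; have := lv b; rewrite E; lia.
  rewrite /g !nw !typ_vtx; [|lia|lia].
  by rewrite /= expr0 !mul1r mulr0 addr0 (upE _ (lv false)).
case: (eqVneq (lvl q) (lvl x)) => e.
  rewrite /last e eqxx.
  by have -> : q = x by apply: lad_le_eq => //; rewrite e.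
have E : f (vtx L false (lvl q)) - f (vtx L true (lvl q)) = 0.
  have [] := @interval_level y x (lvl q).+1 yx; first by lia.
  move=> u iu lu; have := hf u iu; rewrite sum_below; last by lia.
  rewrite lu /=; have -> : ((lvl q).+1 == (lvl y).+1) = false by lia.
  by rewrite !typ_vtx ?expr0 ?expr1 ?mul1r ?mulN1r //; lia.
rewrite /last (negbTE e).
have := vtxK q; case: (typ q) => /= zE; rewrite -{1}zE //.
by apply/eqP; rewrite -subr_eq0 E.
Qed.

End LadderIntervals.

(** An abstract filtered complex. Its cochains are functions of q, z, w with q
   <= z <= w, q <= x and y <= w. One part of the differential, dbl_up, is that
   of the interval from q to w in the variable z; the other, dbl_low, goes to
   terms with q one level lower, and is required to have the form c_diag when
   q, z and w are equal. Since the intervals are acyclic unless they are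
   trivial, only the terms with q = z = w remain, and these form the complex of
   the interval from y to x. *)
Section LadderDouble.
Variables (K : fieldType) (L : ladder) (x y : L).
Local Notation m := (height L).
Local Notation sg z := ((-1) ^+ typ z : K).

Definition valid (q z w : L) : bool :=
  [&& lad_le q x, lad_le q z, lad_le z w & lad_le y w].

Variable c : L -> L -> L -> L -> L -> L -> K.
Hypothesis c_lvl : forall q z w q' z' w', c q z w q' z' w' != 0 ->
  lvl q = (lvl q').+1.
Hypothesis c_diag : forall q q' z' w', valid q q q -> valid q' z' w' ->
  c q q q q' z' w' =
  if [&& z' == q', w' == q' & lvl q == (lvl q').+1] then sg q' else 0.

Local Notation arr := (L -> L -> L -> K).

Definition dbl_up (X : arr) : arr := fun q z w =>
  sg z * \sum_(z' | (lvl z' == (lvl z).+1) && lad_le z' w) X q z' w.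
Definition dbl_low (X : arr) : arr := fun q z w =>
  \sum_q' \sum_z' \sum_w' c q z w q' z' w' * X q' z' w'.
Definition dbl (X : arr) : arr := fun q z w =>
  if valid q z w then dbl_up X q z w + dbl_low X q z w else 0.
Definition supported (X : arr) : Prop := forall q z w, ~~ valid q z w -> X q z w = 0.

Hypothesis dbl_dbl : forall X, supported X -> forall q z w, dbl (dbl X) q z w = 0.

Lemma dbl_lin a X Y q z w :
  dbl (fun q z w => X q z w + a * Y q z w) q z w = dbl X q z w + a * dbl Y q z w.
Proof.
rewrite /dbl; case: ifP => _; last by rewrite mulr0 addr0.
have -> : dbl_up (fun q z w => X q z w + a * Y q z w) q z w =
    dbl_up X q z w + a * dbl_up Y q z w.
  by rewrite /dbl_up big_split /= -big_distrr /=; ring.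
have -> : dbl_low (fun q z w => X q z w + a * Y q z w) q z w =
    dbl_low X q z w + a * dbl_low Y q z w.
  rewrite /dbl_low big_distrr -big_split; apply: eq_bigr => q' _ /=.
  rewrite big_distrr -big_split; apply: eq_bigr => z' _ /=.
  rewrite big_distrr -big_split; apply: eq_bigr => w' _ /=; ring.
by ring.
Qed.

Lemma dbl_low_lvl X k q z w : (forall q z w, (lvl q < k)%N -> X q z w = 0) ->
  (lvl q <= k)%N -> dbl_low X q z w = 0.
Proof.
move=> h hq; rewrite /dbl_low big1 // => q' _; rewrite big1 // => z' _; rewrite big1 // => w' _.
case: (eqVneq (c q z w q' z' w') 0) => [->|/c_lvl e]; first by rewrite mul0r.
by rewrite h ?mulr0 //; lia.
Qed.

Lemma dbl_diag X q : supported X -> valid q q q ->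
  dbl X q q q = \sum_(q' | (lvl q == (lvl q').+1) && lad_le y q') sg q' * X q' q' q'.
Proof.
move=> sX v; rewrite /dbl v /dbl_up big_pred0 ?mulr0 ?add0r; last first.
  by move=> z'; apply/negP => /andP[/eqP e /lad_le_lvl]; lia.
rewrite /dbl_low [RHS]big_mkcond; apply: eq_bigr => q' _.
transitivity (\sum_z' \sum_w' (if (z' == q') && (w' == q') then
    (if lvl q == (lvl q').+1 then sg q' * X q' q' q' else 0) else 0)).
  apply: eq_bigr => z' _; apply: eq_bigr => w' _.
  case: (boolP (valid q' z' w')) => [v'|nv]; last first.
    rewrite sX // mulr0; case: ifP => // /andP[/eqP e1 /eqP e2].
    by rewrite e1 e2 in nv; rewrite sX // mulr0 if_same.
  rewrite c_diag //; case: (eqVneq z' q') => [->|_]; rewrite ?mul0r //=.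
  by case: (eqVneq w' q') => [->|_]; rewrite ?mul0r //=; case: ifP; rewrite ?mul0r.
rewrite (bigD1 q') //= [X in _ + X]big1 ?addr0 => [|z' ne]; last first.
  by rewrite big1 // => w' _; rewrite (negbTE ne).
rewrite (bigD1 q') //= !eqxx [X in _ + X]big1 ?addr0 => [|w' ne]; last first.
  by rewrite (negbTE ne).
case: ifP => //= e; case: ifP => // nl; rewrite sX ?mulr0 //.
by rewrite /valid nl !andbF.
Qed.

(** Induction on the level of q. On the lowest level where X does not vanish,
   dbl_low does not contribute, so X is a cocycle for dbl_up and a coboundary;
   subtracting the coboundary raises the level. *)
Lemma dbl_exact_offdiag X : supported X -> (forall q z w, dbl X q z w = 0) ->
  (forall q, X q q q = 0) ->
  exists2 Y, supported Y & forall q z w, X q z w = dbl Y q z w.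
Proof.
move=> sX dX pX.
suff H n : forall X k, (m < k + n)%N -> supported X -> (forall q z w, dbl X q z w = 0) ->
    (forall q, X q q q = 0) -> (forall q z w, (lvl q < k)%N -> X q z w = 0) ->
    exists2 Y, supported Y & forall q z w, X q z w = dbl Y q z w.
  by apply: (H m.+1 X 0%N) => //; lia.
elim: n => [|n IH] {sX dX pX} X k hk sX dX pX lX.
  exists (fun _ _ _ => 0) => // q z w; rewrite lX; last by have := lvl_le q; lia.
  rewrite /dbl /dbl_up big1 // mulr0 add0r /dbl_low; case: ifP => // _.
  by rewrite big1 // => q' _; rewrite big1 // => z' _; rewrite big1 // => w' _; rewrite mulr0.
have G q w : exists g : L -> K, lvl q = k -> lad_le q x -> lad_le y w -> (lvl q < lvl w)%N ->
    g q = 0 /\ forall z, interval q w z ->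
    X q z w = sg z * \sum_(z' | (lvl z' == (lvl z).+1) && lad_le z' w) g z'.
  have [/eqP lq|] := boolP (lvl q == k); last by move=> ne; exists (fun _ => 0) => e; rewrite e eqxx in ne.
  have [qx|] := boolP (lad_le q x); last by exists (fun _ => 0).
  have [yw|] := boolP (lad_le y w); last by exists (fun _ => 0).
  have [qw|] := ltnP (lvl q) (lvl w); last by exists (fun _ => 0).
  have [|g hg] := @interval_exact_down K L q w (fun z => X q z w) qw; last by exists g.
  move=> z /andP[h1 h2]; have := dX q z w; rewrite /dbl /valid qx h1 h2 yw /=.
  by rewrite (dbl_low_lvl (k := k)) ?lq // addr0 => /sg_eq0.
have [g hg] : exists g : L -> L -> L -> K, forall q w, lvl q = k -> lad_le q x -> lad_le y w ->
    (lvl q < lvl w)%N -> g q w q = 0 /\ forall z, interval q w z ->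
    X q z w = sg z * \sum_(z' | (lvl z' == (lvl z).+1) && lad_le z' w) g q w z'.
  have /choice[g hg] := fun p : L * L => G p.1 p.2.
  by exists (fun q w => g (q, w)) => q w; exact: (hg (q, w)).
pose Y : arr := fun q z w =>
  if [&& valid q z w, lvl q == k & (lvl q < lvl w)%N] then g q w z else 0.
have sY : supported Y by move=> q z w /negbTE nv; rewrite /Y nv.
have lY q z w : (lvl q < k)%N -> Y q z w = 0.
  by move=> h; rewrite /Y [lvl q == k]ltn_eqF // !andbF.
have pY q : Y q q q = 0 by rewrite /Y ltnn !andbF.
(* Y has no diagonal terms because the primitives g vanish at the bottom of
   their interval; so X' still has none. *)
pose X' : arr := fun q z w => X q z w + (-1) * dbl Y q z w.
have dYk q z w : lvl q = k -> dbl Y q z w = X q z w.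
  move=> lq; case: (boolP (valid q z w)) => v; last by rewrite /dbl (negbTE v) sX.
  rewrite /dbl v (dbl_low_lvl (k := k)) ?lq // addr0 /dbl_up.
  have /and4P[h1 h2 h3 h4] := v.
  case: (ltnP (lvl q) (lvl w)) => qw; last first.
    have wq : w = q by symmetry; apply: lad_le_eq => //; exact: lad_le_trans h2 h3.
    have zq : z = q by symmetry; apply: lad_le_eq => //; rewrite -wq; exact: lad_le_lvl.
    rewrite wq zq pX big_pred0 ?mulr0 // => z'.
    by apply/negP => /andP[/eqP e /lad_le_lvl]; lia.
  have [_ hz] := hg q w lq h1 h4 qw; rewrite (hz z); last by rewrite /interval h2 h3.
  congr (_ * _); apply: eq_bigr => z' /andP[/eqP lz' zw'].
  rewrite /Y lq eqxx -lq qw /= andbT /valid h1 zw' h4.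
  by rewrite lad_lt_le //; have := lad_le_lvl h2; lia.
have [||q z w|q|q z w lq|Y' sY' hY'] := IH X' k.+1; first by lia.
- by move=> q z w nv; rewrite /X' sX // /dbl (negbTE nv) mulr0 addr0.
- by rewrite dbl_lin dX dbl_dbl // mulr0 addr0.
- rewrite /X' pX add0r; case: (boolP (valid q q q)) => v; last by rewrite /dbl (negbTE v) mulr0.
  by rewrite dbl_diag // big1 ?mulr0 // => q' _; rewrite pY mulr0.
- case: (eqVneq (lvl q) k) => e; first by rewrite /X' dYk //; ring.
  have lq' : (lvl q < k)%N by lia.
  rewrite /X' lX // /dbl /dbl_up big1 => [|z' _]; last by rewrite lY.
  by rewrite (dbl_low_lvl (k := k)) ?(ltnW lq') // mulr0 addr0 if_same mulr0 addr0.
exists (fun q z w => Y' q z w + 1 * Y q z w).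
  by move=> q z w nv; rewrite sY' // sY // mulr0 addr0.
by move=> q z w; rewrite dbl_lin -hY' /X'; ring.
Qed.

(** The diagonal part of X is a cocycle of the interval from y to x, hence a
   coboundary unless x = y; once it is removed the previous lemma applies. *)
Lemma dbl_exact X : supported X -> (forall q z w, dbl X q z w = 0) ->
  (x = y -> X x x x = 0) ->
  exists2 Y, supported Y & forall q z w, X q z w = dbl Y q z w.
Proof.
move=> sX dX X0.
have [g hg] : exists g : L -> K, forall q, valid q q q -> X q q q =
    \sum_(q' | (lvl q == (lvl q').+1) && lad_le y q') sg q' * g q'.
  case: (ltnP (lvl y) (lvl x)) => yx; last first.
    exists (fun _ => 0) => q /and4P[qx _ _ yq]; rewrite big1 => [|? _]; last by rewrite mulr0.
    have yx' := lad_le_trans yq qx; have e := lad_le_eq yx' yx.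
    by rewrite {}e in yq X0 *; have -> := lad_le_eq qx (lad_le_lvl yq); rewrite X0.
  have [|g hg] := @interval_exact_up K L y x (fun q => X q q q) yx.
    move=> q /andP[yq qx]; have v : valid q q q by rewrite /valid qx yq lad_le_refl.
    by rewrite -(dbl_diag sX v) dX.
  by exists g => q /and4P[qx _ _ yq]; apply: hg; rewrite /interval yq.
pose Y : arr := fun q z w =>
  if [&& valid q z w, z == q & w == q] then g q else 0.
have sY : supported Y by move=> q z w /negbTE nv; rewrite /Y nv.
have YE q q' : valid q q q -> (lvl q == (lvl q').+1) && lad_le y q' -> Y q' q' q' = g q'.
  move=> /and4P[qx _ _ _] /andP[/eqP e yq']; rewrite /Y !eqxx /valid yq' !lad_le_refl.
  by rewrite (lad_le_trans _ qx) // lad_lt_le // e.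
have [|q z w|q|Y' sY' hY'] := @dbl_exact_offdiag (fun q z w => X q z w + (-1) * dbl Y q z w).
- by move=> q z w nv; rewrite sX // /dbl (negbTE nv) mulr0 addr0.
- by rewrite dbl_lin dX dbl_dbl // mulr0 addr0.
- case: (boolP (valid q q q)) => v; last by rewrite sX // /dbl (negbTE v) mulr0 addr0.
  rewrite dbl_diag // hg // mulN1r; apply/eqP; rewrite subr_eq0; apply/eqP.
  by apply: eq_bigr => q' h; rewrite (YE q).
exists (fun q z w => Y' q z w + 1 * Y q z w).
  by move=> q z w nv; rewrite sY' // sY // mulr0 addr0.
by move=> q z w; rewrite dbl_lin -hY'; ring.
Qed.

End LadderDouble.

(** * The Koszul complex *)

Section KoszulDifferential.
Variables (K : fieldType) (L : ladder) (A : ladder_algebra K L).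
Local Notation "c %:S" := (gr_scal A c) (at level 2, format "c %:S").
Local Notation m := (height L).
Local Notation kfun := {ffun tri L -> A}.

(** The A-valued linear extension of a function on the basis. *)
Definition ext (xi : kfun) (a : A) : A := \sum_b (cot a b)%:S * xi b.

Lemma extD xi a a' : ext xi (a + a') = ext xi a + ext xi a'.
Proof.
rewrite /ext -big_split; apply: eq_bigr => b _ /=.
by rewrite cotD rmorphD mulrDl.
Qed.
Lemma extZ xi c a : ext xi (c%:S * a) = c%:S * ext xi a.
Proof.
rewrite /ext big_distrr; apply: eq_bigr => b _ /=.
by rewrite cotZ rmorphM mulrA.
Qed.
Lemma ext0 xi : ext xi 0 = 0.
Proof. by apply: (addrI (ext xi 0)); rewrite -extD !addr0. Qed.
Lemma ext_lin c (xi eta : kfun) a :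
  ext [ffun b => c * xi b + eta b] a = c * ext xi a + ext eta a.
Proof.
rewrite /ext big_distrr -big_split; apply: eq_bigr => b _ /=.
by rewrite ffunE mulrDr scalCA.
Qed.

(** The Koszul differential, before its values on the basis are taken: arrows of
   A on one side are paired with the arrows between dual vertices on the other. *)
Definition kmap (xi : kfun) (a : A) : A := \sum_z \sum_z'
  (edge_sign K z z')%:S * (ext xi (ar z z' * a) * ar (dual z) (dual z')).

Lemma kmapD xi a a' : kmap xi (a + a') = kmap xi a + kmap xi a'.
Proof.
rewrite /kmap -big_split; apply: eq_bigr => z _ /=; rewrite -big_split.
by apply: eq_bigr => z' _ /=; rewrite mulrDr extD mulrDl mulrDr.
Qed.
Lemma kmapZ xi c a : kmap xi (c%:S * a) = c%:S * kmap xi a.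
Proof.
rewrite /kmap big_distrr; apply: eq_bigr => z _ /=; rewrite big_distrr.
by apply: eq_bigr => z' _ /=; rewrite scalCA extZ -!mulrA scalCA.
Qed.
Lemma kmap0 xi : kmap xi 0 = 0.
Proof. by apply: (addrI (kmap xi 0)); rewrite -kmapD !addr0. Qed.
Lemma kmap_lin c (xi eta : kfun) a :
  kmap [ffun b => c * xi b + eta b] a = c * kmap xi a + kmap eta a.
Proof.
rewrite /kmap big_distrr -big_split; apply: eq_bigr => z _ /=.
rewrite big_distrr -big_split; apply: eq_bigr => z' _ /=.
by rewrite ext_lin scalCA -!mulrDr mulrDl !mulrA.
Qed.
Lemma kmap_sum (I : Type) (r : seq I) (P : pred I) (F : I -> A) xi :
  kmap xi (\sum_(i <- r | P i) F i) = \sum_(i <- r | P i) kmap xi (F i).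
Proof. by elim/big_rec2: _ => [|i a b _ <-]; rewrite ?kmap0 // kmapD. Qed.

Definition kdiff (xi : kfun) : kfun := [ffun b => kmap xi (cbt A b)].

Lemma kdiffE xi b : kdiff xi b = kmap xi (cbt A b). Proof. by rewrite ffunE. Qed.

Lemma ext_kdiff xi a : ext (kdiff xi) a = kmap xi a.
Proof.
rewrite {2}(cot_span a) kmap_sum; apply: eq_bigr => b _.
by rewrite kdiffE kmapZ.
Qed.

Lemma ar_mul0 (z z' x y : L) : z != y -> ar z z' * ar x y = 0 :> A.
Proof.
move=> ne; rewrite -(ar_evr A z) -(ar_evl A x) -mulrA (mulrA (ev z)) evM (negbTE ne).
by rewrite mul0r mulr0.
Qed.

(** The square of the differential is the sum over all pairs (z, z2) of the
   bilinear expression of path2_tensor. *)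
Lemma kdiff_kdiff xi : kdiff (kdiff xi) = 0.
Proof.
apply/ffunP => b; rewrite kdiffE [RHS]ffunE; set a := cbt A b.
transitivity (\sum_z \sum_z2 \sum_w (edge_sign K z w * edge_sign K w z2)%:S *
    (ext xi (path2l A z w z2 * a) * path2l A (dual z) (dual w) (dual z2))).
  rewrite /kmap; apply: eq_bigr => z _; rewrite exchange_big /=; apply: eq_bigr => w _.
  rewrite ext_kdiff /kmap (bigD1 w) //= [X in _ + X]big1 ?addr0 => [|z1 ne]; last first.
    by rewrite big1 // => z2 _; rewrite [ar z1 z2 * _]mulrA ar_mul0 // mul0r ext0 mul0r mulr0.
  rewrite big_distrl big_distrr /=; apply: eq_bigr => z2 _.
  by rewrite /path2l !mulrA -rmorphM.
rewrite big1 // => z _; rewrite big1 // => z2 _.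
apply: (path2_tensor (Phi := fun u v => ext xi (u * a) * v)).
- by move=> u u' v; rewrite mulrDl extD mulrDl.
- by move=> u v v'; rewrite mulrDr.
- by move=> c u v; rewrite -mulrA extZ mulrA.
- by move=> c u v; rewrite scalCA.
Qed.

(** The functions which stand for elements of the direct sum, over the basis
   elements b from x to z, of the left ideals generated by the idempotent of
   the dual of z. *)
Definition kok (xi : kfun) : Prop :=
  forall b, xi b = if tok b then xi b * ev (dual b.2) else 0.

Lemma kmap_cbt xi (b : tri L) : kmap xi (cbt A b) = \sum_z'
  (edge_sign K b.2 z')%:S * (ext xi (ar b.2 z' * cbt A b) * ar (dual b.2) (dual z')).
Proof.
rewrite /kmap (bigD1 b.2) //= [X in _ + X]big1 ?addr0 // => z ne.
rewrite big1 // => z' _; rewrite -(ar_evr A z) -mulrA ev_cb (negbTE ne).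
by rewrite mulr0 ext0 mul0r mulr0.
Qed.

Lemma kok_kdiff xi : kok (kdiff xi).
Proof.
move=> b; case: (boolP (tok b)) => [t|/(cbt_ntri A) h]; last by rewrite kdiffE h kmap0.
rewrite kdiffE kmap_cbt big_distrl; apply: eq_bigr => z' _ /=.
by rewrite -!mulrA ar_evr.
Qed.

Lemma cot_ar_deg (b b' : tri L) z z' : cot (ar z z' * cbt A b) b' != 0 ->
  tdeg b' = (tdeg b).+1.
Proof.
move=> h; apply/eqP; apply: contraNT h => ne; apply/eqP.
apply: (cot_hom (n := 1 + tdeg b)); last by rewrite eq_sym.
by apply: gr_projM_hom; rewrite ?ar_hom // cbt_hom eqxx.
Qed.

Lemma kdiff_deg (xi : kfun) n b : (forall b, tdeg b != n.+1 -> xi b = 0) ->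
  tdeg b != n -> kdiff xi b = 0.
Proof.
move=> h ne; rewrite kdiffE /kmap big1 // => z _; rewrite big1 // => z' _.
rewrite /ext big1 ?mul0r ?mulr0 // => b' _.
case: (eqVneq (cot (ar z z' * cbt A b) b') 0) => [->|/cot_ar_deg e]; first by rewrite rmorph0 mul0r.
by rewrite h ?mulr0 // e eqSS.
Qed.

Lemma kdiff_trunc (xi : kfun) n b : tdeg b = n ->
  kdiff [ffun b => if tdeg b == n.+1 then xi b else 0] b = kdiff xi b.
Proof.
move=> e; rewrite !kdiffE /kmap; apply: eq_bigr => z _; apply: eq_bigr => z' _.
congr (_ * (_ * _)); rewrite /ext; apply: eq_bigr => b' _; rewrite ffunE.
case: (eqVneq (cot (ar z z' * cbt A b) b') 0) => [->|/cot_ar_deg e']; first by rewrite rmorph0 !mul0r.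
by rewrite e' e eqxx.
Qed.

(** The coordinates of xi: its component at the basis element (x, q, z) is a
   combination of paths from dual z through dual w to dual y. All coordinates
   are written with the vertices of the original ladder, where the conditions
   become q <= x, q <= z <= w and y <= w. The vertices x and y do not change
   under the differential, so each pair (x, y) gives a complex of its own. *)
Definition karr (xi : kfun) (x y : L) : L -> L -> L -> K := fun q z w =>
  co (xi (x, q, z)) (dual z) (dual w) (dual y).

Definition kcoef (x y q z w q' z' w' : L) : K :=
  edge_sign K z z' * co (ar z z' * cb x q z : A) x q' z' *
  co (cb (dual z') (dual w') (dual y) * ar (dual z) (dual z') : A)
     (dual z) (dual w) (dual y).

Definition kcoef_low (x y q z w q' z' w' : L) : K :=
  if (lvl z == (lvl z').+1) then kcoef x y q z w q' z' w' else 0.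

Lemma kok_span xi x q z : kok xi -> xi (x, q, z) =
  \sum_y \sum_w (karr xi x y q z w)%:S * cb (dual z) (dual w) (dual y).
Proof.
move=> h; rewrite exchange_big /=.
rewrite {1}(co_span (xi (x, q, z))) (bigD1 (dual z)) //= [X in _ + X]big1 ?addr0 => [|x' ne].
  by rewrite -sum_dualE; apply: eq_bigr => w _; rewrite -sum_dualE.
rewrite big1 // => q' _; rewrite big1 // => z' _.
rewrite h; case: ifP => _; last by rewrite co0 rmorph0 mul0r.
rewrite -[co _ _ _ _]/(cot (xi (x, q, z) * ev (dual z)) (x', q', z')) cot_evr /=.
by rewrite eq_sym (negbTE ne) rmorph0 mul0r.
Qed.

Lemma karr_supported xi x y : kok xi -> supported x y (karr xi x y).
Proof.
move=> h q z w; apply: contraNeq => nz.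
have t1 : tok (x, q, z).
  by apply: contraNT nz => nt; rewrite /karr h (negbTE nt) co0.
have t2 : tok (dual z, dual w, dual y).
  by apply: contraNT nz => nt; rewrite /karr -[co _ _ _ _]/(cot _ (_, _, _)) cot_ntri.
have /andP[/= h1 h2] := t1; have /andP[/=] := t2; rewrite !dual_le => h3 h4.
by rewrite /valid h1 h2 h3 h4.
Qed.

Lemma karr_kdiff_coef xi x y q z w : kok xi -> karr (kdiff xi) x y q z w =
  \sum_q' \sum_z' \sum_w' kcoef x y q z w q' z' w' * karr xi x y q' z' w'.
Proof.
move=> h; rewrite [LHS]/karr kdiffE kmap_cbt co_sum exchange_big /=; apply: eq_bigr => z' _.
rewrite coZ.
have -> : ext xi (ar z z' * cb x q z) =
    \sum_q' (co (ar z z' * cb x q z : A) x q' z')%:S * xi (x, q', z').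
  rewrite /ext.
  transitivity (\sum_(b : tri L) if (b.1.1 == x) && (b.2 == z') then
      (co (ar z z' * cb x q z : A) x b.1.2 z')%:S * xi (x, b.1.2, z') else 0).
    apply: eq_bigr => -[[x1 q1] z1] _ /=.
    have -> : ar z z' * cb x q z = ev z' * (ar z z' * cb x q z * ev x) :> A.
      by rewrite !mulrA ar_evl -mulrA cb_evr eqxx.
    rewrite cot_evl cot_evr /= eq_sym; case: (eqVneq z1 z') => [->|_]; last first.
      by rewrite andbF rmorph0 mul0r.
    rewrite andbT eq_sym; case: (eqVneq x1 x) => [->|_]; last by rewrite rmorph0 mul0r.
    by rewrite !mulrA ar_evl -[_ * cb x q z * _]mulrA cb_evr eqxx.
  rewrite -(pair_bigA _ (fun p z1 => if (p.1 == x) && (z1 == z') then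
      (co (ar z z' * cb x q z : A) x p.2 z')%:S * xi (x, p.2, z') else 0)) /=.
  rewrite -(pair_bigA _ (fun x1 q1 => \sum_z1 if (x1 == x) && (z1 == z') then
      (co (ar z z' * cb x q z : A) x q1 z')%:S * xi (x, q1, z') else 0)) /=.
  rewrite (bigD1 x) //= [X in _ + X]big1 ?addr0 => [|x1 ne]; last first.
    by rewrite big1 // => q1 _; rewrite big1 // => z1 _; rewrite (negbTE ne).
  apply: eq_bigr => q1 _; rewrite (bigD1 z') //= !eqxx big1 ?addr0 // => z1 ne.
  by rewrite (negbTE ne) andbF.
rewrite big_distrl co_sum big_distrr /=; apply: eq_bigr => q' _.
rewrite -mulrA coZ (kok_span _ _ _ h) big_distrl co_sum /=.
rewrite (bigD1 y) //= [X in _ + X]big1 ?addr0 => [|y' ne]; last first.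
  rewrite big_distrl co_sum big1 // => w' _ /=; rewrite -mulrA coZ.
  have -> : cb (dual z') (dual w') (dual y') * ar (dual z) (dual z') =
    ev (dual y') * (cb (dual z') (dual w') (dual y') * ar (dual z) (dual z')) :> A.
    by rewrite mulrA ev_cb eqxx.
  rewrite -[co _ _ _ _]/(cot _ (_, _, _)) cot_evl /= (inj_eq (@dual_inj L)) (negbTE ne).
  by rewrite mulr0.
rewrite big_distrl co_sum !big_distrr /=; apply: eq_bigr => w' _.
by rewrite -mulrA coZ /kcoef; ring.
Qed.

(** An ascending arrow from z to z' extends the path of the basis element, and
   its dual descends and is absorbed at the other end: this is dbl_up, the part
   which only moves z. The descending arrows give the rest. *)
Lemma karr_kdiff xi x y q z w : kok xi ->
  karr (kdiff xi) x y q z w = dbl x y (kcoef_low x y) (karr xi x y) q z w.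
Proof.
move=> h; rewrite /dbl; case: ifP => [v|nv]; last first.
  by apply: karr_supported; [exact: kok_kdiff|rewrite nv].
have /and4P[h1 h2 h3 h4] := v.
have t : is_tri x q z by rewrite /is_tri h1 h2.
rewrite karr_kdiff_coef //.
have -> : dbl_up (karr xi x y) q z w = \sum_q' \sum_z' \sum_w'
    (if lvl z' == (lvl z).+1 then kcoef x y q z w q' z' w' else 0) * karr xi x y q' z' w'.
  rewrite /dbl_up exchange_big /= big_distrr /= big_mkcond /=; apply: eq_bigr => z' _.
  case: (eqVneq (lvl z') (lvl z).+1) => [e|_] /=; last first.
    by rewrite big1 // => q' _; rewrite big1 // => w' _; rewrite mul0r.
  have e' : lvl (dual z) = (lvl (dual z')).+1.
    by have := lvl_dualE z; have := lvl_dualE z'; have := lvl_le z'; lia.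
  have esE : edge_sign K z z' = (-1) ^+ typ z by rewrite /edge_sign e ltnSn.
  transitivity ((-1) ^+ typ z * karr xi x y q z' w).
    case: (boolP (lad_le z' w)) => [//|zw].
    by rewrite karr_supported ?mulr0 // /valid (negbTE zw) !andbF.
  rewrite (bigD1 q) //= [X in _ + X]big1 ?addr0 => [|q' ne]; last first.
    rewrite big1 // => w' _; rewrite /kcoef ar_up_cb // co_cb (negbTE ne).
    by rewrite !andbF mulr0 !mul0r.
  rewrite (bigD1 w) //= [X in _ + X]big1 ?addr0 => [|w' ne]; last first.
    rewrite /kcoef; case: (boolP (is_tri (dual z') (dual w') (dual y))) => [t'|nt].
      have nw : (dual w == dual w') = false.
        by rewrite (inj_eq (@dual_inj L)) eq_sym (negbTE ne).
      by rewrite (cb_dn_ar A t' e') co_cb nw !andbF mulr0 mul0r.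
    by rewrite (cb_ntri A nt) mul0r co0 mulr0 mul0r.
  rewrite /kcoef esE ar_up_cb // co_cb !eqxx !andbT (is_tri_up t e) mulr1.
  case: (boolP (is_tri (dual z') (dual w) (dual y))) => [t'|nt].
    rewrite (cb_dn_ar A t' e') co_cb !eqxx !andbT.
    have -> : is_tri (dual z) (dual w) (dual y).
      by rewrite /is_tri !dual_le h3 h4.
    by rewrite mulr1.
  rewrite karr_supported ?mulr0 //; apply: contraNN nt => /and4P[_ _ h5 h6].
  by rewrite /is_tri !dual_le h5 h6.
rewrite /dbl_low -big_split; apply: eq_bigr => q' _ /=.
rewrite -big_split; apply: eq_bigr => z' _ /=.
rewrite -big_split; apply: eq_bigr => w' _ /=.
rewrite /kcoef_low -mulrDl; congr (_ * _).
case: (eqVneq (lvl z') (lvl z).+1) => [->|n1] /=.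
  by rewrite [_ == _.+2]ltn_eqF ?addr0 //; lia.
case: (eqVneq (lvl z) (lvl z').+1) => [|n2]; first by rewrite add0r.
rewrite addr0 /kcoef ar_nadj ?mul0r ?co0 ?mulr0 ?mul0r //.
by rewrite /lad_adj negb_or n1 n2.
Qed.

(** For degree reasons: a descending arrow lowers z by one level and raises the
   degree by one, so q goes down as well. *)
Lemma kcoef_low_lvl x y q z w q' z' w' : kcoef_low x y q z w q' z' w' != 0 ->
  lvl q = (lvl q').+1.
Proof.
rewrite /kcoef_low; case: (eqVneq (lvl z) (lvl z').+1) => [e|_]; last by rewrite eqxx.
rewrite /kcoef !mulf_eq0 !negb_or => /andP[/andP[_ h] _].
have t' : tok (x, q', z').
  by apply: contraNT h => nt; rewrite -[co _ _ _ _]/(cot _ (x, q', z')) cot_ntri.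
have t : tok (x, q, z).
  apply: contraNT h => nt; rewrite [cb x q z](cbt_ntri A nt) mulr0 co0 //.
have := @cot_ar_deg (x, q, z) (x, q', z') z z' h; rewrite /tdeg /tri_deg /=.
have [_ _] := is_triP t; have [_ _] := is_triP t'; rewrite /=; lia.
Qed.

Lemma kcoef_low_diag x y q q' z' w' : valid x y q q q -> valid x y q' z' w' ->
  kcoef_low x y q q q q' z' w' =
  if [&& z' == q', w' == q' & lvl q == (lvl q').+1] then (-1) ^+ typ q' else 0.
Proof.
move=> /and4P[qx _ _ yq] /and4P[q'x q'z' z'w' yw'].
rewrite /kcoef_low; case: (eqVneq (lvl q) (lvl z').+1) => [e|ne]; last first.
  by case: (eqVneq z' q') => [<-|//]; rewrite (negbTE ne) andbF.
have e' : lvl (dual z') = (lvl (dual q)).+1.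
  by have := lvl_dualE q; have := lvl_dualE z'; have := lvl_le q; lia.
have z'x : lad_le z' x by apply: lad_le_trans qx; apply: lad_lt_le; rewrite e.
rewrite /kcoef (ar_dn_cb A qx e) co_cb !eqxx /= andbT.
have -> : is_tri x z' z' by rewrite /is_tri z'x lad_le_refl.
case: (eqVneq z' q') => [<-|ne] /=; last by rewrite mulr0 mul0r.
rewrite e eqxx andbT mulr1.
have -> : edge_sign K q z' = (-1) ^+ typ z'.
  by rewrite /edge_sign (_ : (lvl q < lvl z')%N = false) //; lia.
case: (eqVneq w' z') => [E|ne].
  rewrite {}E in yw' *; by rewrite cb_up_ar // ?dual_le // co_cb !eqxx !andbT /is_tri lad_le_refl dual_le yq mulr1.
have lt : (lvl z' < lvl w')%N.
  by case/orP: z'w' => // /eqP E; rewrite E eqxx in ne.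
rewrite -[co _ _ _ _]/(cot (_ : A) (dual q, dual q, dual y)).
rewrite (@cot_hom _ _ _ (tri_deg (dual z') (dual w') (dual y) + 1)) ?mulr0 //.
  apply: gr_projM_hom; last exact: ar_hom.
  by have := cbt_hom A (tri_deg (dual z') (dual w') (dual y)) (dual z', dual w', dual y); rewrite eqxx.
rewrite /tdeg /tri_deg /=.
have := lvl_dualE q; have := lvl_dualE z'; have := lvl_dualE w'; have := lvl_dualE y.
have := lad_le_lvl yq; have := lad_le_lvl yw'; lia.
Qed.

Definition krec (Y : L -> L -> L -> L -> L -> K) : kfun :=
  [ffun b : tri L => \sum_y \sum_w (Y b.1.1 y b.1.2 b.2 w)%:S *
     cb (dual b.2) (dual w) (dual y)].

Lemma kok_krec Y : (forall x y, supported x y (Y x y)) -> kok (krec Y).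
Proof.
move=> sY b; rewrite ffunE; case: (boolP (tok b)) => [t|nt].
  rewrite big_distrl; apply: eq_bigr => y _; rewrite big_distrl; apply: eq_bigr => w _ /=.
  by rewrite -mulrA cb_evr eqxx.
rewrite big1 // => y _; rewrite big1 // => w _; rewrite sY ?rmorph0 ?mul0r //.
by apply: contraNN nt => /and4P[h1 h2 _ _]; rewrite /tok /is_tri h1 h2.
Qed.

Lemma karr_krec Y x y q z w : (forall x y, supported x y (Y x y)) ->
  karr (krec Y) x y q z w = Y x y q z w.
Proof.
move=> sY; rewrite /karr ffunE /= co_sum (bigD1 y) //= [X in _ + X]big1 ?addr0 => [|y' ne].
  rewrite co_sum (bigD1 w) //= [X in _ + X]big1 ?addr0 => [|w' ne].
    rewrite coZ co_cb !eqxx !andbT; case: (boolP (is_tri _ _ _)) => [_|nt]; first by rewrite mulr1.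
    rewrite mulr0 sY //; apply: contraNN nt => /and4P[_ _ h1 h2].
    by rewrite /is_tri !dual_le h1 h2.
  have nw : (dual w == dual w') = false.
    by rewrite (inj_eq (@dual_inj L)) eq_sym (negbTE ne).
  by rewrite coZ co_cb nw !andbF mulr0.
have ny : (dual y == dual y') = false.
  by rewrite (inj_eq (@dual_inj L)) eq_sym (negbTE ne).
by rewrite co_sum big1 // => w' _; rewrite coZ co_cb ny !andbF mulr0.
Qed.

Lemma karr_inj xi eta : kok xi -> kok eta ->
  (forall x y q z w, karr xi x y q z w = karr eta x y q z w) -> xi = eta.
Proof.
move=> h1 h2 h; apply/ffunP => -[[x q] z]; rewrite !kok_span //.
by apply: eq_bigr => y _; apply: eq_bigr => w _; rewrite h.
Qed.

(** Any array of coordinates comes from a chain, and the square of the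
   differential of chains is zero. *)
Lemma dbl_kcoef x y X : supported x y X -> forall q z w,
  dbl x y (kcoef_low x y) (dbl x y (kcoef_low x y) X) q z w = 0.
Proof.
move=> sX q z w.
pose Y x' y' q z w := if (x' == x) && (y' == y) then X q z w else 0.
have sY x' y' : supported x' y' (Y x' y').
  move=> q' z' w'; rewrite /Y; case: ifP => // /andP[/eqP-> /eqP->].
  exact: sX.
have XE : X = karr (krec Y) x y.
  apply/funext => q'; apply/funext => z'; apply/funext => w'.
  by rewrite karr_krec // /Y !eqxx.
have E : dbl x y (kcoef_low x y) X = karr (kdiff (krec Y)) x y.
  apply/funext => q'; apply/funext => z'; apply/funext => w'.
  by rewrite karr_kdiff ?XE //; exact: kok_krec.
rewrite E -karr_kdiff; last exact: kok_kdiff.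
by rewrite kdiff_kdiff /karr ffunE co0.
Qed.

(** Exactness for each pair (x, y) by the abstract filtered complex. The only
   obstruction, for x = y, is the degree 0 coordinate of xi at the idempotent
   x. *)
Lemma kdiff_exact xi : kok xi -> kdiff xi = 0 ->
  (forall x, co (xi (x, x, x)) (dual x) (dual x) (dual x) = 0) ->
  exists2 eta, kok eta & xi = kdiff eta.
Proof.
move=> h d0 a0.
have H (p : L * L) : exists Y : L -> L -> L -> K, supported p.1 p.2 Y /\
    forall q z w, karr xi p.1 p.2 q z w = dbl p.1 p.2 (kcoef_low p.1 p.2) Y q z w.
  case: p => x y /=.
  have [||||||Y sY hY] := @dbl_exact K L x y (kcoef_low x y) _ _ _ (karr xi x y).
  - exact: kcoef_low_lvl.
  - by move=> *; exact: kcoef_low_diag.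
  - exact: dbl_kcoef.
  - exact: karr_supported.
  - by move=> q z w; rewrite -karr_kdiff // d0 /karr ffunE co0.
  - by move=> ->; exact: a0.
  by exists Y.
have /choice[Y hY] := H.
pose Y' x y := Y (x, y).
have sY x y : supported x y (Y' x y) by case: (hY (x, y)).
exists (krec Y'); first exact: kok_krec.
apply: karr_inj => // [|x y q z w]; first exact: kok_kdiff.
rewrite karr_kdiff; last exact: kok_krec.
have [_ /= ->] := hY (x, y).
congr dbl; apply/funext => q'; apply/funext => z'; apply/funext => w'.
by rewrite karr_krec.
Qed.

End KoszulDifferential.

(** * Components of degree 0 and 1 *)

Section DegreeZeroOne.
Variables (K : fieldType) (L : ladder) (A : ladder_algebra K L).
Local Notation "c %:S" := (gr_scal A c) (at level 2, format "c %:S").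

Definition tri_diag (x : L) : tri L := (x, x, x).

Lemma tdeg0 (b : tri L) : tok b -> tdeg b = 0%N -> b = tri_diag b.2.
Proof.
case: b => [[x q] z] t; have [h1 h2 h3 h4] := is_triP t; rewrite /tdeg /tri_deg /= in h1 h2 h3 h4 *.
move=> e; have ex : q = x by apply: lad_le_eq => //; lia.
have ez : q = z by apply: lad_le_eq => //; lia.
by rewrite /tri_diag -ex -ez.
Qed.

Lemma tok_diag x : tok (tri_diag x). Proof. exact: is_tri_xx. Qed.
Lemma tdeg_diag x : tdeg (tri_diag x) = 0%N.
Proof. by rewrite /tdeg /tri_deg /=; lia. Qed.
Lemma cbt_diag x : cbt A (tri_diag x) = ev x. Proof. exact: cb_ev. Qed.

Lemma gr_proj0E (a : A) : gr_proj A 0 a = \sum_x (cot a (tri_diag x))%:S * ev x.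
Proof.
apply: cot_inj => b; rewrite cot_proj cot_sum.
have [/eqP d|nd] := boolP (0 == tdeg b)%N; last first.
  rewrite big1 // => x _; rewrite cotZ -cbt_diag cot_cbt.
  case: (eqVneq b (tri_diag x)) => [e|]; last by rewrite andbF mulr0.
  by rewrite e tdeg_diag in nd.
case: (boolP (tok b)) => [t|nt]; last first.
  by rewrite cot_ntri // big1 // => x _; rewrite cotZ [cot (ev x) b]cot_ntri ?mulr0.
rewrite (bigD1 b.2) //= big1 ?addr0 => [|x ne].
  by rewrite cotZ -cbt_diag cot_cbt -tdeg0 // eqxx t mulr1.
rewrite cotZ -cbt_diag cot_cbt; case: (eqVneq b (tri_diag x)) => [e|]; last by rewrite andbF mulr0.
by rewrite e eqxx in ne.
Qed.

Lemma deg0_ev (y : A) x : gr_proj A 0 y = y -> ev x * y = y ->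
  y = (cot y (tri_diag x))%:S * ev x.
Proof.
move=> h e; rewrite -{1}e -{1}h gr_proj0E big_distrr /= (bigD1 x) //= big1 ?addr0.
  by rewrite scalCA evM eqxx.
by move=> x' ne; rewrite scalCA evM eq_sym (negbTE ne) mulr0.
Qed.

Lemma cot_mul_ar (u : A) x y t : tdeg t = 1%N ->
  cot (u * ar x y) t = cot u (tri_diag y) * cot (ar x y : A) t.
Proof.
move=> d; have -> : cot (u * ar x y) t = cot (gr_proj A 1 (u * ar x y)) t.
  by rewrite cot_proj d eqxx.
rewrite gr_projM !big_ord_recl big_ord0 addr0 /= !subn0 subnn.
have -> : gr_proj A 0 (ar x y : A) = 0 by rewrite -ar_hom gr_proj_proj.
rewrite mulr0 addr0 ar_hom gr_proj0E big_distrl cot_sum /= (bigD1 y) //= big1 ?addr0.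
  by rewrite -mulrA cotZ ar_evl.
move=> y' ne; rewrite -mulrA -(ar_evl A x y) [ev y' * _]mulrA evM (negbTE ne) mul0r.
by rewrite mulr0 cot0.
Qed.

Lemma cot_ar_mul (u : A) x y t : tdeg t = 1%N ->
  cot (ar x y * u) t = cot u (tri_diag x) * cot (ar x y : A) t.
Proof.
move=> d; have -> : cot (ar x y * u) t = cot (gr_proj A 1 (ar x y * u)) t.
  by rewrite cot_proj d eqxx.
rewrite gr_projM !big_ord_recl big_ord0 addr0 /= !subn0 subnn.
have -> : gr_proj A 0 (ar x y : A) = 0 by rewrite -ar_hom gr_proj_proj.
rewrite mul0r add0r ar_hom gr_proj0E big_distrr cot_sum /= (bigD1 x) //= big1 ?addr0.
  by rewrite scalCA cotZ ar_evr.
move=> y' ne; rewrite scalCA -(ar_evr A x y) -mulrA evM eq_sym (negbTE ne) !mulr0.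
by rewrite cot0.
Qed.

Definition tri_ar (x y : L) : tri L := (x, if (lvl x < lvl y)%N then x else y, y).

Lemma tri_arP x y : lad_adj x y ->
  [/\ tok (tri_ar x y), tdeg (tri_ar x y) = 1%N & ar x y = cbt A (tri_ar x y)].
Proof.
move=> /orP[/eqP e|/eqP e]; rewrite /tok /tdeg /tri_deg /tri_ar /cbt /=.
  have -> : (lvl x < lvl y)%N = false by lia.
  by rewrite (ar_cb_dn A e) e /is_tri lad_le_refl lad_lt_le ?e //; split=> //; lia.
have -> : (lvl x < lvl y)%N by lia.
by rewrite (ar_cb_up A e) e /is_tri lad_le_refl lad_lt_le ?e //; split=> //; lia.
Qed.

End DegreeZeroOne.

(** * The Koszul resolution *)

Section KoszulModules.
Variables (K : fieldType) (L : ladder) (A : ladder_algebra K L).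
Local Notation "c %:S" := (gr_scal A c) (at level 2, format "c %:S").
Local Notation kfun := {ffun tri L -> A}.

Definition kpred n : {pred kfun} := fun xi =>
  [forall b, xi b == if tok b && (tdeg b == n) then xi b * ev (dual b.2) else 0].

Lemma kpredP n (xi : kfun) : reflect (kok xi /\ forall b, tdeg b != n -> xi b = 0) (kpred n xi).
Proof.
apply: (iffP forallP) => [h|[h1 h2] b].
  split=> b; have /eqP e := h b; last by rewrite e => /negbTE ->; rewrite andbF.
  by move: e; case: (tok b) => //=; case: (_ == n) => // ->; rewrite mul0r.
apply/eqP; case: (eqVneq (tdeg b) n) => [_|ne]; last by rewrite andbF h2.
by rewrite andbT; exact: h1.
Qed.

Lemma kpred_closed n : zmod_closed (kpred n).
Proof.
split=> [|xi eta /kpredP[h1 h2] /kpredP[h3 h4]]; apply/kpredP; split.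
- by move=> b; rewrite ffunE mul0r if_same.
- by move=> b _; rewrite ffunE.
- move=> b; rewrite !ffunE (h1 b) (h3 b); case: ifP => _; last by rewrite subr0.
  by rewrite mulrBl -!mulrA evM eqxx.
by move=> b ne; rewrite !ffunE h2 // h4 // subr0.
Qed.
HB.instance Definition _ n := GRing.isZmodClosed.Build kfun (kpred n) (kpred_closed n).

(** The n-th term of the Koszul resolution: the part of the direct sum described
   at kok which is indexed by the basis elements of degree n. *)
Record kmod n := KMod { kval : kfun; _ : kpred n kval }.
HB.instance Definition _ n := [isSub for @kval n].
HB.instance Definition _ n := [Choice of kmod n by <:].
HB.instance Definition _ n := [SubChoice_isSubZmodule of kmod n by <:].

Lemma kvalP n (xi : kmod n) : kok (kval xi) /\ forall b, tdeg b != n -> kval xi b = 0.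
Proof. by case: xi => xi /= /kpredP. Qed.

Lemma kmod_eq n (xi eta : kmod n) : (forall b, kval xi b = kval eta b) -> xi = eta.
Proof. by move=> h; apply: val_inj; apply/ffunP. Qed.

Lemma kscale_subproof n (a : A) (xi : kmod n) : kpred n [ffun b => a * kval xi b].
Proof.
have [h1 h2] := kvalP xi; apply/kpredP; split=> b; rewrite !ffunE.
  by rewrite {1}h1; case: ifP => _; rewrite ?mulrA ?mulr0.
by move=> ne; rewrite h2 // mulr0.
Qed.
Definition kscale n a (xi : kmod n) : kmod n := KMod (kscale_subproof a xi).

Fact kscaleA n a b (xi : kmod n) : kscale a (kscale b xi) = kscale (a * b) xi.
Proof. by apply: kmod_eq => c; rewrite !ffunE mulrA. Qed.
Fact kscale1 n : left_id 1 (@kscale n).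
Proof. by move=> xi; apply: kmod_eq => c; rewrite !ffunE mul1r. Qed.
Fact kscaleDr n : right_distributive (@kscale n) +%R.
Proof. by move=> a xi eta; apply: kmod_eq => c; rewrite !ffunE mulrDr. Qed.
Fact kscaleDl n (xi : kmod n) : {morph (@kscale n)^~ xi : a b / a + b}.
Proof. by move=> a b; apply: kmod_eq => c; rewrite !ffunE mulrDl. Qed.
HB.instance Definition _ n := GRing.Zmodule_isLmodule.Build A (kmod n)
  (@kscaleA n) (@kscale1 n) (@kscaleDr n) (@kscaleDl n).

Lemma kvalZ n a (xi : kmod n) b : kval (a *: xi) b = a * kval xi b.
Proof. by rewrite ffunE. Qed.
Lemma kvalD n (xi eta : kmod n) b : kval (xi + eta) b = kval xi b + kval eta b.
Proof. by rewrite ffunE. Qed.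
Lemma kval0 n b : kval (0 : kmod n) b = 0.
Proof. by rewrite ffunE. Qed.
Lemma kval_sum n (I : Type) (r : seq I) (P : pred I) (F : I -> kmod n) b :
  kval (\sum_(i <- r | P i) F i) b = \sum_(i <- r | P i) kval (F i) b.
Proof. by elim/big_rec2: _ => [|i x y _ <-]; rewrite ?kval0 ?kvalD. Qed.

Lemma kdelta_subproof n b0 : kpred n [ffun b : tri L =>
  if [&& b == b0, tok b & tdeg b == n] then ev (dual b.2) else 0 : A].
Proof.
apply/kpredP; split=> b; rewrite !ffunE.
  case: (boolP (tok b)) => _; last by rewrite andbF.
  by case: ifP => _; rewrite ?evM ?eqxx ?mul0r.
by move=> /negbTE ->; rewrite !andbF.
Qed.
(** The generators of the n-th term, defined for all triples for uniformity and
   0 when the triple is not of degree n. *)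
Definition kdelta n b0 : kmod n := KMod (kdelta_subproof n b0).

Lemma kdeltaE n b0 b : kval (kdelta n b0) b =
  if [&& b == b0, tok b & tdeg b == n] then ev (dual b.2) else 0.
Proof. by rewrite ffunE. Qed.

Lemma kmod_span n (xi : kmod n) : xi = \sum_b kval xi b *: kdelta n b.
Proof.
apply: kmod_eq => b; rewrite kval_sum (big_only (i := b)) => [|b' ne].
  rewrite kvalZ kdeltaE eqxx; have [h1 h2] := kvalP xi.
  case: (eqVneq (tdeg b) n) => [_|ne]; last by rewrite h2 // mul0r.
  by rewrite {1}h1 andbT /=; case: ifP; rewrite ?mulr0.
by rewrite kvalZ kdeltaE eq_sym (negbTE ne) mulr0.
Qed.

Lemma linear_span n (M : lmodType A) (f : {linear kmod n -> M}) xi :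
  f xi = \sum_b kval xi b *: f (kdelta n b).
Proof.
by rewrite {1}(kmod_span xi) linear_sum; apply: eq_bigr => b _; rewrite linearZ.
Qed.

Lemma kmod_projective n : projective (kmod n).
Proof.
move=> M N p g psurj.
have [w hw] := choice (fun b : tri L => psurj (g (kdelta n b))).
have [|h hE] := @linear_of A (kmod n) M (fun xi => \sum_b kval xi b *: w b).
  move=> a xi eta; under eq_bigr do rewrite kvalD kvalZ scalerDl -scalerA.
  by rewrite big_split scaler_sumr.
exists h => xi; rewrite hE linear_sum (linear_span g); apply: eq_bigr => b _.
by rewrite linearZ hw.
Qed.

Lemma kd_subproof n (xi : kmod n.+1) : kpred n (kdiff (kval xi)).
Proof.
apply/kpredP; split; first exact: kok_kdiff.
by move=> b; apply: kdiff_deg; case: (kvalP xi).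
Qed.
Definition kd n (xi : kmod n.+1) : kmod n := KMod (kd_subproof xi).

Lemma kdE n (xi : kmod n.+1) b : kval (kd xi) b = kmap (kval xi) (cbt A b).
Proof. exact: kdiffE. Qed.

Fact kd_linear n : linear (@kd n).
Proof.
move=> a xi eta; apply: kmod_eq => b.
rewrite kvalD kvalZ !kdE -kmap_lin; congr (kmap _ _).
by apply/ffunP => c; rewrite !ffunE.
Qed.
HB.instance Definition _ n := GRing.isLinear.Build A (kmod n.+1) (kmod n) _
  (@kd n) (@kd_linear n).

(** The augmentation identifies the 0-th term, a sum of the left ideals of all
   idempotents, with A. *)
Definition ksum (xi : kmod 0) : A := \sum_x kval xi (tri_diag x).
Definition kaug (xi : kmod 0) : gr0_module A :=
  GrComp (gr0_scale_subproof (ksum xi)).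

Fact kaug_linear : linear kaug.
Proof.
move=> a xi eta; apply: val_inj => /=.
have -> : ksum (a *: xi + eta) = a * ksum xi + ksum eta.
  rewrite /ksum; under eq_bigr do rewrite kvalD kvalZ.
  by rewrite big_split big_distrr.
by rewrite gr_projD gr_projM big_ord1 subn0.
Qed.
HB.instance Definition _ := GRing.isLinear.Build A (kmod 0) (gr0_module A) _
  kaug kaug_linear.

Lemma cot_kval_diag n (xi : kmod n) b x :
  cot (kval xi b) (tri_diag x) = if x == dual b.2 then cot (kval xi b) (tri_diag x) else 0.
Proof.
have [h _] := kvalP xi; rewrite {1}h; case: (tok b) (h b) => h'; last by rewrite h' cot0 if_same.
by rewrite cot_evr eq_sym.
Qed.

Lemma cot_kaug (xi : kmod 0) x :
  cot (gr_val (kaug xi)) (tri_diag (dual x)) = cot (kval xi (tri_diag x)) (tri_diag (dual x)).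
Proof.
rewrite /= cot_proj tdeg_diag eqxx /ksum cot_sum (bigD1 x) //= big1 ?addr0 // => y ne.
by rewrite cot_kval_diag (inj_eq (@dual_inj L)) eq_sym (negbTE ne).
Qed.

Lemma cot_mul_ar_diag (u : A) x y z : cot (u * ar x y) (tri_diag z) = 0.
Proof.
have -> : cot (u * ar x y) (tri_diag z) = cot (gr_proj A 0 (u * ar x y)) (tri_diag z).
  by rewrite cot_proj tdeg_diag.
by rewrite gr_projM big_ord1 subnn -(ar_hom A x y) gr_proj_proj mulr0 cot0.
Qed.

Lemma cot_kmap_diag xi a x : cot (kmap xi a : A) (tri_diag x) = 0.
Proof.
rewrite /kmap cot_sum big1 // => z _; rewrite cot_sum big1 // => z' _.
by rewrite cotZ cot_mul_ar_diag mulr0.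
Qed.

Lemma kaug_surj y : exists xi, kaug xi = y.
Proof.
have h : kpred 0 [ffun b : tri L => if b.1.1 == b.2 then
    if tok b && (tdeg b == 0)%N then gr_val y * ev (dual b.2) else 0 else 0 : A].
  apply/kpredP; split=> b; rewrite !ffunE; case: (tok b) => //=.
  - by case: ifP; rewrite ?mul0r //; case: ifP; rewrite ?mul0r // -mulrA evM eqxx.
  - by rewrite if_same.
  - by move=> /negbTE ->; rewrite if_same.
  - by rewrite if_same.
exists (KMod h); apply: val_inj => /=; rewrite -[RHS]gr_valP; congr (gr_proj _ _ _).
rewrite /ksum; under eq_bigr => x _ do rewrite ffunE tok_diag tdeg_diag !eqxx /=.
by rewrite -big_distrr (sum_dualE (fun x => ev x : A)) ev_sum /= mulr1.
Qed.

(** A primitive can be replaced by its homogeneous part, since the differential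
   is homogeneous. *)
Lemma kexact_trunc n (xi : kmod n) (eta : kfun) : kok eta -> kval xi = kdiff eta ->
  exists eta', xi = @kd n eta'.
Proof.
move=> keta xiE.
have h : kpred n.+1 [ffun b => if tdeg b == n.+1 then eta b else 0].
  apply/kpredP; split=> b; rewrite ffunE.
    by rewrite {1}keta; case: ifP => _; case: ifP => _; rewrite ?mul0r.
  by move=> /negbTE ->.
exists (KMod h); apply: kmod_eq => b; have [_ h2] := kvalP xi.
case: (eqVneq (tdeg b) n) => [e|ne].
  by rewrite xiE kdE -kdiffE kdiff_trunc.
by rewrite h2 //; have [_ ->] := kvalP (kd (KMod h)).
Qed.

(** The obstruction to exactness in kdiff_exact is the degree 0 part of the
   augmentation. *)
Lemma kexact0 (xi : kmod 0) : kaug xi = 0 <-> exists eta, xi = kd eta.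
Proof.
split=> [a0|[eta ->]]; last first.
  apply: val_inj => /=; rewrite gr_proj0E big1 // => x _.
  rewrite /ksum cot_sum big1 ?rmorph0 ?mul0r // => y _.
  by rewrite kdE cot_kmap_diag.
have d0 : kdiff (kval xi) = 0.
  apply/ffunP => b; rewrite kdiffE ffunE /kmap big1 // => z _; rewrite big1 // => z' _.
  rewrite /ext big1 ?mul0r ?mulr0 // => b' _.
  case: (eqVneq (cot (ar z z' * cbt A b) b') 0) => [->|/cot_ar_deg e].
    by rewrite rmorph0 mul0r.
  by have [_ ->] := kvalP xi; rewrite ?mulr0 // e.
have [||eta keta xiE] := kdiff_exact _ d0.
- by case: (kvalP xi).
- by move=> x; rewrite -[LHS]cot_kaug a0 -[RHS](cot0 A (tri_diag (dual x))).
exact: kexact_trunc keta xiE.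
Qed.

Lemma kexactS n (xi : kmod n.+1) : kd xi = 0 <-> exists eta, xi = kd eta.
Proof.
split=> [x0|[eta ->]]; last first.
  apply: kmod_eq => b; rewrite kdE kval0 -kdiffE.
  have -> : kval (kd eta) = kdiff (kval eta) by [].
  by rewrite kdiff_kdiff ffunE.
have d0 : kdiff (kval xi) = 0 by apply/ffunP => b; rewrite [RHS]ffunE kdiffE -kdE x0 kval0.
have [||eta keta xiE] := kdiff_exact _ d0.
- by case: (kvalP xi).
- move=> x; have [_ h] := kvalP xi; rewrite (h (x, x, x)) ?co0 //.
  by rewrite (tdeg_diag x).
exact: kexact_trunc keta xiE.
Qed.

Definition koszul_resolution : proj_resolution (gr0_module A) :=
  @ProjResolution A (gr0_module A) (fun n => kmod n) (fun n => @kd n) kaug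
    kmod_projective kaug_surj kexact0 kexactS.

End KoszulModules.

(** * The Ext algebra *)

Section KoszulExt.
Variables (K : fieldType) (L : ladder) (A : ladder_algebra K L).
Local Notation "c %:S" := (gr_scal A c) (at level 2, format "c %:S").
Local Notation A0 := (gr0_module A).
Local Notation km n := (kmod A n).
Local Notation delta n b := (kdelta A n b).

(** The component of degree 0 at a generator. Forms with values in A_0 only see
   this part of a chain. *)
Definition khead n (xi : km n) (b : tri L) : K :=
  cot (kval xi b) (tri_diag (dual b.2)).

Lemma gr_proj0_kval n (xi : km n) b :
  gr_proj A 0 (kval xi b) = (khead xi b)%:S * ev (dual b.2).
Proof.
rewrite gr_proj0E (big_only (i := dual b.2)) // => x ne.
by rewrite cot_kval_diag (negbTE ne) rmorph0 mul0r.
Qed.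

Lemma kdelta0 n b : ~~ (tok b && (tdeg b == n)) -> delta n b = 0.
Proof.
move=> h; apply: kmod_eq => c; rewrite kdeltaE kval0; case: eqP => //= ->.
by rewrite (negbTE h).
Qed.

Lemma kdelta_ev n b : ev (dual b.2) *: delta n b = delta n b.
Proof.
apply: kmod_eq => c; rewrite kvalZ kdeltaE; case: (eqVneq c b) => [->|_] /=; last by rewrite mulr0.
by case: ifP => _; rewrite ?mulr0 // evM eqxx.
Qed.

Lemma gr0_valZ a (y : A0) : gr_val (a *: y) = gr_proj A 0 a * gr_val y.
Proof. by []. Qed.
Lemma gr0_val_sum (I : Type) (r : seq I) (F : I -> A0) :
  gr_val (\sum_(i <- r) F i) = \sum_(i <- r) gr_val (F i).
Proof. by elim: r => [|i r IH]; rewrite ?big_nil // !big_cons -IH. Qed.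

(** A linear form with values in A_0 is determined by one scalar for each
   generator, because the generator b lies in the component of the idempotent
   of its dual vertex. *)
Definition kform n (f : {linear km n -> A0}) (b : tri L) : K :=
  cot (gr_val (f (delta n b))) (tri_diag (dual b.2)).

Lemma kform0 n (f : {linear km n -> A0}) b : ~~ (tok b && (tdeg b == n)) -> kform f b = 0.
Proof. by move=> h; rewrite /kform kdelta0 // linear0 -[RHS](cot0 A (tri_diag (dual b.2))). Qed.

Lemma kformE n (f : {linear km n -> A0}) b :
  gr_val (f (delta n b)) = (kform f b)%:S * ev (dual b.2).
Proof.
apply: deg0_ev; first exact: gr_valP.
by rewrite -{2}kdelta_ev linearZ gr0_valZ ev_hom.
Qed.

Lemma kform_apply n (f : {linear km n -> A0}) xi :
  gr_val (f xi) = \sum_b (khead xi b * kform f b)%:S * ev (dual b.2).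
Proof.
rewrite linear_span gr0_val_sum; apply: eq_bigr => b _.
rewrite gr0_valZ kformE gr_proj0_kval -!mulrA scalCA evM eqxx.
by rewrite mulrA rmorphM.
Qed.

Lemma khead_kd n (xi : km n.+1) b : khead (kd xi) b = 0.
Proof. by rewrite /khead kdE cot_kmap_diag. Qed.

(** The resolution is minimal: the differential has no component of degree 0, so
   all forms are cocycles and none but 0 is a coboundary. *)
Lemma kform_kd n (f : {linear km n -> A0}) xi : f (kd xi) = 0.
Proof.
apply: val_inj; rewrite [LHS]kform_apply big1 // => b _.
by rewrite khead_kd mul0r rmorph0 mul0r.
Qed.

(** The forms on the n-th term are identified with the component of degree n of
   A, the values of a form being taken as coordinates. *)
Definition kcls n (f : {linear km n -> A0}) : A := \sum_b (kform f b)%:S * cbt A b.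

Lemma cot_kcls n (f : {linear km n -> A0}) b : cot (kcls f) b = kform f b.
Proof.
rewrite /kcls cot_sum (big_only (i := b)) => [|c ne].
  rewrite cotZ cot_cbt eqxx andbT; case: (boolP (tok b)) => t; first by rewrite mulr1.
  by rewrite mulr0 kform0 // (negbTE t).
by rewrite cotZ cot_cbt eq_sym (negbTE ne) andbF mulr0.
Qed.

Lemma kcls_hom n (f : {linear km n -> A0}) : gr_proj A n (kcls f) = kcls f.
Proof.
apply: cot_inj => b; rewrite cot_proj cot_kcls; case: eqVneq => // ne.
by rewrite kform0 // eq_sym (negbTE ne) andbF.
Qed.

Lemma kform_eq n (f g : {linear km n -> A0}) : kcls f = kcls g -> f =1 g.
Proof.
move=> e xi; apply: val_inj; rewrite /= !kform_apply; apply: eq_bigr => b _.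
by rewrite -!cot_kcls e.
Qed.

Lemma kcls_surj n (e : A) : gr_proj A n e = e ->
  exists f : {linear km n -> A0}, kcls f = e.
Proof.
move=> he.
pose F (xi : km n) : A := \sum_b (cot e b)%:S * kval xi b.
have [|f fE] := @linear_of A (km n) A0
    (fun xi => GrComp (gr0_scale_subproof (F xi))).
  move=> a xi eta; apply: val_inj => /=.
  have -> : F (a *: xi + eta) = a * F xi + F eta.
    rewrite /F; under eq_bigr do rewrite kvalD kvalZ mulrDr -scalCA.
    by rewrite big_split big_distrr.
  by rewrite gr_projD gr_projM big_ord1 subn0.
exists f; apply: cot_inj => b; rewrite cot_kcls.
case: (boolP (tok b && (tdeg b == n))) => [|h]; last first.
  rewrite kform0 //; move: h; rewrite negb_and => /orP[h|h].
    by rewrite cot_ntri.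
  by rewrite (cot_hom he) // eq_sym.
move=> /andP[t d]; rewrite /kform fE /= cot_proj tdeg_diag eqxx /F cot_sum (big_only (i := b)).
  rewrite cotZ kdeltaE eqxx t d -cbt_diag cot_cbt eqxx tok_diag /=.
  by rewrite mulr1.
by move=> c ne; rewrite cotZ kdeltaE (negbTE ne) cot0 mulr0.
Qed.

Lemma kcls_aug : kcls (@kaug _ _ A) = 1.
Proof.
apply: cot_inj => b; rewrite cot_kcls -(ev_sum A) cot_sum.
case: (boolP (tok b && (tdeg b == 0)%N)) => [/andP[t /eqP d]|h]; last first.
  rewrite kform0 // big1 // => x _; move: h; rewrite -cbt_diag cot_cbt.
  by case: (eqVneq b (tri_diag x)) => [->|_]; rewrite ?andbF // tok_diag tdeg_diag.
have -> : b = tri_diag b.2 by exact: tdeg0.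
rewrite (big_only (i := b.2)) => [|x ne]; last first.
  rewrite -cbt_diag cot_cbt /=; case: (eqVneq (tri_diag b.2) (tri_diag x)) => [[e]|]; last by rewrite andbF.
  by rewrite e eqxx in ne.
rewrite /kform /= cot_kaug kdeltaE eqxx tok_diag tdeg_diag /= -!cbt_diag !cot_cbt !eqxx.
by rewrite !tok_diag.
Qed.

Lemma kval_kd_delta n b c : kval (kd (delta n.+1 b)) c =
  if tok b && (tdeg b == n.+1) then
    (edge_sign K c.2 b.2 * cot (ar c.2 b.2 * cbt A c) b)%:S * ar (dual c.2) (dual b.2)
  else 0.
Proof.
rewrite kdE kmap_cbt; case: ifP => h; last first.
  rewrite big1 // => z' _; rewrite kdelta0 ?h //.
  rewrite /ext big1 ?mul0r ?mulr0 // => b' _; by rewrite kval0 mulr0.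
have E a : ext (kval (delta n.+1 b)) a = (cot a b)%:S * ev (dual b.2).
  rewrite /ext (big_only (i := b)) => [|b' ne]; first by rewrite kdeltaE eqxx h.
  by rewrite kdeltaE (negbTE ne) mulr0.
rewrite (big_only (i := b.2)) => [|z' ne]; rewrite E.
  by rewrite -mulrA ar_evl mulrA rmorphM.
rewrite -(ar_evl A c.2) -[ev z' * _ * _]mulrA cot_evl (negbTE ne).
by rewrite rmorph0 !mul0r mulr0.
Qed.

(** Determines a lift of f as far as A_0 sees it: the head of the lift of the
   generator b at c is the coefficient of b in the product of c with the class
   of f. Nothing has to be constructed, since any lift has this property, by
   induction on the degree of c. *)
Lemma khead_lift p (f : {linear km p -> A0}) (F : forall k, {linear km (k + p) -> km k}) :
  (forall x, kaug (F 0%N x) = f x) ->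
  (forall k x, kd (F k.+1 x) = F k (kd x)) ->
  forall k b c, tok b -> tdeg b = (k + p)%N -> tok c -> tdeg c = k ->
    khead (F k (delta (k + p) b)) c = cot (cbt A c * kcls f) b.
Proof.
move=> h0 hS; elim=> [|k IH] b c tb db tc dc.
  rewrite (tdeg0 tc dc); set z := c.2.
  rewrite /khead -cot_kaug h0 cbt_diag cot_evl cot_kcls kformE.
  rewrite cotZ -cbt_diag cot_cbt tok_diag /=.
  case: (eqVneq z b.2) => [->|ne]; first by rewrite eqxx mulr1.
  case: (eqVneq (tri_diag (dual z)) (tri_diag (dual b.2))) => [[/dual_inj e]|_]; last by rewrite mulr0.
  by rewrite e eqxx in ne.
(* Comparing the coefficients of one arrow on both sides of the lifting
   equation gives the claim for all products with that arrow on the left. *)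
have key c1 z' : tok c1 -> tdeg c1 = k -> lad_adj c1.2 z' ->
    \sum_c' cot (ar c1.2 z' * cbt A c1) c' * khead (F k.+1 (delta (k.+1 + p) b)) c' =
    cot (ar c1.2 z' * (cbt A c1 * kcls f)) b.
  move=> tc1 dc1 az; set z := c1.2.
  have adz : lad_adj (dual z) (dual z').
    have := lvl_dualE z; have := lvl_dualE z'; have := lvl_le z; have := lvl_le z'.
    by move: az; rewrite /lad_adj -/z; lia.
  have [tt dt arE] := tri_arP A adz; set t := tri_ar _ _ in tt dt arE.
  have at1 : cot (ar (dual z) (dual z') : A) t = 1 by rewrite arE cot_cbt tt eqxx.
  have := congr1 (fun u => cot (kval u c1) t) (hS k (delta (k.+1 + p) b)).
  rewrite kdE kmap_cbt -/z cot_sum (big_only (i := z')) => [|z1 ne]; last first.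
    rewrite cotZ cot_mul_ar // -(ar_evl A (dual z)) cot_evl /= (inj_eq (@dual_inj L)) (negbTE ne).
    by rewrite !mulr0.
  rewrite cotZ cot_mul_ar // at1 mulr1 => LHS.
  have LE : cot (ext (kval (F k.+1 (delta (k.+1 + p) b))) (ar z z' * cbt A c1)) (tri_diag (dual z')) =
      \sum_c' cot (ar z z' * cbt A c1) c' * khead (F k.+1 (delta (k.+1 + p) b)) c'.
    rewrite /ext cot_sum; apply: eq_bigr => c' _; rewrite cotZ /khead.
    case: (eqVneq c'.2 z') => [<-//|ne].
    by rewrite -(ar_evl A z z') -[ev z' * _ * _]mulrA cot_evl eq_sym (negbTE ne) !mul0r.
  rewrite {}LE in LHS.
  have es : edge_sign K z z' != 0 by rewrite signr_eq0.
  apply: (mulfI es); rewrite LHS linear_span kval_sum cot_sum.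
  transitivity (\sum_b' edge_sign K z z' *
      (cot (cbt A c1 * kcls f) b' * cot (ar z z' * cbt A b') b)); last first.
    rewrite -big_distrr /=; congr (_ * _).
    move: (cbt A c1 * kcls f) => v.
    rewrite {2}(cot_span v) big_distrr cot_sum; apply: eq_bigr => b' _.
    by rewrite /= scalCA cotZ.
  apply: eq_bigr => b' _; rewrite kvalZ kval_kd_delta db tb eqxx /=.
  rewrite -mulrA cotZ [cot (_ * kval _ c1) t]cot_ar_mul //.
  case: (eqVneq b'.2 z) => [e|ne]; last first.
    rewrite -(ar_evr A z z') -[ar z z' * _ * _]mulrA ev_cb eq_sym (negbTE ne) mulr0 cot0.
    rewrite -(ar_evr A (dual b'.2)) cot_evr /= (inj_eq (@dual_inj L)) (negbTE ne).
    by rewrite !mulr0.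
  rewrite e; case: (eqVneq b.2 z') => [e'|ne]; last first.
    rewrite -(ar_evl A z z') -[ev z' * _ * _]mulrA cot_evl eq_sym (negbTE ne).
    rewrite -(ar_evl A (dual z)) cot_evl /= (inj_eq (@dual_inj L)) (negbTE ne).
    by rewrite !mulr0.
  rewrite e' at1 mulr1.
  case: (eqVneq (cot (ar z z' * cbt A b') b) 0) => [->|/cot_ar_deg db']; first by rewrite !mulr0 mul0r.
  have [tb'|ntb'] := boolP (tok b'); last first.
    by rewrite (cbt_ntri A ntb') mulr0 cot0 !mulr0 mul0r.
  have dbk : tdeg b' = (k + p)%N by apply: succn_inj; rewrite -db' db.
  rewrite -(IH b' c1) // /khead -/z; ring.
have nd : tri_deg c.1.1 c.1.2 c.2 != 0%N by rewrite [tri_deg _ _ _]dc.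
have [y [t' d' E]] := cb_factor A tc nd; pose c1 : tri L := (c.1.1, if c.1.2 == c.2 then y else c.1.2, y).
have -> : khead (F k.+1 (delta (k.+1 + p) b)) c =
    \sum_c' cot (cbt A c) c' * khead (F k.+1 (delta (k.+1 + p) b)) c'.
  rewrite (big_only (i := c)) => [|c' ne]; first by rewrite cot_cbt tc eqxx mul1r.
  by rewrite cot_cbt (negbTE ne) andbF mul0r.
have cE : cbt A c = ar c1.2 c.2 * cbt A c1 by exact: E.
have dc1 : tdeg c1 = k by apply: succn_inj; rewrite -dc -[RHS]d'.
have tc1 : tok c1 by exact: t'.
case: (boolP (lad_adj c1.2 c.2)) => [adj|nadj].
  by rewrite cE key // mulrA.
have := cot_cbt A c c; rewrite tc eqxx cE (ar_nadj A nadj) mul0r cot0.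
by move/eqP; rewrite eq_sym oner_eq0.
Qed.

(** The forms on the minimal resolution are A itself, and the product of Ext is
   that of A by khead_lift. *)
Theorem koszul_dual_self : koszul_dual A A.
Proof.
exists (koszul_resolution A), (fun n f => kcls f); split; [|split; [|split; [|split; [|split]]]].
- by move=> n f _; exact: kcls_hom.
- move=> n c f g h _ _ hE; apply: cot_inj => b.
  rewrite cotD cotZ !cot_kcls /kform hE -cotZ -cotD; congr cot.
  by rewrite /= gr_proj_scal.
- move=> n e he; have [f fE] := kcls_surj he; exists f => // x.
  exact: kform_kd.
- move=> n f _; split=> [f0|cb].
    have fE xi : f xi = 0.
      have [|z zE] := @linear_of A (km n) A0 (fun _ => 0).
        by move=> a x y; rewrite scaler0 addr0.
      rewrite (@kform_eq _ f z) ?zE // f0; apply: cot_inj => b.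
      by rewrite cot0 cot_kcls /kform zE -[LHS](cot0 A (tri_diag (dual b.2))).
    case: n f f0 fE => [|n] f _ fE; first exact: fE.
    have [|z zE] := @linear_of A (km n) A0 (fun _ => 0).
      by move=> a x y; rewrite scaler0 addr0.
    by exists z => x; rewrite fE zE.
  apply: cot_inj => b; rewrite cot0 cot_kcls /kform.
  rewrite -[RHS](cot0 A (tri_diag (dual b.2))); congr cot.
  case: n f cb => [|n] f cb; first by rewrite cb.
  by case: cb => h ->; rewrite kform_kd.
- exact: kcls_aug.
move=> p q f g h F _ _ [F0 FS] hE; apply: cot_inj => b.
rewrite cot_kcls.
case: (boolP (tok b && (tdeg b == q + p)%N)) => [/andP[tb /eqP db]|nb]; last first.
  rewrite kform0 //; move: nb; rewrite negb_and => /orP[nt|nd].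
    by rewrite cot_ntri.
  rewrite (@cot_hom _ _ _ (q + p)) // ?[_ == tdeg b]eq_sym //.
  by apply: gr_projM_hom; exact: kcls_hom.
rewrite /kform hE kform_apply cot_sum {2}/kcls big_distrl cot_sum.
apply: eq_bigr => c _ /=; rewrite cotZ -[_%:S * _ * _]mulrA cotZ.
case: (boolP (tok c && (tdeg c == q))) => [/andP[tc /eqP dc]|nc]; last first.
  by rewrite kform0 // mulr0 !mul0r.
rewrite (khead_lift F0 FS tb db tc dc) -cbt_diag cot_cbt tok_diag /=.
case: (eqVneq (tri_diag (dual b.2)) (tri_diag (dual c.2))) => [|ne].
  by rewrite mulr1 mulrC.
case: (eqVneq c.2 b.2) => [e|ne']; first by rewrite e eqxx in ne.
have cE : cbt A c = ev c.2 * cbt A c by rewrite ev_cb eqxx.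
by rewrite cE -[ev c.2 * _ * _]mulrA cot_evl (negbTE ne') !mulr0 ?mul0r.
Qed.

End KoszulExt.

(** * The quadratic dual *)

Section QuadraticDualGenerators.
Variables (K : fieldType) (A : gralg K).
Local Notation D := (quadratic_dual A).
Local Notation pi := (@quot_pi (dual_free A) (@quad_dual_relations K A)).

Definition qgen0 (a : gr_comp A 0) : D := pi (dual_gen0 a).
Definition qgen1 (f : gr1_dual A) : D := pi (dual_gen1 f).

Lemma tensor_rel_eq (l r : dual_free A) : tensor_rel l r -> pi l = pi r.
Proof.
by move=> h; apply/quot_pi_eq; apply: ideal_gen_in; left; exists l, r.
Qed.

Lemma qgen0_scal c a : gr_val a = gr_scal A c -> qgen0 a = gr_scal D c.
Proof. by move=> h; exact: (tensor_rel_eq (tensor_scal h)). Qed.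
Lemma qgen0D a b : qgen0 (a + b) = qgen0 a + qgen0 b.
Proof.
rewrite /qgen0 (tensor_rel_eq (tensor_add0 a b)).
exact: quot_piD.
Qed.
Lemma qgen0M (a b : gr_comp A 0) : qgen0 (gr_mul a b) = qgen0 a * qgen0 b.
Proof.
rewrite /qgen0 (tensor_rel_eq (tensor_mul0 a b)).
exact: quot_piM.
Qed.
Lemma qgen0_0 : qgen0 0 = 0.
Proof. by apply: (addrI (qgen0 0)); rewrite -qgen0D !addr0. Qed.
Lemma qgen0_sum (I : Type) (r : seq I) (F : I -> gr_comp A 0) :
  qgen0 (\sum_(i <- r) F i) = \sum_(i <- r) qgen0 (F i).
Proof. by elim: r => [|i r IH]; rewrite ?big_nil ?qgen0_0 // !big_cons qgen0D IH. Qed.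

Lemma qgen1D (f g h : gr1_dual A) : (forall v, h v = f v + g v) ->
  qgen1 h = qgen1 f + qgen1 g.
Proof.
by move=> e; rewrite /qgen1 (tensor_rel_eq (tensor_add1 e)); exact: quot_piD.
Qed.
Lemma qgen1_mull a (f h : gr1_dual A) : (forall v, h v = f (gr_mul v a)) ->
  qgen1 h = qgen0 a * qgen1 f.
Proof.
by move=> e; rewrite /qgen1 (tensor_rel_eq (tensor_mull e)); exact: quot_piM.
Qed.
Lemma qgen1_mulr a (f h : gr1_dual A) : (forall v, h v = gr_mul (f v) a) ->
  qgen1 h = qgen1 f * qgen0 a.
Proof.
by move=> e; rewrite /qgen1 (tensor_rel_eq (tensor_mulr e)); exact: quot_piM.
Qed.
Lemma qgen1_0 (f : gr1_dual A) : (forall v, f v = 0) -> qgen1 f = 0.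
Proof.
move=> h; apply: (addrI (qgen1 f)); rewrite addr0 -(@qgen1D f f f) // => v.
by rewrite h addr0.
Qed.
Lemma qgen1_eq (f g : gr1_dual A) : (forall v, f v = g v) -> qgen1 f = qgen1 g.
Proof.
move=> h; have := @qgen1_mulr (GrComp (gr0_scale_subproof 1)) g f.
have e1 : gr_proj A 0 1 = 1 by rewrite -(rmorph1 (gr_scal A)) gr_proj_scal.
rewrite (@qgen0_scal 1) ?rmorph1 ?mulr1 /=; first by apply=> v; apply: val_inj; rewrite /= h e1 mulr1.
by rewrite e1.
Qed.

Lemma qgen1_rel u : annihilates u -> \sum_(fg <- u) qgen1 fg.1 * qgen1 fg.2 = 0.
Proof.
move=> h; transitivity (pi (\sum_(fg <- u) dual_gen1 fg.1 * dual_gen1 fg.2)).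
  rewrite quot_pi_sum; apply: eq_bigr => fg _; by rewrite quot_piM.
rewrite -(quot_pi0 (@quad_dual_relations K A)); apply/quot_pi_eq; rewrite subr0.
by apply: ideal_gen_in; right; exists u.
Qed.

Lemma qgen0_hom a : gr_proj D 0 (qgen0 a) = qgen0 a.
Proof.
apply: etrans (quot_proj_pi (@quad_dual_relations_homog K A) 0 (dual_gen0 a)) _.
by rewrite dual_gen0_hom.
Qed.
Lemma qgen1_hom f : gr_proj D 1 (qgen1 f) = qgen1 f.
Proof.
apply: etrans (quot_proj_pi (@quad_dual_relations_homog K A) 1 (dual_gen1 f)) _.
by rewrite dual_gen1_hom.
Qed.

(** The universal property of the presentation of the quadratic dual by degree 0
   and degree 1 generators. *)
Lemma quadratic_dual_lift (B : gralg K) (e : gr_comp A 0 -> B) (a : gr1_dual A -> B) :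
  (forall c x, gr_val x = gr_scal A c -> e x = gr_scal B c) ->
  (forall x y, e (x + y) = e x + e y) ->
  (forall x y : gr_comp A 0, e (gr_mul x y) = e x * e y) ->
  (forall f g h : gr1_dual A, (forall v, h v = f v + g v) -> a h = a f + a g) ->
  (forall x (f h : gr1_dual A), (forall v, h v = f (gr_mul v x)) -> a h = e x * a f) ->
  (forall x (f h : gr1_dual A), (forall v, h v = gr_mul (f v) x) -> a h = a f * e x) ->
  (forall u, annihilates u -> \sum_(fg <- u) a fg.1 * a fg.2 = 0) ->
  exists F : {rmorphism D -> B},
    [/\ forall c, F (gr_scal D c) = gr_scal B c, forall x, F (qgen0 x) = e x
      & forall f, F (qgen1 f) = a f].
Proof.
move=> h1 h2 h3 h4 h5 h6 h7.
have [||||f [fs fe fa]] := @path_alg_lift K (dual_quiver A) B (gr_scal B) (@gr_scalC _ B)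
    (fun _ => 1) (fun i => match i with inl x => e x | inr g => a g end).
- by move=> x y; rewrite mulr1; case: x y => [] [].
- by rewrite (big_pred1 tt) // => -[].
- by move=> i; rewrite mul1r.
- by move=> i; rewrite mulr1.
have f0 x : f (dual_gen0 x) = e x by exact: (fa (inl x)).
have f1 g : f (dual_gen1 g) = a g by exact: (fa (inr g)).
have [|F FE] := @quot_lift (dual_free A) B (@quad_dual_relations K A) f.
  move=> _ [[l [r [lr ->]]]|[u hu ->]]; last first.
    rewrite rmorph_sum -[RHS](h7 u hu); apply: eq_bigr => fg _.
    by rewrite rmorphM; congr (_ * _); exact: f1.
  rewrite rmorphB; apply/eqP; rewrite subr_eq0; apply/eqP.
  case: lr => [c x hx|x y|x y|g g' h hh|x g h hh|x g h hh].
  - by rewrite f0 (h1 c) //; symmetry; exact: fs.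
  - by rewrite f0 h2 rmorphD; congr (_ + _); rewrite f0.
  - by rewrite f0 h3 rmorphM; congr (_ * _); rewrite f0.
  - by rewrite f1 (h4 _ _ _ hh) rmorphD; congr (_ + _); rewrite f1.
  - by rewrite f1 (h5 _ _ _ hh) rmorphM; congr (_ * _); rewrite ?f0 ?f1.
  - by rewrite f1 (h6 _ _ _ hh) rmorphM; congr (_ * _); rewrite ?f0 ?f1.
exists F; split=> [c|x|g]; rewrite -?f0 -?f1; exact: FE || (rewrite -[RHS]fs; exact: FE).
Qed.

(** The generators of degree 0 and 1 generate the quadratic dual. *)
Lemma quadratic_dual_ext (B : pzRingType) (F G : {rmorphism D -> B}) :
  (forall c, F (gr_scal D c) = G (gr_scal D c)) ->
  (forall x, F (qgen0 x) = G (qgen0 x)) -> (forall f, F (qgen1 f) = G (qgen1 f)) ->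
  F =1 G.
Proof.
move=> hs h0 h1 x; rewrite -[x]quot_reprK; move: (quot_repr x) => {}x.
elim/path_alg_ind: x => [|f g hf hg|c f hf|x|i f hf].
- by rewrite quot_pi0 !rmorph0.
- by rewrite quot_piD !rmorphD hf hg.
- by rewrite quot_piM !rmorphM hf; congr (_ * _); exact: hs.
- have -> : path_elt K (Q := dual_quiver A) x [::] = 1.
    by case: x; rewrite (pa_one K (dual_quiver A)) (big_pred1 tt) // => -[].
  by rewrite -[quot_pi _ _]/(1 : D) !rmorph1.
rewrite quot_piM !rmorphM hf; congr (_ * _).
by case: i => [y|g]; [exact: h0|exact: h1].
Qed.

End QuadraticDualGenerators.

Section LadderQuadraticDual.
Variables (K : fieldType) (L : ladder) (A : ladder_algebra K L).
Local Notation "c %:S" := (gr_scal A c) (at level 2, format "c %:S").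
Local Notation D := (quadratic_dual A).
Local Notation "c %:D" := (gr_scal D c) (at level 2, format "c %:D").

Definition coef0 (a : A) (x : L) : K := cot a (tri_diag x).
Definition coef1 (v : A) (x y : L) : K := cot v (tri_ar x y).

Lemma coef0M (a b : A) x : gr_proj A 0 a = a -> coef0 (a * b) x = coef0 a x * coef0 b x.
Proof.
move=> <-; rewrite gr_proj0E /coef0 big_distrl cot_sum /= (big_only (i := x)) => [|y ne].
  rewrite -mulrA cotZ cot_evl eqxx; congr (_ * _).
  rewrite cot_sum (big_only (i := x)) => [|y ne].
    by rewrite cotZ -cbt_diag cot_cbt eqxx tok_diag mulr1.
  rewrite cotZ -cbt_diag cot_cbt; case: eqVneq => [[e]|]; last by rewrite andbF mulr0.
  by rewrite e eqxx in ne.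
by rewrite -mulrA cotZ cot_evl /= (negbTE ne) mulr0.
Qed.

Lemma coef0_ev x y : coef0 (ev x : A) y = (y == x)%:R.
Proof.
rewrite /coef0 -cbt_diag cot_cbt tok_diag /=; case: (eqVneq y x) => [->|ne]; first by rewrite eqxx.
by case: eqVneq => // -[e]; rewrite e eqxx in ne.
Qed.

Lemma coef0_scal c x : coef0 c%:S x = c.
Proof.
rewrite -[c%:S]mulr1 -(ev_sum A) /coef0 cotZ cot_sum (big_only (i := x)).
  by rewrite [cot _ _]coef0_ev eqxx mulr1.
by move=> y ne; rewrite [cot _ _]coef0_ev eq_sym (negbTE ne).
Qed.

Lemma deg0E (a : gr_comp A 0) : gr_val a = \sum_x (coef0 (gr_val a) x)%:S * ev x.
Proof. by rewrite -[LHS]gr_valP gr_proj0E. Qed.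

Lemma coef1_nadj (v : A) x y : gr_proj A 1 v = v -> ~~ lad_adj x y -> coef1 v x y = 0.
Proof.
move=> hv na; case: (boolP (tok (tri_ar x y))) => [t|nt]; last exact: cot_ntri.
apply: (cot_hom hv); move: na; rewrite /lad_adj /tri_ar /tdeg /tri_deg /=; case: ltnP; lia.
Qed.

Lemma coef1_ar x y p q : lad_adj x y -> coef1 (ar x y : A) p q = ((p == x) && (q == y))%:R.
Proof.
move=> a; have [t d e] := tri_arP A a; rewrite /coef1 e cot_cbt t /=; congr (_%:R).
rewrite /tri_ar; case: (eqVneq p x) => [->|ne] /=.
  case: (eqVneq q y) => [->|ne]; first by rewrite eqxx.
  by case: eqVneq => // /(congr1 snd) /= E; rewrite E eqxx in ne.
by case: eqVneq => // /(congr1 (fun b => b.1.1)) /= E; rewrite E eqxx in ne.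
Qed.

Lemma deg1E (v : A) : gr_proj A 1 v = v -> v = \sum_x \sum_y (coef1 v x y)%:S * ar x y.
Proof.
move=> hv; apply: cot_inj => b.
case: (boolP (tok b && (tdeg b == 1)%N)) => [/andP[t /eqP d]|nb]; last first.
  have E (w : A) : gr_proj A 1 w = w -> cot w b = 0.
    move=> hw; move: nb; rewrite negb_and => /orP[nt|nd]; first exact: cot_ntri.
    by apply: (cot_hom hw); rewrite eq_sym.
  rewrite (E _ hv) E // gr_proj_big; apply: eq_bigr => x _.
  by rewrite gr_proj_big; apply: eq_bigr => y _; rewrite gr_projZ ar_hom.
have bE : b = tri_ar b.1.1 b.2 /\ lad_adj b.1.1 b.2.
  case: b t d => [[x q] z] t; have [h1 h2 h3 h4] := is_triP t.
  rewrite /tdeg /tri_deg /tri_ar /lad_adj /= in h1 h2 h3 h4 * => d.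
  case: ltnP => lt; split.
  - by have -> : q = x by apply: lad_le_eq => //; lia.
  - by apply/orP; right; apply/eqP; lia.
  - by have -> : q = z by apply: lad_le_eq => //; lia.
  - by apply/orP; left; apply/eqP; lia.
have [{1}-> adj] := bE; set x := b.1.1 in adj *; set y := b.2 in adj *.
have -> : b = tri_ar x y by case: bE.
rewrite -[LHS]/(coef1 v x y) cot_sum (big_only (i := x)) => [|x' ne].
  rewrite cot_sum (big_only (i := y)) => [|y' ne].
    by rewrite cotZ [cot (ar _ _) _](coef1_ar _ _ adj) !eqxx mulr1.
  case: (boolP (lad_adj x y')) => [a|na].
    by rewrite cotZ [cot (ar _ _) _](coef1_ar _ _ a) [y == _]eq_sym (negbTE ne) andbF mulr0.
  by rewrite (ar_nadj A na) mulr0 cot0.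
rewrite cot_sum big1 // => y' _; case: (boolP (lad_adj x' y')) => [a|na].
  by rewrite cotZ [cot (ar _ _) _](coef1_ar _ _ a) [x == _]eq_sym (negbTE ne) mulr0.
by rewrite (ar_nadj A na) mulr0 cot0.
Qed.

Section ArrowForm.
Variable k : L -> L -> K.

(** A form of the dual bimodule is left linear over A_0, so its value at an
   arrow to y is a multiple of the idempotent of y. *)
Definition arform_val (v : A) : A := \sum_x \sum_y (k x y * coef1 v x y)%:S * ev y.

Lemma arform_subproof v : gr_homog 0 (arform_val v).
Proof.
apply/eqP; rewrite /arform_val gr_proj_big; apply: eq_bigr => x _.
by rewrite gr_proj_big; apply: eq_bigr => y _; rewrite gr_projZ ev_hom.
Qed.
Definition arform_fun (v : gr_comp A 1) : gr_comp A 0 := GrComp (arform_subproof (gr_val v)).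

Fact arform_zmod : zmod_morphism arform_fun.
Proof.
move=> v w; apply: val_inj; rewrite /= /arform_val -sumrB; apply: eq_bigr => x _.
rewrite -sumrB; apply: eq_bigr => y _.
have E : coef1 (gr_val v - gr_val w) x y = coef1 (gr_val v) x y - coef1 (gr_val w) x y.
  by rewrite /coef1 cotD; congr (_ + _); exact: coN.
by rewrite E mulrBr rmorphB mulrBl.
Qed.
HB.instance Definition _ := GRing.isZmodMorphism.Build _ _ arform_fun arform_zmod.

Lemma coef1_mull (a v : A) x y : gr_proj A 0 a = a -> coef1 (a * v) x y = coef0 a y * coef1 v x y.
Proof.
move=> ha; rewrite -{1}ha gr_proj0E big_distrl /coef1 cot_sum /= (big_only (i := y)) => [|z ne].
  by rewrite -mulrA cotZ cot_evl /= eqxx.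
by rewrite -mulrA cotZ cot_evl /= (negbTE ne) mulr0.
Qed.
Lemma coef1_mulr (a v : A) x y : gr_proj A 0 a = a -> coef1 (v * a) x y = coef1 v x y * coef0 a x.
Proof.
move=> ha; rewrite -{1}ha gr_proj0E big_distrr /coef1 cot_sum /= (big_only (i := x)) => [|z ne].
  by rewrite scalCA cotZ cot_evr /= eqxx mulrC.
by rewrite scalCA cotZ cot_evr /= (negbTE ne) mulr0.
Qed.

Lemma arform_linear (a : gr_comp A 0) (v : gr_comp A 1) :
  arform_fun (gr_mul a v) = gr_mul a (arform_fun v).
Proof.
apply: val_inj; rewrite /= /arform_val big_distrr; apply: eq_bigr => x _ /=.
rewrite big_distrr; apply: eq_bigr => y _ /=; rewrite coef1_mull ?gr_valP //.
have E : gr_val a * ev y = (coef0 (gr_val a) y)%:S * ev y.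
  rewrite {1}deg0E big_distrl /= (big_only (i := y)) => [|z ne]; first by rewrite -mulrA evM eqxx.
  by rewrite -mulrA evM (negbTE ne) mulr0.
by rewrite scalCA E [RHS]mulrA -rmorphM; congr (_%:S * _); ring.
Qed.
Definition arform : gr1_dual A := Gr1Dual arform_linear.

Lemma arformE v : gr_val (arform v) = arform_val (gr_val v). Proof. by []. Qed.
End ArrowForm.

Local Notation g0 := (@qgen0 K A).
Local Notation g1 := (@qgen1 K A).

Definition evc (x : L) : gr_comp A 0 := GrComp (introT eqP (ev_hom A x)).
Definition arc (x y : L) : gr_comp A 1 := GrComp (introT eqP (ar_hom A x y)).

Lemma scalc_subproof c : gr_homog 0 (gr_scal A c).
Proof. by apply/eqP; rewrite gr_proj_scal. Qed.
Definition scalc c : gr_comp A 0 := GrComp (scalc_subproof c).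

Lemma gr_comp_sum n (I : Type) (r : seq I) (F : I -> gr_comp A n) :
  gr_val (\sum_(i <- r) F i) = \sum_(i <- r) gr_val (F i).
Proof. by elim: r => [|i r IH]; rewrite ?big_nil // !big_cons -IH. Qed.

Definition arrow_form (x y : L) : gr1_dual A :=
  arform (fun p q => ((p == x) && (q == y))%:R).

Lemma arrow_formE x y v : gr_val (arrow_form x y v) = (coef1 (gr_val v) x y)%:S * ev y.
Proof.
rewrite arformE /arform_val (big_only (i := x)) => [|p ne].
  rewrite (big_only (i := y)) => [|q ne]; first by rewrite !eqxx mul1r.
  by rewrite (negbTE ne) andbF mul0r rmorph0 mul0r.
by rewrite big1 // => q _; rewrite (negbTE ne) mul0r rmorph0 mul0r.
Qed.

Definition form_coef (f : gr1_dual A) (x y : L) : K := coef0 (gr_val (f (arc x y))) y.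

Lemma gr1_dualZ (f : gr1_dual A) c v : gr_val (f (gr_mul (scalc c) v)) = c%:S * gr_val (f v).
Proof. by rewrite dual_linear. Qed.

Lemma form_coef_val (f : gr1_dual A) x y : gr_val (f (arc x y)) = (form_coef f x y)%:S * ev y.
Proof.
apply: deg0_ev; first exact: gr_valP.
have -> : arc x y = gr_mul (evc y) (arc x y) by apply: val_inj; rewrite /= ar_evl.
by rewrite dual_linear /= mulrA evM eqxx.
Qed.

(** The forms on the arrows have the matrix entries form_coef as coordinates, so
   that the functionals arrow_form are a basis of the dual bimodule. *)
Lemma form_coefE (f : gr1_dual A) v : f v = arform (form_coef f) v.
Proof.
have -> : v = \sum_x \sum_y gr_mul (scalc (coef1 (gr_val v) x y)) (arc x y).
  apply: val_inj; rewrite [LHS](deg1E (gr_valP v)) -[RHS]/(gr_val _) gr_comp_sum.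
  by apply: eq_bigr => x _; rewrite gr_comp_sum.
rewrite !raddf_sum; apply: eq_bigr => x _.
rewrite !raddf_sum; apply: eq_bigr => y _.
rewrite !dual_linear.
suff -> : f (arc x y) = arform (form_coef f) (arc x y) by [].
apply: val_inj; rewrite [RHS]arformE /arform_val.
apply: etrans (form_coef_val f x y) _; case: (boolP (lad_adj x y)) => [a|na].
  rewrite (big_only (i := x)) => [|p ne].
    rewrite (big_only (i := y)) => [|q ne]; first by rewrite coef1_ar // !eqxx mulr1.
    by rewrite coef1_ar // (negbTE ne) andbF mulr0 rmorph0 mul0r.
  by rewrite big1 // => q _; rewrite coef1_ar // (negbTE ne) mulr0 rmorph0 mul0r.
have z : arc x y = 0 by apply: val_inj; rewrite /= ar_nadj.
rewrite /form_coef z raddf0 [coef0 _ _]co0 rmorph0 mul0r big1 // => p _.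
by rewrite big1 // => q _; rewrite [coef1 _ _ _]co0 mulr0 rmorph0 mul0r.
Qed.

Lemma qgen1_arform_sum (I : Type) (r : seq I) (F : I -> L -> L -> K) :
  g1 (arform (fun x y => \sum_(i <- r) F i x y)) = \sum_(i <- r) g1 (arform (F i)).
Proof.
elim: r => [|i r IH].
  rewrite big_nil; apply: qgen1_0 => v; apply: val_inj; rewrite /= /arform_val.
  by rewrite big1 // => x _; rewrite big1 // => y _; rewrite big_nil mul0r rmorph0 mul0r.
rewrite big_cons -IH; apply: qgen1D => v; apply: val_inj.
rewrite /= /arform_val -big_split; apply: eq_bigr => x _; rewrite -big_split.
by apply: eq_bigr => y _; rewrite big_cons mulrDl rmorphD mulrDl.
Qed.

Lemma qgen1_arformZ c k : g1 (arform (fun x y => c * k x y)) = c%:D * g1 (arform k).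
Proof.
rewrite -(qgen0_scal (a := scalc c)) //; apply: qgen1_mull => v; apply: val_inj.
rewrite /= /arform_val; apply: eq_bigr => x _; apply: eq_bigr => y _.
by rewrite -gr_scalC /coef1 cotZ; congr (_%:S * _); ring.
Qed.

Lemma qgen1_span f : g1 f = \sum_x \sum_y (form_coef f x y)%:D * g1 (arrow_form x y).
Proof.
rewrite (qgen1_eq (form_coefE f)).
under [RHS]eq_bigr do under eq_bigr do rewrite -qgen1_arformZ.
under [RHS]eq_bigr do rewrite -qgen1_arform_sum.
rewrite -qgen1_arform_sum; apply: qgen1_eq => v; apply: val_inj.
rewrite /= /arform_val; apply: eq_bigr => x _; apply: eq_bigr => y _; congr ((_ * _)%:S * _).
rewrite (big_only (i := x)) => [|p ne].
  rewrite (big_only (i := y)) => [|q ne]; first by rewrite !eqxx mulr1.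
  by rewrite [y == _]eq_sym (negbTE ne) andbF mulr0.
by rewrite big1 // => q _; rewrite [x == _]eq_sym (negbTE ne) mulr0.
Qed.

Lemma qgen0_span a : g0 a = \sum_x (coef0 (gr_val a) x)%:D * g0 (evc x).
Proof.
have -> : a = \sum_x gr_mul (scalc (coef0 (gr_val a) x)) (evc x).
  by apply: val_inj; rewrite [LHS]deg0E -[RHS]/(gr_val _) gr_comp_sum.
rewrite qgen0_sum; apply: eq_bigr => x _; rewrite qgen0M (qgen0_scal (c := coef0 (gr_val a) x)) //.
congr ((_)%:D * _); rewrite gr_comp_sum /coef0 cot_sum (big_only (i := x)) => [|y ne].
  by rewrite cotZ [cot (ev x) _]coef0_ev eqxx mulr1.
by rewrite cotZ [cot (ev _) _]coef0_ev eq_sym (negbTE ne) mulr0.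
Qed.

Lemma ev_mul_deg1 (v : A) y : gr_proj A 1 v = v ->
  ev y * v = \sum_p (coef1 v p y)%:S * ar p y.
Proof.
move=> hv; rewrite {1}(deg1E hv) big_distrr; apply: eq_bigr => p _ /=.
rewrite big_distrr /= (big_only (i := y)) => [|q ne]; first by rewrite scalCA ar_evl.
by rewrite scalCA -(ar_evl A p q) [ev y * _]mulrA evM eq_sym (negbTE ne) mul0r mulr0.
Qed.

Lemma deg1_mul_ev (v : A) x : gr_proj A 1 v = v ->
  v * ev x = \sum_q (coef1 v x q)%:S * ar x q.
Proof.
move=> hv; rewrite {1}(deg1E hv) big_distrl /= (big_only (i := x)) => [|p ne].
  by rewrite big_distrl; apply: eq_bigr => q _; rewrite /= -mulrA ar_evr.
rewrite big_distrl big1 // => q _ /=.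
by rewrite -(ar_evr A p q) -!mulrA evM (negbTE ne) !mulr0.
Qed.

(** Relations can be reversed, by co_rev. *)
Lemma path2_sum_rev x z (k : L -> K) :
  \sum_w (k w)%:S * path2l A x w z = 0 -> \sum_w (k w)%:S * path2l A z w x = 0.
Proof.
move=> h; apply: cot_inj => b; rewrite cot0 cot_sum.
under eq_bigr do rewrite cotZ cot_path2 -co_rev.
case: (boolP ((z == b.1.1) && (x == b.2))) => _; last by rewrite big1 // => w _; rewrite mulr0.
exact: (co_path2_sum _ h).
Qed.

Lemma deg1_mul (v w : A) x z : gr_proj A 1 v = v -> gr_proj A 1 w = w ->
  ev z * (v * w) * ev x = \sum_y (coef1 v y z * coef1 w x y)%:S * path2l A x y z.
Proof.
move=> hv hw; rewrite mulrA -mulrA (ev_mul_deg1 _ hv) (deg1_mul_ev _ hw) big_distrl.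
apply: eq_bigr => p _ /=; rewrite big_distrr /= (big_only (i := p)) => [|q ne].
  by rewrite -mulrA scalCA mulrA -rmorphM.
by rewrite -mulrA scalCA ar_mul0 ?mulr0 // eq_sym.
Qed.

Lemma pairing_arrow_forms c x y z (v w : gr_comp A 1) :
  gr_val (dual_pairing (arform (fun p q => c * ((p == x) && (q == y))%:R))
    (arrow_form y z) v w) =
  (c * (coef1 (gr_val v) y z * coef1 (gr_val w) x y))%:S * ev z.
Proof.
rewrite [LHS]arrow_formE coef1_mulr ?gr_valP //; congr (_%:S * _).
rewrite arformE /arform_val (big_only (i := x)) => [|p ne].
  rewrite (big_only (i := y)) => [|q ne].
    by rewrite !eqxx mulr1 /coef0 cotZ [cot (ev _) _]coef0_ev eqxx mulr1; ring.
  by rewrite (negbTE ne) andbF mulr0 mul0r rmorph0 mul0r.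
by rewrite big1 // => q _; rewrite (negbTE ne) mulr0 mul0r rmorph0 mul0r.
Qed.

(** A relation of A, signed and moved to the dual vertices, annihilates the
   relations of A, by path2_relations_orth; so it holds in the quadratic dual. *)
Lemma edge_sign_dual_relation x z (r : L -> K) :
  \sum_w (r w)%:S * (ar w z * ar x w) = 0 ->
  \sum_w (r w)%:D * ((edge_sign K w z)%:D * g1 (arrow_form (dual z) (dual w)) *
    ((edge_sign K x w)%:D * g1 (arrow_form (dual w) (dual x)))) = 0.
Proof.
move=> hr; pose c w := r w * (edge_sign K w z * edge_sign K x w).
pose F w := (arform (fun p q => c w * ((p == dual z) && (q == dual w))%:R),
  arrow_form (dual w) (dual x)).
transitivity (\sum_(fg <- [seq F w | w : L]) g1 fg.1 * g1 fg.2).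
  rewrite big_image /=; apply: eq_bigr => w _.
  rewrite qgen1_arformZ /c !rmorphM -!mulrA; congr (_ * (_ * _)).
  exact: (@scalCA _ D (edge_sign K x w) (g1 (arrow_form _ _)) (g1 (arrow_form _ _))).
apply: qgen1_rel => u hu; rewrite big_image /=; apply: val_inj.
rewrite -[LHS]/(gr_val _) gr_comp_sum.
pose k w := \sum_(vw <- u) coef1 (gr_val vw.1) (dual w) (dual x) * coef1 (gr_val vw.2) (dual z) (dual w).
transitivity (\sum_w (c w * k w)%:S * ev (dual x)).
  apply: eq_bigr => w _; rewrite gr_comp_sum /k big_distrr rmorph_sum big_distrl.
  apply: eq_bigr => vw _; exact: pairing_arrow_forms.
have hk : \sum_w (k w)%:S * path2l A (dual x) (dual w) (dual z) = 0.
  pose k' y := \sum_(vw <- u) coef1 (gr_val vw.1) y (dual x) * coef1 (gr_val vw.2) (dual z) y.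
  rewrite (sum_dualE (fun y => (k' y)%:S * path2l A (dual x) y (dual z))).
  apply: path2_sum_rev.
  have := congr1 (fun v : gr_comp A 2 => ev (dual x) * gr_val v * ev (dual z)) hu.
  rewrite gr_comp_sum mulr0 mul0r => h; rewrite -[RHS]h big_distrr big_distrl /=.
  under [RHS]eq_bigr do rewrite deg1_mul ?gr_valP //.
  rewrite exchange_big; apply: eq_bigr => y _ /=.
  by rewrite /k' rmorph_sum big_distrl.
suff h : \sum_w c w * k w = 0 by rewrite -big_distrl -rmorph_sum /= h rmorph0 mul0r.
rewrite -[RHS](path2_relations_orth hr hk) [RHS]big_mkcond; apply: eq_bigr => w _.
case: ifP => [_|/negbT na]; first by rewrite /c; ring.
rewrite /k big1 ?mulr0 // => vw _; move: na; rewrite negb_and => /orP[na|na].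
  rewrite coef1_nadj ?mul0r ?gr_valP //; move: na; apply: contraNN.
  by have := lvl_dualE x; have := lvl_dualE w; rewrite /lad_adj; lia.
rewrite mulrC coef1_nadj ?mul0r ?gr_valP //; move: na; apply: contraNN.
by have := lvl_dualE z; have := lvl_dualE w; rewrite /lad_adj; lia.
Qed.

(** Reversing the ladder turns the functional dual to an arrow into an arrow
   again: the arrow from x to y goes to the functional of the arrow from dual y
   to dual x, up to the edge sign. *)
Lemma to_quadratic_dual : exists F : {rmorphism A -> D},
  [/\ forall c, F (c%:S) = c%:D, forall x, F (ev x) = g0 (evc (dual x))
    & forall x y, F (ar x y) = (edge_sign K x y)%:D * g1 (arrow_form (dual y) (dual x))].
Proof.
apply: la_univ.
- exact: gr_scalC.
- move=> x y; rewrite -qgen0M; case: (eqVneq x y) => [->|ne].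
    by congr qgen0; apply: val_inj; rewrite /= evM eqxx.
  rewrite -[RHS](qgen0_0 A); congr qgen0; apply: val_inj.
  by rewrite /= evM (inj_eq (@dual_inj L)) (negbTE ne).
- rewrite (sum_dualE (fun x => g0 (evc x))) -qgen0_sum (qgen0_scal (c := 1)) ?rmorph1 //.
  by rewrite gr_comp_sum ev_sum.
- move=> x y; rewrite scalCA; congr (_ * _); symmetry; apply: qgen1_mull => v.
  apply: val_inj; rewrite -[LHS]/(gr_val _) -[RHS]/(gr_val _) !arrow_formE /=.
  by rewrite /coef1 cot_evr /= eqxx.
- move=> x y; rewrite -mulrA; congr (_ * _); symmetry; apply: qgen1_mulr => v.
  apply: val_inj; rewrite -[RHS]/(gr_val (arrow_form (dual y) (dual x) v) * ev (dual x)).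
  by rewrite -[LHS]/(gr_val _) arrow_formE -mulrA evM eqxx.
- move=> x y na; rewrite qgen1_0 ?mulr0 // => v; apply: val_inj.
  rewrite -[LHS]/(gr_val _) arrow_formE coef1_nadj ?gr_valP ?rmorph0 ?mul0r //.
  move: na; apply: contraNN.
  by have := lvl_dualE x; have := lvl_dualE y; rewrite /lad_adj; lia.
exact: edge_sign_dual_relation.
Qed.

Definition from0 (a : gr_comp A 0) : A := \sum_x (coef0 (gr_val a) (dual x))%:S * ev x.
Definition from1 (f : gr1_dual A) : A :=
  \sum_x \sum_y (edge_sign K x y * form_coef f (dual y) (dual x))%:S * ar x y.

Lemma sum_ev_mul (k k' : L -> K) :
  (\sum_x (k x)%:S * ev x) * (\sum_x (k' x)%:S * ev x) = \sum_x (k x * k' x)%:S * ev x :> A.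
Proof.
rewrite big_distrl; apply: eq_bigr => x _ /=; rewrite big_distrr /= (big_only (i := x)).
  by rewrite -mulrA scalCA evM eqxx mulrA rmorphM.
by move=> y ne; rewrite -mulrA scalCA evM eq_sym (negbTE ne) !mulr0.
Qed.

Lemma pairing_arcs (f g : gr1_dual A) c x y z :
  coef0 (gr_val (dual_pairing f g (gr_mul (scalc c) (arc y z)) (arc x y))) z =
  c * (form_coef f x y * form_coef g y z).
Proof.
have E : gr_mul (gr_mul (scalc c) (arc y z)) (f (arc x y)) =
    gr_mul (scalc (c * form_coef f x y)) (arc y z) :> gr_comp A 1.
  by apply: val_inj; rewrite /= form_coef_val -mulrA scalCA ar_evr mulrA -rmorphM.
by rewrite /dual_pairing [X in g X]E gr1_dualZ /coef0 cotZ mulrA.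
Qed.

(** An annihilator of the relations is, by functional_factor, a combination of
   the coordinate functions of the quadratic paths at the dual vertices; and
   such combinations are relations by path2_tensor. *)
Lemma from1_relation u : annihilates u -> \sum_(fg <- u) from1 fg.1 * from1 fg.2 = 0.
Proof.
move=> hu.
pose k x w z := \sum_(fg <- u) form_coef fg.1 (dual z) (dual w) * form_coef fg.2 (dual w) (dual x).
transitivity (\sum_x \sum_z \sum_w (edge_sign K x w * edge_sign K w z)%:S * ((k x w z)%:S * path2l A x w z)).
  transitivity (\sum_(fg <- u) \sum_x \sum_z \sum_w (edge_sign K x w * edge_sign K w z)%:S *
      ((form_coef fg.1 (dual z) (dual w) * form_coef fg.2 (dual w) (dual x))%:S * path2l A x w z)).
    apply: eq_bigr => fg _; rewrite {2}/from1 big_distrr; apply: eq_bigr => x _ /=.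
    rewrite exchange_big big_distrr; apply: eq_bigr => w _ /=.
    rewrite /from1 big_distrl (big_only (i := w)) /= => [|p ne]; last first.
      rewrite big_distrl big1 // => z _ /=; rewrite -mulrA scalCA ar_mul0 // !mulr0 //.
    rewrite big_distrl; apply: eq_bigr => z _ /=.
    by rewrite -mulrA scalCA !mulrA -!rmorphM /path2l !mulrA; congr (_%:S * _ * _); ring.
  rewrite exchange_big; apply: eq_bigr => x _; rewrite exchange_big; apply: eq_bigr => z _.
  rewrite exchange_big; apply: eq_bigr => w _ /=.
  by rewrite -!big_distrr /= -big_distrl /= -rmorph_sum.
rewrite big1 // => x _; rewrite big1 // => z _.
(* k x _ z vanishes on all relations between the paths at the dual vertices, so
   it is a combination of their coordinates. *)
have [w|c hc] := @functional_factor K L L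
    (fun w q => co (path2l A (dual x) (dual w) (dual z)) (dual x) q (dual z)) (fun w => k x w z).
  move=> hw.
  have hr : \sum_y (w y)%:S * path2l A (dual z) (dual y) (dual x) = 0.
    apply: cot_inj => b; rewrite cot0 cot_sum.
    under eq_bigr do rewrite cotZ cot_path2 -co_rev.
    case: (boolP ((dual z == b.1.1) && (dual x == b.2))) => _; last by rewrite big1 // => y _; rewrite mulr0.
    exact: hw.
  have := hu [seq (gr_mul (scalc (w y)) (arc (dual y) (dual x)), arc (dual z) (dual y)) | y : L].
  rewrite /quad_relation big_image /=.
  have -> : \sum_i gr_mul (gr_mul (scalc (w i)) (arc (dual i) (dual x))) (arc (dual z) (dual i)) = 0.
    apply: val_inj; rewrite -[LHS]/(gr_val _) gr_comp_sum -[RHS]hr.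
    by apply: eq_bigr => y _; rewrite /path2l mulrA.
  move=> /(_ erefl) /(congr1 (fun v : gr_comp A 0 => coef0 (gr_val v) (dual x))).
  rewrite gr_comp_sum /coef0 cot_sum -[cot (gr_val 0) _]/(cot 0 _) cot0 => h.
  rewrite -[RHS]h; under [LHS]eq_bigr do rewrite /k big_distrr /=.
  rewrite exchange_big; apply: eq_bigr => fg _ /=.
  rewrite big_image gr_comp_sum cot_sum; apply: eq_bigr => y _ /=.
  exact/esym/pairing_arcs.
pose kt (v : A) := \sum_q c q * co v (dual x) q (dual z).
have := @path2_tensor K L A (fun u v => (kt v)%:S * u) x z.
have ktD v v' : kt (v + v') = kt v + kt v'.
  by rewrite /kt -big_split; apply: eq_bigr => q _ /=; rewrite coD mulrDr.
have ktZ d v : kt (d%:S * v) = d * kt v.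
  by rewrite /kt big_distrr; apply: eq_bigr => q _ /=; rewrite coZ; ring.
move=> /(_ (fun u u' v => mulrDr _ _ _)) h.
rewrite -[RHS]h.
- by apply: eq_bigr => w _; rewrite hc.
- by move=> a v v'; rewrite ktD rmorphD mulrDl.
- by move=> d a v; rewrite scalCA.
- by move=> d a v; rewrite ktZ rmorphM mulrA.
Qed.

Lemma from_quadratic_dual : exists F : {rmorphism D -> A},
  [/\ forall c, F (c%:D) = c%:S, forall a, F (g0 a) = from0 a
    & forall f, F (g1 f) = from1 f].
Proof.
apply: (@quadratic_dual_lift K A A).
- move=> c a ac; rewrite /from0 ac; under eq_bigr do rewrite coef0_scal.
  by rewrite -big_distrr /= ev_sum mulr1.
- move=> a b; rewrite /from0 -big_split; apply: eq_bigr => x _ /=.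
  by rewrite /coef0 cotD rmorphD mulrDl.
- move=> a b; rewrite /from0 sum_ev_mul; apply: eq_bigr => x _ /=.
  by rewrite coef0M ?gr_valP.
- move=> f g h e; rewrite /from1 -big_split; apply: eq_bigr => x _ /=.
  rewrite -big_split; apply: eq_bigr => y _ /=.
  by rewrite /form_coef e /coef0 cotD mulrDr rmorphD mulrDl.
- move=> a f h e; rewrite /from0 /from1 big_distrr; apply: eq_bigr => x _ /=.
  rewrite big_distrr; apply: eq_bigr => y _ /=.
  rewrite big_distrl (big_only (i := y)) /= => [|p ne]; last first.
    by rewrite -mulrA scalCA -(ar_evl A x y) [ev p * _]mulrA evM (negbTE ne) mul0r !mulr0.
  rewrite -mulrA scalCA ar_evl mulrA -rmorphM; congr (_%:S * _).
  suff -> : form_coef h (dual y) (dual x) =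
      coef0 (gr_val a) (dual y) * form_coef f (dual y) (dual x) by ring.
  have E : gr_mul (arc (dual y) (dual x)) a =
      gr_mul (scalc (coef0 (gr_val a) (dual y))) (arc (dual y) (dual x)) :> gr_comp A 1.
    apply: val_inj; rewrite /= {1}[gr_val a]deg0E big_distrr /= (big_only (i := dual y)) => [|p ne].
      by rewrite scalCA ar_evr.
    by rewrite scalCA -(ar_evr A (dual y)) -[ar _ _ * _ * _]mulrA evM eq_sym (negbTE ne) !mulr0.
  by rewrite /form_coef e [X in f X]E gr1_dualZ /coef0 cotZ.
- move=> a f h e; rewrite /from0 /from1 big_distrl; apply: eq_bigr => x _ /=.
  rewrite big_distrl; apply: eq_bigr => y _ /=.
  rewrite big_distrr (big_only (i := x)) /= => [|p ne]; last first.
    by rewrite -mulrA scalCA -(ar_evr A x y) -[ar _ _ * _ * _]mulrA evM eq_sym (negbTE ne) !mulr0.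
  rewrite -mulrA scalCA ar_evr mulrA -rmorphM; congr (_%:S * _).
  suff -> : form_coef h (dual y) (dual x) =
      form_coef f (dual y) (dual x) * coef0 (gr_val a) (dual x) by ring.
  by rewrite /form_coef e [LHS]coef0M ?gr_valP.
exact: from1_relation.
Qed.

(** The algebra is generated by the idempotents and the arrows. *)
Lemma ladder_algebra_ext (B : pzRingType) (F G : {rmorphism A -> B}) :
  (forall c, F (c%:S) = G (c%:S)) -> (forall x, F (ev x) = G (ev x)) ->
  (forall x y, F (ar x y) = G (ar x y)) -> F =1 G.
Proof.
move=> hs he ha a; rewrite (cot_span a) !rmorph_sum; apply: eq_bigr => b _.
rewrite !rmorphM hs; congr (_ * _); have [n] := ubnP (tdeg b); elim: n b => // n IH b hn.
case: (boolP (tok b)) => [t|nt]; last by rewrite cbt_ntri // !rmorph0.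
case: (eqVneq (tdeg b) 0%N) => [d|nd]; first by rewrite (tdeg0 t d) cbt_diag.
have [y [t' d e]] := cb_factor A t nd; rewrite /cbt e !rmorphM ha; congr (_ * _).
by apply: (IH (b.1.1, _, y)); rewrite -ltnS d.
Qed.

(** The two morphisms are inverse to each other on generators since edge signs
   square to 1, and they preserve the degree of the basis elements. *)
Theorem ladder_algebra_self_dual : gr_iso A D.
Proof.
have [F [Fs Fe Fa]] := to_quadratic_dual.
have [G [Gs G0 G1]] := from_quadratic_dual.
have GF : cancel F G.
  apply: (@ladder_algebra_ext A (G \o F) idfun) => [c|x|x y] /=.
  - by rewrite Fs Gs.
  - rewrite Fe G0 /from0 (big_only (i := x)) => [|y ne]; rewrite [coef0 _ _]coef0_ev (inj_eq (@dual_inj L)).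
      by rewrite eqxx rmorph1 mul1r.
    by rewrite (negbTE ne) rmorph0 mul0r.
  rewrite Fa rmorphM Gs G1; case: (boolP (lad_adj x y)) => [a|na]; last first.
    rewrite ar_nadj // /from1 big1 ?mulr0 // => p _; rewrite big1 // => q _.
    rewrite /form_coef arrow_formE /coef0 cotZ -[gr_val (arc _ _)]/(ar _ _) coef1_nadj ?ar_hom //.
      by rewrite mul0r mulr0 rmorph0 mul0r.
    move: na; apply: contraNN.
    by have := lvl_dualE x; have := lvl_dualE y; rewrite /lad_adj; lia.
  have ad : lad_adj (dual y) (dual x).
    have := lvl_dualE x; have := lvl_dualE y; have := lvl_le x; have := lvl_le y.
    by move: a; rewrite /lad_adj; lia.
  have fE p q : form_coef (arrow_form (dual y) (dual x)) (dual q) (dual p) = ((p == x) && (q == y))%:R.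
    rewrite /form_coef arrow_formE /coef0 cotZ [cot (ev _) _]coef0_ev (inj_eq (@dual_inj L)).
    case: (boolP (lad_adj p q)) => [b|nb].
      rewrite coef1_ar //; last first.
        have := lvl_dualE p; have := lvl_dualE q; have := lvl_le p; have := lvl_le q.
        by move: b; rewrite /lad_adj; lia.
      rewrite !(inj_eq (@dual_inj L)) (eq_sym x) (eq_sym y).
      by case: (p == x); case: (q == y); rewrite /= ?mulr1 ?mulr0.
    rewrite -[gr_val _]/(ar (dual q) (dual p)) ar_nadj; last first.
      move: nb; apply: contraNN.
      by have := lvl_dualE p; have := lvl_dualE q; rewrite /lad_adj; lia.
    rewrite [coef1 _ _ _]cot0 mul0r.
    case: (eqVneq p x) => [px|//]; case: (eqVneq q y) => [qy|//].
    by rewrite px qy a in nb.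
  rewrite /from1 (big_only (i := x)) => [|p ne].
    rewrite (big_only (i := y)) => [|q ne]; first by rewrite fE !eqxx mulr1 mulrA -rmorphM edge_signM rmorph1 mul1r.
    by rewrite fE (negbTE ne) andbF mulr0 rmorph0 mul0r.
  by rewrite big1 // => q _; rewrite fE (negbTE ne) mulr0 rmorph0 mul0r.
have FG : cancel G F.
  apply: (@quadratic_dual_ext K A D (F \o G) idfun) => [c|a|f] /=.
  - by rewrite Gs Fs.
  - rewrite G0 /from0 rmorph_sum qgen0_span.
    rewrite -[RHS](sum_dualE (fun x => (coef0 (gr_val a) x)%:D * g0 (evc x))).
    by apply: eq_bigr => x _; rewrite rmorphM Fs Fe.
  rewrite G1 /from1 rmorph_sum qgen1_span exchange_big /=.
  rewrite -[RHS](sum_dualE (fun x => \sum_y (form_coef f y x)%:D * g1 (arrow_form y x))).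
  apply: eq_bigr => x _; rewrite rmorph_sum.
  rewrite -[RHS](sum_dualE (fun y => (form_coef f y (dual x))%:D * g1 (arrow_form y (dual x)))).
  apply: eq_bigr => y _; rewrite rmorphM Fs Fa mulrA -rmorphM; congr (_%:D * _).
  by rewrite -mulrA mulrCA edge_signM mulr1.
exists F; split; first by exists G.
  exact: Fs.
move=> n a.
have Fb b : gr_proj D (tdeg b) (F (cbt A b)) = F (cbt A b).
  have [k] := ubnP (tdeg b); elim: k b => // k IH b hk.
  case: (boolP (tok b)) => [t|nt]; last by rewrite cbt_ntri // rmorph0 gr_proj0.
  case: (eqVneq (tdeg b) 0%N) => [d|nd].
    by rewrite d (tdeg0 t d) cbt_diag Fe qgen0_hom.
  have [y [t' d e]] := cb_factor A t nd; rewrite /cbt e rmorphM Fa -mulrA.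
  rewrite gr_projZ; congr (_ * _).
  have -> : tdeg b = (1 + tdeg (b.1.1, if b.1.2 == b.2 then y else b.1.2, y))%N by rewrite add1n; exact/esym/d.
  apply: gr_projM_hom; first exact: qgen1_hom.
  by apply: IH; rewrite -ltnS /tdeg /= d.
rewrite (cot_span a) gr_proj_big !rmorph_sum gr_proj_big; apply: eq_bigr => b _.
rewrite gr_projZ !rmorphM Fs gr_projZ; congr (_ * _).
rewrite cbt_hom -[in RHS]Fb gr_proj_proj Fb; case: ifP => // _.
exact: rmorph0.
Qed.

End LadderQuadraticDual.

(** * The Chevalley representation *)

Section LadderRelations.
Variables (K : fieldType) (L : ladder) (q : qnumbers K (height L)).
Variables (B : pzRingType) (sc : K -> B) (a : L -> L -> B).

Definition two_steps (x y z : L) : B := a y z * a x y.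

(** The coefficients of the last family are those of the product of the weight
   of the edge from p to z with the class x. At level 0 the sum is empty and
   the path over the peak is 0. *)
Definition ladder_relations : Prop :=
  [/\ forall x y y' z, lvl y = (lvl x).+1 -> lvl y' = lvl y -> lvl z = (lvl y).+1 ->
        two_steps x y z = two_steps x y' z,
      forall x y y' z, lvl x = (lvl y).+1 -> lvl y' = lvl y -> lvl y = (lvl z).+1 ->
        two_steps x y z = two_steps x y' z
    & forall x p z, lvl x = lvl z -> lvl p = (lvl x).+1 ->
        two_steps x p z = \sum_(w | lvl x == (lvl w).+1)
          sc (chevv q (weightv q p z) x w) * two_steps x w z].

End LadderRelations.

Section ChevalleyAction.
Variables (K : fieldType) (L : ladder) (q : qnumbers K (height L)).
Local Notation m := (height L).
Let m3 := height_ge3 L.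

Lemma eq_chev l l' b k c : l =1 l' -> chev q l b k c = chev q l' b k c.
Proof. by move=> h; rewrite /chev !h. Qed.

(** The weights of the edges descending from x are dual to the forms given by
   the coefficients of the products with x. *)
Lemma chevv_weightv (x w c : L) : lvl x = (lvl w).+1 -> lvl c = lvl w ->
  chevv q (weightv q x w) x c = (c == w)%:R.
Proof.
move=> e1 e2; have [b xE] := vtxP e1; have [d wE] := vtxP (erefl (lvl w)).
have [f cE] := vtxP e2; have lx := lvl_le x; set i := lvl w in e1 e2 xE wE cE *.
rewrite xE wE cE chevE; last by lia.
rewrite -(@chev_weight _ _ q b d f i); last by lia.
by apply: eq_chev; apply: weightE; lia.
Qed.

(** Weights form a plane and, above level 1, the weights of the two edges
   descending from x are a basis of it; chev gives the coordinates in this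
   basis by chev_weight. *)
Lemma weight_span (l : bool -> K) b j e : (0 < j < m)%N ->
  l e = chev q l b j.+1 false * weight q b false j e
      + chev q l b j.+1 true * weight q b true j e.
Proof.
move=> h; have n0 : q j != 0 by apply: qn_neq0.
have jn : (j != 0)%N by lia.
rewrite /chev /weight jn !andbT.
by case: b e => [] [] /=; field.
Qed.

Lemma chev_span (l : bool -> K) b j a k c : (0 < j < m)%N ->
  chev q l a k c = chev q l b j.+1 false * chev q (weight q b false j) a k c
                 + chev q l b j.+1 true * chev q (weight q b true j) a k c.
Proof.
move=> h; have E e := weight_span l b e h.
move: (chev q l b j.+1 false) (chev q l b j.+1 true) E => u v E.
by rewrite /chev; case: ifP => _; rewrite !E; ring.
Qed.

(** The peak relation holds in the representation below because of chev_span,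
   which writes the weight of the edge out of the peak as a combination of the
   weights of the edges descending from x. *)
Lemma chevv_peak (x p z a c : L) : lvl x = lvl z -> lvl p = (lvl x).+1 ->
  lad_le a x -> lvl a = (lvl c).+1 ->
  chevv q (weightv q p z) a c = \sum_(w | lvl x == (lvl w).+1)
    chevv q (weightv q p z) x w * (if lad_le c w then chevv q (weightv q x w) a c else 0).
Proof.
move=> exz ep ax ac; have lp := lvl_le p; have la := lad_le_lvl ax.
case: (posnP (lvl x)) => [x0|x0]; first by lia.
pose j := (lvl x).-1; have ex : lvl x = j.+1 by rewrite prednK.
transitivity (\sum_(w | lvl w == j) chevv q (weightv q p z) x w * chevv q (weightv q x w) a c).
  case: (posnP j) => [j0|j0].
    rewrite j0 sum_lvl_end; last by left.
    (* On level 1 there is only one descending edge, and a must be x. *)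
    have -> : a = x by apply: lad_le_eq => //; lia.
    have lc : lvl c = 0%N by lia.
    have [f ->] := vtxP lc; rewrite (vtx_bot L f) chevv_weightv ?lvl_vtx //; last by lia.
    by rewrite eqxx mulr1.
  rewrite sum_lvl; last by lia.
  have [k ek] : exists k, lvl c = k by exists (lvl c).
  rewrite ek in ac; have [b xE] := vtxP ex; have [f cE] := vtxP ek.
  have [g aE] := vtxP ac; have km : (k < m)%N by lia.
  have L1 l : chevv q l a c = chev q l g k.+1 f by rewrite aE cE chevE.
  have L2 l d : chevv q l x (vtx L d j) = chev q l b j.+1 d by rewrite xE chevE //; lia.
  rewrite !L1 !L2 (@chev_span _ b j); last by lia.
  by congr (_ * _ + _ * _); apply: eq_chev => i; rewrite xE weightE //; lia.
apply: eq_big => [w|w /eqP ew]; first by rewrite ex eqSS eq_sym.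
congr (_ * _); case: (boolP (lad_le c w)) => // ncw.
have cw : lvl c = lvl w.
  by apply/eqP; move: ncw; rewrite /lad_le negb_or => /andP[_]; lia.
have -> : a = x by apply: lad_le_eq => //; lia.
rewrite chevv_weightv //; last by lia.
by case: (eqVneq c w) ncw => // ->; rewrite lad_le_refl.
Qed.

Lemma chevv_square (x y y' z a c : L) :
  lvl x = (lvl y).+1 -> lvl y' = lvl y -> lvl y = (lvl z).+1 ->
  lad_le a x -> lad_le c z -> lvl a = (lvl c).+2 ->
  \sum_(b | lvl b == (lvl c).+1) chevv q (weightv q y z) b c * chevv q (weightv q x y) a b =
  \sum_(b | lvl b == (lvl c).+1) chevv q (weightv q y' z) b c * chevv q (weightv q x y') a b.
Proof.
move=> exy ey' eyz ax cz eac; have lx := lvl_le x; have la := lvl_le a.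
have l1 := lad_le_lvl ax; have l2 := lad_le_lvl cz.
set j := lvl z in eyz l2; set k := lvl c in eac l2 *.
have exj : lvl x = j.+2 by rewrite exy eyz.
have ey'j : lvl y' = j.+1 by rewrite ey'.
have [tx xE] := vtxP exj; have [ty yE] := vtxP eyz; have [ty' y'E] := vtxP ey'j.
have [tz zE] := vtxP (erefl (lvl z)); have [ta aE] := vtxP eac; have [tc cE] := vtxP (erefl (lvl c)).
have H y1 t1 : y1 = vtx L t1 j.+1 ->
    \sum_(b | lvl b == k.+1) chevv q (weightv q y1 z) b c * chevv q (weightv q x y1) a b =
    chev2 q (weight q t1 tz j) (weight q tx t1 j.+1) ta k tc.
  move=> y1E; rewrite sum_lvl; last by lia.
  rewrite /chev2 big_bool addrC.
  have E t : chevv q (weightv q y1 z) (vtx L t k.+1) c = chev q (weight q t1 tz j) t k.+1 tc.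
    rewrite cE -/k chevE; last by lia.
    by apply: eq_chev; rewrite y1E zE -/j; apply: weightE; lia.
  have E' t : chevv q (weightv q x y1) a (vtx L t k.+1) = chev q (weight q tx t1 j.+1) ta k.+2 t.
    rewrite aE chevE; last by lia.
    by apply: eq_chev; rewrite y1E xE; apply: weightE; lia.
  by rewrite !E !E'.
rewrite (H y ty) // (H y' ty') //; apply: chev2_weight; first by lia.
case: (posnP j) => [j0|//] /=.
have k0 : k = 0%N by lia.
rewrite k0 eqxx andbT.
have axE : a = x by apply: lad_le_eq => //; lia.
move: axE; rewrite aE xE j0 k0 => /eqP; rewrite vtx_inj //.
Qed.

End ChevalleyAction.

Section ChevalleyRepresentation.
Variables (K : fieldType) (L : ladder) (q : qnumbers K (height L)).
Local Notation m := (height L).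
Local Notation I := (L * L)%type.

(** Matrices indexed by pairs of vertices instead of ordinals. *)
Definition mxI (T : I -> I -> K) : 'M[K]_#|{: I}| :=
  \matrix_(i, j) T (enum_val i) (enum_val j).

Lemma mxI_mul S T : mxI S *m mxI T = mxI (fun i j => \sum_k S i k * T k j).
Proof.
apply/matrixP => i j; rewrite !mxE -[RHS]sum_enum_val; apply: eq_bigr => k _.
by rewrite !mxE.
Qed.

Lemma mxI_eq S T : (forall i j, S i j = T i j) -> mxI S = mxI T.
Proof. by move=> h; apply/matrixP => i j; rewrite !mxE. Qed.

(** The representation by Schubert classes. The component at the vertex x has
   the classes a <= x as a basis. An arrow going up includes the classes below
   x into those below y. An arrow going down multiplies by the weight of the
   edge and keeps the classes below y. The argument a is the index of the
   column, c that of the row. *)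
Definition rep_entry (x y c a : L) : K :=
  if lvl y == (lvl x).+1 then ((c == a) && lad_le a x)%:R
  else if lvl x == (lvl y).+1 then
    if [&& lad_le a x, lad_le c y & lvl a == (lvl c).+1] then chevv q (weightv q x y) a c else 0
  else 0.

(** The pairs (x, a) with a not below x are kept in the component of x, although
   the arrows kill them, so that the idempotents add up to 1. *)
Definition rep_ev (x : L) := mxI (fun i j => ((i == j) && (i.1 == x))%:R).
Definition rep_ar (x y : L) :=
  mxI (fun i j => if (i.1 == y) && (j.1 == x) then rep_entry x y i.2 j.2 else 0).

Lemma rep_two_steps x y z : two_steps rep_ar x y z =
  mxI (fun i j => if (i.1 == z) && (j.1 == x) then
     \sum_b rep_entry y z i.2 b * rep_entry x y b j.2 else 0).
Proof.
rewrite /two_steps [LHS]mxI_mul; apply: mxI_eq => i j.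
rewrite -(pair_bigA _ (fun y1 b => (if (i.1 == z) && (y1 == y) then rep_entry y z i.2 b else 0) *
   (if (y1 == y) && (j.1 == x) then rep_entry x y b j.2 else 0))) /=.
rewrite (big_only (i := y)) => [|y1 ne].
  case: (i.1 == z); last by rewrite big1 // => b _; rewrite mul0r.
  case: (j.1 == x); last by rewrite ?andbF big1 // => b _; rewrite ?andbF mulr0.
  by apply: eq_bigr => b _; rewrite eqxx.
by rewrite big1 // => b _; rewrite (negbTE ne) mulr0.
Qed.

Lemma rep_peak x p z c a : lvl x = lvl z -> lvl p = (lvl x).+1 ->
  \sum_b rep_entry p z c b * rep_entry x p b a =
  if [&& lad_le a x, lad_le c z & lvl a == (lvl c).+1] then chevv q (weightv q p z) a c else 0.
Proof.
move=> e1 e2; rewrite (big_only (i := a)) => [|b ne]; last first.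
  by rewrite {2}/rep_entry e2 eqxx (negbTE ne) /= ?mulr0n mulr0.
rewrite /rep_entry e2 eqxx e1 /= eqxx /=.
have -> : (lvl z == (lvl z).+2)%N = false by lia.
rewrite [a == a]eqxx; case: (boolP (lad_le a x)) => ax /=; last by rewrite mulr0n mulr0.
rewrite mulr1; have -> // : lad_le a p.
by apply: lad_le_trans ax _; apply: lad_lt_le; rewrite e2.
Qed.

Lemma rep_valley x w z c a : lvl x = lvl z -> lvl x = (lvl w).+1 ->
  \sum_b rep_entry w z c b * rep_entry x w b a =
  if [&& lad_le a x, lad_le c w & lvl a == (lvl c).+1] then chevv q (weightv q x w) a c else 0.
Proof.
move=> e1 e2; rewrite (big_only (i := c)) => [|b ne]; last first.
  by rewrite {1}/rep_entry -e1 e2 eqxx eq_sym (negbTE ne) /= ?mulr0n mul0r.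
rewrite /rep_entry -e1 e2 eqxx /=.
have -> : ((lvl w) == (lvl w).+2)%N = false by lia.
rewrite eqxx; case: (boolP (lad_le c w)) => cw; last by rewrite mul0r andbF.
by rewrite mul1r.
Qed.

(** Ascending paths are inclusions of classes; the relations of descending paths
   are chevv_square, and those of peaks are chevv_peak. *)
Lemma rep_ladder_relations : ladder_relations q (@scalar_mx K #|{: I}|) rep_ar.
Proof.
split.
- move=> x y y' z e1 e2 e3; rewrite !rep_two_steps; apply: mxI_eq => i j.
  case: ifP => // _.
  have H y1 : lvl y1 = (lvl x).+1 -> lvl z = (lvl y1).+1 ->
      \sum_b rep_entry y1 z i.2 b * rep_entry x y1 b j.2 = ((i.2 == j.2) && lad_le j.2 x)%:R.
    move=> h1 h2; rewrite (big_only (i := j.2)) => [|b ne].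
      rewrite /rep_entry h1 h2 !eqxx /= h1; case: (boolP (lad_le j.2 x)) => ax; last by rewrite !andbF mulr0n mulr0.
      have -> : lad_le j.2 y1 by apply: lad_le_trans ax _; apply: lad_lt_le; rewrite h1.
      by rewrite mulr1 eqxx.
    by rewrite {2}/rep_entry h1 eqxx (negbTE ne) /= ?mulr0n mulr0.
  by rewrite !H //; lia.
- move=> x y y' z e1 e2 e3; rewrite !rep_two_steps; apply: mxI_eq => [[z1 c] [x1 a]] /=.
  case: ifP => // _.
  have H y1 : lvl x = (lvl y1).+1 -> lvl y1 = (lvl z).+1 ->
      \sum_b rep_entry y1 z c b * rep_entry x y1 b a =
      if [&& lad_le a x, lad_le c z & lvl a == (lvl c).+2] then
        \sum_(b | lvl b == (lvl c).+1) chevv q (weightv q y1 z) b c * chevv q (weightv q x y1) a b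
      else 0.
    move=> h1 h2; have n1 : (lvl z == (lvl y1).+1) = false by lia.
    have n2 : (lvl y1 == (lvl x).+1) = false by lia.
    have E b : rep_entry y1 z c b * rep_entry x y1 b a =
        if [&& lad_le a x, lad_le c z, lvl a == (lvl c).+2 & lvl b == (lvl c).+1] then
          chevv q (weightv q y1 z) b c * chevv q (weightv q x y1) a b else 0.
      rewrite /rep_entry n1 n2 -h1 -h2 !eqxx.
      case: (boolP (lad_le a x)) => ax; last by rewrite mulr0.
      case: (boolP (lad_le c z)) => cz; last by rewrite andbF mul0r.
      case: (eqVneq (lvl b) (lvl c).+1) => eb; last by rewrite !andbF mul0r.
      rewrite eb; case: (eqVneq (lvl a) (lvl c).+2) => ea; last by rewrite !andbF mulr0.
      rewrite /= !andbT; case: (boolP (lad_le b y1)) => //= nb; rewrite mulr0.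
      have l1 := lad_le_lvl ax.
      have eby : lvl b = lvl y1.
        by apply/eqP; move: nb; rewrite /lad_le negb_or => /andP[_]; lia.
      have -> : a = x by apply: lad_le_eq => //; lia.
      rewrite chevv_weightv //; case: (eqVneq b y1) nb => [->|_ _]; first by rewrite lad_le_refl.
      by rewrite mulr0.
    under eq_bigr do rewrite E.
    case: (lad_le a x) => /=; last by rewrite big1.
    case: (lad_le c z) => /=; last by rewrite big1.
    case: (lvl a == (lvl c).+2) => /=; last by rewrite big1.
    by rewrite -big_mkcond.
  rewrite (H y) // (H y'); [|lia|lia].
  by case: ifP => // /and3P[h1 h2 /eqP h3]; apply: chevv_square => //; lia.
move=> x p z e1 e2.
have sumE (P : pred L) (k : L -> K) : \sum_(w | P w) (k w)%:M * two_steps rep_ar x w z =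
    mxI (fun i j => \sum_(w | P w) k w * (if (i.1 == z) && (j.1 == x) then
      \sum_b rep_entry w z i.2 b * rep_entry x w b j.2 else 0)).
  apply/matrixP => i j; rewrite summxE mxE; apply: eq_bigr => w _.
  by rewrite [_ * _]mul_scalar_mx rep_two_steps !mxE.
rewrite sumE rep_two_steps; apply: mxI_eq => [[z1 c] [x1 a]] /=.
case: ifP => _; last by rewrite big1 // => w _; rewrite mulr0.
rewrite rep_peak //; under eq_bigr => w /eqP ew do rewrite rep_valley //.
case: (boolP (lad_le a x)) => ax /=; last by rewrite big1 // => w _; rewrite mulr0.
case: (eqVneq (lvl a) (lvl c).+1) => ac; last by rewrite andbF big1 // => w _; rewrite andbF mulr0.
have la := lad_le_lvl ax.
rewrite lad_lt_le; last by lia.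
rewrite /= (chevv_peak q e1 e2 ax ac); apply: eq_bigr => w _.
by rewrite andbT.
Qed.

Lemma rep_evM x y : rep_ev x * rep_ev y = if x == y then rep_ev x else 0.
Proof.
rewrite [LHS]mxI_mul; apply/matrixP => i j; rewrite mxE.
rewrite (big_only (i := enum_val i)) => [|k ne]; last by rewrite [_ == k]eq_sym (negbTE ne) mul0r.
rewrite eqxx /=; case: (eqVneq x y) => [->|ne]; rewrite mxE.
  by case: (_.1 == y); rewrite ?andbF ?mul0r // mul1r.
by case: (eqVneq _ x) => [->|]; rewrite ?mul0r // (negbTE ne) andbF mulr0.
Qed.

Lemma rep_ev_sum : \sum_x rep_ev x = 1.
Proof.
apply/matrixP => i j; rewrite summxE (big_only (i := (enum_val i).1)) => [|x ne].
  by rewrite !mxE eqxx andbT (inj_eq enum_val_inj).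
by rewrite mxE eq_sym [_ == x]eq_sym (negbTE ne) andbF.
Qed.

Lemma rep_ar_evl x y : rep_ev y * rep_ar x y = rep_ar x y.
Proof.
rewrite [LHS]mxI_mul; apply: mxI_eq => i j.
rewrite (big_only (i := i)) => [|k ne]; last by rewrite eq_sym (negbTE ne) mul0r.
by rewrite eqxx; case: (i.1 == y); rewrite ?mul1r // mul0r.
Qed.
Lemma rep_ar_evr x y : rep_ar x y * rep_ev x = rep_ar x y.
Proof.
rewrite [LHS]mxI_mul; apply: mxI_eq => i j.
rewrite (big_only (i := j)) => [|k ne]; last by rewrite (negbTE ne) mulr0.
by rewrite eqxx; case: (j.1 == x); rewrite ?mulr1 // mulr0 andbF.
Qed.
Lemma rep_ar_nadj x y : ~~ lad_adj x y -> rep_ar x y = 0.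
Proof.
rewrite /lad_adj negb_or => /andP[/negbTE h1 /negbTE h2].
apply/matrixP => i j; rewrite !mxE /rep_entry h1 h2.
by rewrite if_same.
Qed.

End ChevalleyRepresentation.

(** * Algebras presented by the ladder relations *)

Section LadderPaths.
Variables (K : fieldType) (L : ladder) (q : qnumbers K (height L)) (A : gralg K).
Local Notation m := (height L).
Local Notation "c %:S" := (gr_scal A c) (at level 2, format "c %:S").
Variables (ev : L -> A) (ar : L -> L -> A).
Hypothesis evM : forall x y, ev x * ev y = if x == y then ev x else 0.
Hypothesis ev_sum : \sum_x ev x = 1.
Hypothesis ar_evl : forall x y, ev y * ar x y = ar x y.
Hypothesis ar_evr : forall x y, ar x y * ev x = ar x y.
Hypothesis ar_nadj : forall x y, ~~ lad_adj x y -> ar x y = 0.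
Hypothesis ev_hom : forall x, gr_proj A 0 (ev x) = ev x.
Hypothesis ar_hom : forall x y, gr_proj A 1 (ar x y) = ar x y.
Hypothesis ar_rel : ladder_relations q (gr_scal A) ar.
Hypothesis A_ind : forall P : A -> Prop, P 0 -> (forall a b, P a -> P b -> P (a + b)) ->
  (forall c a, P a -> P (c%:S * a)) -> (forall x, P (ev x)) ->
  (forall x y a, P a -> P (ar x y * a)) -> forall a, P a.
Hypothesis A_univ : forall (B : pzRingType) (sc : {rmorphism K -> B})
  (e : L -> B) (a : L -> L -> B),
  (forall c b, sc c * b = b * sc c) ->
  (forall x y, e x * e y = if x == y then e x else 0) ->
  \sum_x e x = 1 ->
  (forall x y, e y * a x y = a x y) -> (forall x y, a x y * e x = a x y) ->
  (forall x y, ~~ lad_adj x y -> a x y = 0) ->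
  ladder_relations q sc a ->
  exists f : {rmorphism A -> B},
    [/\ forall c, f (c%:S) = sc c, forall x, f (ev x) = e x
      & forall x y, f (ar x y) = a x y].

Let up x y y' z : lvl y = (lvl x).+1 -> lvl y' = lvl y -> lvl z = (lvl y).+1 ->
  ar y z * ar x y = ar y' z * ar x y'.
Proof. by case: ar_rel => h _ _; exact: h. Qed.
Let dn x y y' z : lvl x = (lvl y).+1 -> lvl y' = lvl y -> lvl y = (lvl z).+1 ->
  ar y z * ar x y = ar y' z * ar x y'.
Proof. by case: ar_rel => _ h _; exact: h. Qed.
Let peak x p z : lvl x = lvl z -> lvl p = (lvl x).+1 ->
  ar p z * ar x p = \sum_(w | lvl x == (lvl w).+1)
    (chevv q (weightv q p z) x w)%:S * (ar w z * ar x w).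
Proof. by case: ar_rel => _ _ h; exact: h. Qed.

(** The choice of intermediate vertices of type false does not matter, because
   the relations make all ascending paths from x to y equal; a path of length 1
   has no intermediate vertex. *)
Fixpoint upath (n : nat) (x y : L) : A :=
  match n with
  | 0 => ev x
  | n'.+1 => if n' is _.+1 then
      ar (vtx L false (lvl y).-1) y * upath n' x (vtx L false (lvl y).-1)
    else ar x y
  end.
Fixpoint dpath (n : nat) (x y : L) : A :=
  match n with
  | 0 => ev x
  | n'.+1 => if n' is _.+1 then
      dpath n' (vtx L false (lvl x).-1) y * ar x (vtx L false (lvl x).-1)
    else ar x y
  end.

Lemma upathS n x y z : lvl y = (lvl x + n)%N -> (n = 0%N -> y = x) ->
  lvl z = (lvl y).+1 -> ar y z * upath n x y = upath n.+1 x z.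
Proof.
case: n => [|n] ey yx ez; first by rewrite yx //= ar_evr.
rewrite [RHS]/=; set v := vtx L false _.
have lv : lvl v = lvl y by rewrite lvl_vtx ez //=; have := lvl_le z; lia.
case: n ey {yx} => [|n] ey /=; first by rewrite (@up x y v z) //; lia.
have ly := lvl_le y.
by rewrite lv !mulrA (@up _ y v z) // lvl_vtx; lia.
Qed.

Lemma dpathS n x y z : lvl y = (lvl z + n)%N -> (n = 0%N -> y = z) ->
  lvl x = (lvl y).+1 -> dpath n y z * ar x y = dpath n.+1 x z.
Proof.
case: n => [|n] ey yx ex; first by rewrite yx //= -yx // ar_evl.
rewrite [RHS]/=; set v := vtx L false _.
have lv : lvl v = lvl y by rewrite lvl_vtx ex //=; have := lvl_le x; lia.
case: n ey {yx} => [|n] ey /=; first by rewrite (@dn x y v z) //; lia.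
have ly := lvl_le y.
by rewrite lv -!mulrA (@dn x y v) // lvl_vtx; lia.
Qed.

Lemma upath_ar n x y z : lvl z = (lvl x + n)%N -> (n = 0%N -> z = x) ->
  lvl x = (lvl y).+1 -> upath n x z * ar y x = upath n.+1 y z.
Proof.
elim: n z => [|n IH] z ez zx ex; first by rewrite zx //= ar_evl.
case: n IH ez {zx} => [|n] IH ez.
  by rewrite -[RHS](@upathS 1 y x z) //; lia.
have lz := lvl_le z; set v := vtx L false (lvl z).-1.
have lv : lvl v = (lvl z).-1 by rewrite lvl_vtx //; lia.
rewrite -(@upathS n.+1 x v z) //; [|lia|lia].
by rewrite -mulrA IH //; lia.
Qed.

Lemma ar_dpath n x y z : lvl x = (lvl y + n)%N -> (n = 0%N -> x = y) ->
  lvl y = (lvl z).+1 -> ar y z * dpath n x y = dpath n.+1 x z.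
Proof.
elim: n x => [|n IH] x ex xy ey; first by rewrite xy //= ar_evr.
case: n IH ex {xy} => [|n] IH ex.
  by rewrite -[RHS](@dpathS 1 x y z) //; lia.
have lx := lvl_le x; set v := vtx L false (lvl x).-1.
have lv : lvl v = (lvl x).-1 by rewrite lvl_vtx //; lia.
rewrite -(@dpathS n.+1 x v y) //; [|lia|lia].
by rewrite mulrA IH //; lia.
Qed.

(** These paths, which descend from x to r and ascend to z, will be the basis. *)
Definition pb (x r z : L) : A :=
  if is_tri x r z then upath (lvl z - lvl r) r z * dpath (lvl x - lvl r) x r else 0.

Lemma le_diff0 (x y : L) : lad_le x y -> (lvl y - lvl x)%N = 0%N -> y = x.
Proof. by move=> h e; symmetry; apply: lad_le_eq => //; lia. Qed.

Lemma pb_ev x : pb x x x = ev x.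
Proof. by rewrite /pb is_tri_xx subnn /= evM eqxx. Qed.
Lemma pb_ntri x r z : ~~ is_tri x r z -> pb x r z = 0.
Proof. by rewrite /pb => /negbTE ->. Qed.
Lemma ar_up_pb x r y z : is_tri x r y -> lvl z = (lvl y).+1 -> ar y z * pb x r y = pb x r z.
Proof.
move=> t e; rewrite /pb t (is_tri_up t e) mulrA; have [_ h _ l] := is_triP t.
rewrite upathS //; [|lia|exact: le_diff0].
by congr (upath _ _ _ * _); lia.
Qed.
Lemma ar_dn_pb x y z : lad_le y x -> lvl y = (lvl z).+1 -> ar y z * pb x y y = pb x z z.
Proof.
move=> h e; have l := lad_le_lvl h.
have zx : lad_le z x by apply: lad_le_trans h; apply: lad_lt_le; rewrite e.
rewrite /pb /is_tri h zx !lad_le_refl !subnn /= mulrA ar_evr.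
have -> : (lvl x - lvl z)%N = (lvl x - lvl y).+1 by lia.
have lxy : lvl x = (lvl y + (lvl x - lvl y))%N by lia.
have D := ar_dpath lxy (le_diff0 h) e.
by rewrite -D mulrA ar_evl.
Qed.
Lemma pb_dn_ar x y r z : is_tri x r z -> lvl y = (lvl x).+1 -> pb x r z * ar y x = pb y r z.
Proof.
move=> t e; have [h1 h2 l1 l2] := is_triP t.
have t' : is_tri y r z.
  by rewrite /is_tri h2 andbT; apply: lad_le_trans h1 _; apply: lad_lt_le; rewrite e.
rewrite /pb t t' -mulrA dpathS //; [|lia|by move=> n0; apply: le_diff0].
by congr (_ * dpath _ _ _); lia.
Qed.
Lemma pb_up_ar x y z : lad_le x z -> lvl x = (lvl y).+1 -> pb x x z * ar y x = pb y y z.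
Proof.
move=> h e; have l := lad_le_lvl h.
have yz : lad_le y z by apply: lad_le_trans h; apply: lad_lt_le; rewrite e.
rewrite /pb /is_tri h yz !lad_le_refl !subnn /= -mulrA ar_evl.
have -> : (lvl z - lvl y)%N = (lvl z - lvl x).+1 by lia.
have lxz : lvl z = (lvl x + (lvl z - lvl x))%N by lia.
have D := upath_ar lxz (le_diff0 h) e.
by rewrite -D -mulrA ar_evr.
Qed.

(** The coordinates of a path are the entries of its action on the class x at
   the vertex x, the highest one there. A path which descends from x to r and
   ascends to z takes it to the class r at z, so these paths are independent. *)
Section Coordinates.
Variable rho : {rmorphism A -> 'M[K]_#|{: L * L}|}.
Hypothesis rho_scal : forall c, rho c%:S = c%:M.
Hypothesis rho_ev : forall x, rho (ev x) = rep_ev K x.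
Hypothesis rho_ar : forall x y, rho (ar x y) = rep_ar q x y.

Definition entry (a : A) (i j : L * L) : K := rho a (enum_rank i) (enum_rank j).
Definition pco (a : A) (x r z : L) : K := entry a (z, r) (x, x).

Lemma entryM a b i j : entry (a * b) i j = \sum_k entry a i k * entry b k j.
Proof.
rewrite /entry rmorphM [LHS]mxE -[RHS]sum_enum_val; apply: eq_bigr => k _.
by rewrite !enum_valK.
Qed.
Lemma entry_ar x y i j : entry (ar x y) i j =
  if (i.1 == y) && (j.1 == x) then rep_entry q x y i.2 j.2 else 0.
Proof. by rewrite /entry rho_ar mxE !enum_rankK. Qed.
Lemma entry_ev x i j : entry (ev x) i j = ((i == j) && (i.1 == x))%:R.
Proof. by rewrite /entry rho_ev mxE !enum_rankK. Qed.

Lemma entry_upath n x y z c : lvl y = (lvl x + n)%N -> (n = 0%N -> y = x) ->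
  entry (upath n x y) (z, c) (x, x) = ((z == y) && (c == x))%:R.
Proof.
elim: n y z c => [|n IH] y z c ey yx.
  by rewrite /= entry_ev yx //= xpair_eqE; case: (z == x); rewrite ?andbF //= andbT.
have ly := lvl_le y.
have E v : lvl v = (lvl x + n)%N -> lvl y = (lvl v).+1 -> lad_le x v ->
    (n = 0%N -> v = x) ->
    entry (ar v y * upath n x v) (z, c) (x, x) = ((z == y) && (c == x))%:R.
  move=> ev' eyv xv vx; rewrite entryM (big_only (i := (v, x))) => [|[k1 k2] ne].
    rewrite IH // !eqxx mulr1 entry_ar /= eqxx andbT /rep_entry eyv eqxx xv andbT.
    by case: (z == y).
  rewrite IH //; move: ne; rewrite xpair_eqE => /negbTE ->.
  by rewrite mulr0n mulr0.
case: n IH E ey {yx} => [|n] IH E ey.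
  have := E x; rewrite /= ar_evr; apply; [lia|lia|exact: lad_le_refl|by []].
rewrite /=; set v := vtx L false (lvl y).-1.
have lv : lvl v = (lvl y).-1 by rewrite lvl_vtx //; lia.
by apply: E => //; [lia|lia|apply: lad_lt_le; lia].
Qed.

Lemma entry_dpath n x y x' i : lvl x = (lvl y + n)%N -> (n = 0%N -> x = y) ->
  entry (dpath n x y) i (x', x') = ((i == (y, y)) && (x' == x))%:R.
Proof.
elim: n x x' i => [|n IH] x x' i ex xy.
  rewrite /= entry_ev xy //; case: (eqVneq x' y) => [->|ne].
    by case: (eqVneq i (y, y)) => [->|]; rewrite ?eqxx.
  by rewrite andbF; case: (eqVneq i (x', x')) => [->|] //=; rewrite (negbTE ne).
have lx := lvl_le x.
have E v : lvl v = (lvl y + n)%N -> lvl x = (lvl v).+1 -> (n = 0%N -> v = y) ->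
    entry (dpath n v y * ar x v) i (x', x') = ((i == (y, y)) && (x' == x))%:R.
  move=> ev' exv vy; rewrite entryM (big_only (i := (v, v))) => [|[k1 k2] ne].
    rewrite IH // eqxx andbT entry_ar /= eqxx /=.
    case: (eqVneq x' x) => [->|_]; last by rewrite andbF mulr0.
    rewrite /rep_entry exv !lad_le_refl eqxx /= chevv_weightv // eqxx.
    have -> : (lvl v == (lvl v).+2) = false by lia.
    by rewrite ?eqxx mulr1 ?andbT.
  rewrite entry_ar /=; case: ifP => [/andP[/eqP k1v /eqP ->]|_]; last by rewrite mulr0.
  rewrite k1v /rep_entry exv eqxx.
  have -> : (lvl v == (lvl v).+2) = false by lia.
  case: ifP => [/and3P[_ _ /eqP ek]|_]; last by rewrite mulr0.
  rewrite chevv_weightv //; last by lia.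
  case: (eqVneq k2 v) => [e|_]; last by rewrite mulr0n mulr0.
  by rewrite k1v e eqxx in ne.
case: n IH E ex {xy} => [|n] IH E ex.
  have := E y; rewrite /= ar_evl; apply; [lia|lia|by []].
rewrite /=; set v := vtx L false (lvl x).-1.
have lv : lvl v = (lvl x).-1 by rewrite lvl_vtx //; lia.
by apply: E => //; lia.
Qed.

Lemma pco_pb x r z x' r' z' : pco (pb x r z) x' r' z' =
  (is_tri x r z && [&& x' == x, r' == r & z' == z])%:R.
Proof.
rewrite /pco /pb; case: (boolP (is_tri x r z)) => [t|_]; last by rewrite /entry rmorph0 mxE.
have [h1 h2 l1 l2] := is_triP t.
rewrite entryM (big_only (i := (r, r))) => [|k ne].
  rewrite entry_upath; [|lia|exact: le_diff0].
  rewrite entry_dpath; [|lia|by move=> e; apply: le_diff0].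
  by rewrite eqxx /=; case: (z' == z); case: (r' == r); case: (x' == x); rewrite ?mulr1 ?mulr0n ?mulr0.
rewrite entry_dpath; [|lia|by move=> e; apply: le_diff0].
by rewrite (negbTE ne) mulr0n mulr0.
Qed.

Lemma pcoD a b x r z : pco (a + b) x r z = pco a x r z + pco b x r z.
Proof. by rewrite /pco /entry rmorphD mxE. Qed.
Lemma pcoZ c a x r z : pco (c%:S * a) x r z = c * pco a x r z.
Proof. by rewrite /pco /entry rmorphM rho_scal [_ * _]mul_scalar_mx mxE. Qed.

Definition spanned (a : A) : Prop :=
  a = \sum_x \sum_r \sum_z (pco a x r z)%:S * pb x r z.

Lemma spanned0 : spanned 0.
Proof.
rewrite /spanned big1 // => x _; rewrite big1 // => r _; rewrite big1 // => z _.
by rewrite /pco /entry rmorph0 mxE rmorph0 mul0r.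
Qed.
Lemma spannedD a b : spanned a -> spanned b -> spanned (a + b).
Proof.
rewrite /spanned => ha hb; rewrite {1}ha {1}hb -big_split; apply: eq_bigr => x _ /=.
rewrite -big_split; apply: eq_bigr => r _ /=; rewrite -big_split; apply: eq_bigr => z _ /=.
by rewrite pcoD rmorphD mulrDl.
Qed.
Lemma spannedZ c a : spanned a -> spanned (c%:S * a).
Proof.
rewrite /spanned => ha; rewrite {1}ha big_distrr; apply: eq_bigr => x _ /=.
rewrite big_distrr; apply: eq_bigr => r _ /=; rewrite big_distrr; apply: eq_bigr => z _ /=.
by rewrite pcoZ rmorphM mulrA.
Qed.
Lemma spanned_sum (I : Type) (s : seq I) (P : pred I) (F : I -> A) :
  (forall i, P i -> spanned (F i)) -> spanned (\sum_(i <- s | P i) F i).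
Proof. by move=> h; apply: big_ind => //; [exact: spanned0|exact: spannedD]. Qed.
Lemma spanned_pb x r z : spanned (pb x r z).
Proof.
case: (boolP (is_tri x r z)) => [t|nt]; last by rewrite pb_ntri //; exact: spanned0.
rewrite /spanned (big_only (i := x)) => [|x' ne]; last first.
  rewrite big1 // => r' _; rewrite big1 // => z' _.
  by rewrite pco_pb (negbTE ne) andbF rmorph0 mul0r.
rewrite (big_only (i := r)) => [|r' ne]; last first.
  by rewrite big1 // => z' _; rewrite pco_pb (negbTE ne) !andbF rmorph0 mul0r.
rewrite (big_only (i := z)) => [|z' ne]; last first.
  by rewrite pco_pb (negbTE ne) !andbF rmorph0 mul0r.
by rewrite pco_pb t !eqxx rmorph1 mul1r.
Qed.

Lemma upath_evl n x y : (n = 0%N -> y = x) -> ev y * upath n x y = upath n x y.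
Proof.
case: n => [|[|n]] /= h; first by rewrite h // evM eqxx.
  by rewrite ar_evl.
by rewrite mulrA ar_evl.
Qed.
Lemma pb_evl x r z : ev z * pb x r z = pb x r z.
Proof.
rewrite /pb; case: (boolP (is_tri x r z)) => [t|_]; last by rewrite mulr0.
by have [_ h2 _ _] := is_triP t; rewrite mulrA upath_evl //; apply: le_diff0.
Qed.

Lemma spanned_ar (y z : L) : (forall x r, spanned (ar y z * pb x r y)) ->
  forall a, spanned a -> spanned (ar y z * a).
Proof.
move=> h a ->; rewrite big_distrr; apply: spanned_sum => x _ /=.
rewrite big_distrr; apply: spanned_sum => r _ /=.
rewrite big_distrr; apply: spanned_sum => w _ /=.
rewrite mulrA -gr_scalC -mulrA; apply: spannedZ.
case: (eqVneq w y) => [->|ne]; first exact: h.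
by rewrite -(ar_evr y z) -(pb_evl x r w) mulrA -(mulrA _ (ev y)) evM eq_sym (negbTE ne) mulr0 mul0r; exact: spanned0.
Qed.

Lemma spanned_ar_up (y z : L) a : lvl z = (lvl y).+1 -> spanned a -> spanned (ar y z * a).
Proof.
move=> e; apply: spanned_ar => x r.
case: (boolP (is_tri x r y)) => [t|/pb_ntri ->]; last by rewrite mulr0; exact: spanned0.
by rewrite ar_up_pb //; exact: spanned_pb.
Qed.

(** The peak relation turns a descending arrow after an ascent into combinations
   in which the descending arrow comes earlier, until it is absorbed by the
   descent. The induction is on the level of the peak. *)
Lemma spanned_ar_dn (y z : L) a : lvl y = (lvl z).+1 -> spanned a -> spanned (ar y z * a).
Proof.
have [n] := ubnP (lvl y); elim: n y z a => // n IH y z a ln e.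
apply: spanned_ar => x r.
case: (boolP (is_tri x r y)) => [t|/pb_ntri ->]; last by rewrite mulr0; exact: spanned0.
have [h1 h2 l1 l2] := is_triP t; have ly := lvl_le y.
case: (eqVneq r y) => [ry|ne].
  by rewrite ry in h1 *; rewrite ar_dn_pb //; exact: spanned_pb.
have l3 : (lvl r < lvl y)%N.
  by rewrite ltn_neqAle l2 andbT; apply: contra ne => /eqP E; apply/eqP/lad_le_eq => //; rewrite E.
have [v lv rv] : exists2 v : L, lvl y = (lvl v).+1 & lad_le r v.
  case: (ltnP (lvl r) (lvl y).-1) => l4.
    have E : lvl (vtx L false (lvl y).-1) = (lvl y).-1 by rewrite lvl_vtx //; lia.
    exists (vtx L false (lvl y).-1); first by rewrite E; lia.
    by apply: lad_lt_le; rewrite E.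
  by exists r; [lia|exact: lad_le_refl].
have t' : is_tri x r v by rewrite /is_tri h1.
rewrite -(ar_up_pb t' lv) mulrA peak; [|lia|by []].
rewrite mulr_suml; apply: spanned_sum => w /eqP lw; rewrite -!mulrA; apply: spannedZ.
apply: spanned_ar_up; first by lia.
by apply: IH; [lia|by []|exact: spanned_pb].
Qed.

Lemma spannedT a : spanned a.
Proof.
apply: A_ind a => [|a b|c a|x|x y a h]; [exact: spanned0|exact: spannedD|exact: spannedZ| |].
  by rewrite -pb_ev; exact: spanned_pb.
case: (boolP (lad_adj x y)) => [|/ar_nadj ->]; last by rewrite mul0r; exact: spanned0.
by case/orP => /eqP e; [apply: spanned_ar_dn|apply: spanned_ar_up].
Qed.

Lemma pco_peak (x p z c : L) : lvl x = lvl z -> lvl p = (lvl x).+1 -> lvl x = (lvl c).+1 ->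
  pco (ar p z * ar x p) x c z = chevv q (weightv q p z) x c.
Proof.
move=> e1 e2 e3.
have E : rho (ar p z * ar x p) = two_steps (rep_ar q) x p z by rewrite rmorphM !rho_ar.
rewrite /pco /entry E rep_two_steps mxE !enum_rankK /= !eqxx /= rep_peak //.
by rewrite lad_le_refl e3 eqxx lad_lt_le //; lia.
Qed.

Lemma chevv_peakE (j : nat) (a p z c : bool) : (j.+1 < m)%N ->
  chevv q (weightv q (vtx L p j.+2) (vtx L z j.+1)) (vtx L a j.+1) (vtx L c j) =
  chev q (weight q p z j.+1) a j.+1 c.
Proof.
move=> h; rewrite chevE; last by lia.
by apply: eq_chev => i; apply: weightE.
Qed.

Lemma pco_sym (x p z c : L) : lvl x = lvl z -> lvl p = (lvl x).+1 -> lvl x = (lvl c).+1 ->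
  pco (ar p z * ar x p) x c z = pco (ar p x * ar z p) z c x.
Proof.
move=> e1 e2 e3; rewrite !pco_peak //; [|lia|lia].
have lp := lvl_le p; have [d cE] := vtxP (erefl (lvl c)).
move: e1 e2 e3; set j := lvl c in cE *; move=> e1 e2 e3; rewrite e3 in e1 e2.
have [a xE] := vtxP e3; have [b zE] := vtxP (esym e1); have [t pE] := vtxP e2.
rewrite xE zE pE cE !chevv_peakE ?chev_weight_peak //; [|lia..].
by case: {xE} a; case: {zE} b; case: {pE} t; case: {cE} d.
Qed.

(** In the closed form of the coefficients, replacing j by m - j - 2 exchanges q
   j and q (j + 2) by the symmetry of quantum integers, and the parity twist of
   the dual matches the types. *)
Lemma pco_dual (x p z c : L) : lvl x = lvl z -> lvl p = (lvl x).+1 -> lvl x = (lvl c).+1 ->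
  pco (ar (dual c) (dual z) * ar (dual x) (dual c)) (dual x) (dual p) (dual z) =
  - (-1) ^+ (x != z) * pco (ar p z * ar x p) x c z.
Proof.
move=> e1 e2 e3; have lp := lvl_le p; rewrite !pco_peak ?lvl_dual //; try lia.
have [d cE] := vtxP (erefl (lvl c)).
move: e1 e2 e3; set j := lvl c in cE *; move=> e1 e2 e3; rewrite e3 in e1 e2.
have [a xE] := vtxP e3; have [b zE] := vtxP (esym e1); have [t pE] := vtxP e2.
rewrite xE zE pE cE vtx_inj; last by lia.
rewrite !dual_vtx; [|lia..].
pose i := (m - j.+2)%N; have h1 : (m - j.+2 = i)%N by [].
have h2 : (m - j.+1 = i.+1)%N by rewrite /i; lia.
have h3 : (m - j = i.+2)%N by rewrite /i; lia.
rewrite h1 h2 h3 !chevv_peakE ?chev_weight_peak //; [|lia..].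
have -> : q i = q j.+2 by rewrite -h1 qn_sym //; lia.
have -> : q i.+1 = q j.+1 by rewrite -h2 qn_sym //; lia.
have -> : q i.+2 = q j by rewrite -h3 qn_sym //; lia.
rewrite /= negbK; case: (odd j); case: {xE} a; case: {zE} b; case: {pE} t; case: {cE} d => /=; ring.
Qed.

End Coordinates.

Section Transfer.
Variables (B : pzRingType) (sc : {rmorphism K -> B}) (a : L -> L -> B).
Hypothesis quad : forall x z (r : L -> K),
  \sum_w (r w)%:S * (ar w z * ar x w) = 0 -> \sum_w sc (r w) * (a w z * a x w) = 0.

Let delta_sum (C : pzRingType) (f : {rmorphism K -> C}) (y : L) (r : L -> K) (F : L -> C) :
  \sum_w f ((w == y)%:R - r w) * F w = F y - \sum_w f (r w) * F w.
Proof.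
rewrite (eq_bigr (fun w => f (w == y)%:R * F w - f (r w) * F w)) => [|w _].
  rewrite sumrB (big_only (i := y)) => [|w ne]; first by rewrite eqxx rmorph1 mul1r.
  by rewrite (negbTE ne) rmorph0 mul0r.
by rewrite rmorphB mulrBl.
Qed.
Let delta_eq (x z p : L) (r : L -> K) :
  two_steps ar x p z = \sum_w (r w)%:S * two_steps ar x w z ->
  two_steps a x p z = \sum_w sc (r w) * two_steps a x w z.
Proof.
move=> h; apply/eqP; rewrite -subr_eq0; apply/eqP.
rewrite -(@delta_sum _ sc p r (fun w => two_steps a x w z)); apply: quad.
by rewrite (@delta_sum _ (gr_scal A) p r (fun w => two_steps ar x w z)) h subrr.
Qed.
Let delta1 (C : pzRingType) (f : {rmorphism K -> C}) (y : L) (F : L -> C) :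
  \sum_w f (w == y)%:R * F w = F y.
Proof.
rewrite (big_only (i := y)) => [|w ne]; first by rewrite eqxx rmorph1 mul1r.
by rewrite (negbTE ne) rmorph0 mul0r.
Qed.
Let if_sum (C : pzRingType) (f : {rmorphism K -> C}) (P : pred L) (r : L -> K) (F : L -> C) :
  \sum_w f (if P w then r w else 0) * F w = \sum_(w | P w) f (r w) * F w.
Proof.
rewrite [RHS]big_mkcond; apply: eq_bigr => w _.
by case: ifP => _ //; rewrite rmorph0 mul0r.
Qed.

(** Each ladder relation is a linear relation between the paths of length two
   with given ends, so it is inherited by every algebra in which the relations
   of this kind hold. *)
Lemma ladder_relations_transfer : ladder_relations q sc a.
Proof.
split=> [x y y' z h1 h2 h3|x y y' z h1 h2 h3|x p z h1 h2].
- rewrite (@delta_eq x z y (fun w => (w == y')%:R)); first exact: delta1.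
  by rewrite (@delta1 _ (gr_scal A) y' (fun w => two_steps ar x w z)); exact: up.
- rewrite (@delta_eq x z y (fun w => (w == y')%:R)); first exact: delta1.
  by rewrite (@delta1 _ (gr_scal A) y' (fun w => two_steps ar x w z)); exact: dn.
rewrite (@delta_eq x z p (fun w =>
    if lvl x == (lvl w).+1 then chevv q (weightv q p z) x w else 0)); first exact: if_sum.
by rewrite (@if_sum _ (gr_scal A)); exact: peak.
Qed.
End Transfer.

(** The universal property gives a morphism to the matrices of the Chevalley
   representation, whose entries are the coordinates that make the spanning
   paths independent. *)
Theorem ladder_algebra_exists : exists LA : ladder_algebra K L, la_alg LA = A.
Proof.
pose scm : {rmorphism K -> 'M[K]_#|{: L * L}|} := @scalar_mx K #|{: L * L}|.
have [rho [r1 r2 r3]] := @A_univ _ scm (@rep_ev K L) (rep_ar q)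
  (fun c b => esym (scalar_mxC c b)) (@rep_evM K L) (@rep_ev_sum K L)
  (@rep_ar_evl K L q) (@rep_ar_evr K L q) (@rep_ar_nadj K L q) (rep_ladder_relations q).
unshelve eexists (@LadderAlgebra K L A ev ar pb (pco rho) _ _ _ _ _ _ _ _ _ _ _ _ _ _ _ _ _ _ _ _); try by [].
- exact: pb_ev.
- exact: pb_ntri.
- exact: ar_up_pb.
- exact: ar_dn_pb.
- exact: pb_dn_ar.
- exact: pb_up_ar.
- exact: pcoD.
- exact: pcoZ.
- exact: pco_pb.
- exact: (spannedT r1 r2 r3).
- exact: (pco_sym r3).
- exact: (pco_dual r3).
move=> B sc e a h1 h2 h3 h4 h5 h6 h7; apply: A_univ => //.
exact: ladder_relations_transfer.
Qed.

End LadderPaths.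

(** * The dihedral algebra *)

Section DihedralLadder.
Variables (R : realType) (m : nat).
Hypothesis m3 : (3 <= m)%N.
Variables (W : finGroupType) (s t : W).
Hypothesis hW : dihedral_coxeter_system m s t.
Local Notation w := (word s t).
Local Notation lng := (cox_length s t).

Lemma cox_length_le x : (lng x <= m)%N.
Proof. by have [b [k [km ->]]] := word_cover m3 hW x; rewrite (cox_length_word m3 hW). Qed.
Lemma word_length_typ x : w (x != w false (lng x)) (lng x) = x.
Proof.
have [b [k [km ->]]] := word_cover m3 hW x; rewrite (cox_length_word m3 hW) //.
case: (eqVneq (w b k) (w false k)) => [-> //|].
by case: b => //; rewrite eqxx.
Qed.
Lemma cox_lengthK b k : (k <= m)%N -> lng (w b k) = k.
Proof. exact: (cox_length_word m3 hW). Qed.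
Lemma word_typ b k : (0 < k < m)%N -> (w b k != w false (lng (w b k))) = b.
Proof.
move=> h; rewrite (cox_length_word m3 hW) //; last by lia.
by case: b; [apply/eqP/(word_type m3 hW)|rewrite eqxx].
Qed.
Lemma word_bot b : w b 0 = w false 0. Proof. by []. Qed.
Lemma word_topE b : w b m = w false m.
Proof. by case: b; rewrite // (word_top hW). Qed.

(** The elements of the dihedral group are the alternating words; the type of a
   word is true when it starts with t, except for the bottom and the top, which
   have type false. *)
Definition dihedral_ladder : ladder :=
  @Ladder W m lng (fun x => x != w false (lng x)) w m3 cox_length_le
    word_length_typ cox_lengthK word_typ word_bot word_topE.

Lemma qint_neq0 n : (0 < n < m)%N -> qint R m n != 0.
Proof. by move=> h; rewrite gt_eqF // qint_gt0. Qed.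

Definition qint_numbers : qnumbers R (height dihedral_ladder) :=
  @QNumbers R m (qint R m) (qint0 R m3) (qint1 R m3) (qintSS R m3) qint_neq0 (@qint_sym R m m3).

Section Relations.
Variables (B : pzRingType) (sc : {rmorphism R -> B}).
Local Notation q := qint_numbers.
Local Notation C p z a j d := (chev q (weight q p z j.+1) a j.+1 d).

(** The defining relations written with words, all of them in a form which is
   symmetric in the two letters and in the choice of types. *)
Definition word_relations (T : W -> W -> W -> B) : Prop :=
  [/\ forall b c d j, (j.+2 <= m)%N ->
        T (w b j) (w d j.+1) (w c j.+2) = T (w b j) (w (~~ d) j.+1) (w c j.+2),
      forall b c d j, (j.+2 <= m)%N ->
        T (w c j.+2) (w d j.+1) (w b j) = T (w c j.+2) (w (~~ d) j.+1) (w b j),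
      forall p, T 1%g (w p 1) 1%g = 0,
      forall a p z, T (w a 1) (w p 2) (w z 1) =
        sc (C p z a 0 false) * T (w a 1) 1%g (w z 1)
    & forall a p z j, (0 < j)%N -> (j.+1 < m)%N ->
        T (w a j.+1) (w p j.+2) (w z j.+1) =
          sc (C p z a j a) * T (w a j.+1) (w a j) (w z j.+1)
        + sc (C p z a j (~~ a)) * T (w a j.+1) (w (~~ a) j) (w z j.+1)].

Lemma lvl_word b k : (k <= m)%N -> lvl (w b k : dihedral_ladder) = k.
Proof. exact: (@lvl_vtx dihedral_ladder). Qed.
Lemma lvl_wordP (x : dihedral_ladder) k : lvl x = k -> exists b, x = w b k.
Proof. exact: (@vtxP dihedral_ladder). Qed.

Lemma chevalley_sum (T : W -> W -> W -> B) (a p z : bool) (j : nat) : (j.+1 < m)%N ->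
  \sum_(v : dihedral_ladder | lvl (w a j.+1 : dihedral_ladder) == (lvl v).+1)
    sc (chevv q (weightv q (w p j.+2 : dihedral_ladder) (w z j.+1)) (w a j.+1) v)
      * T (w a j.+1) v (w z j.+1) =
  if j == 0%N then sc (C p z a 0 false) * T (w a 1) 1%g (w z 1)
  else sc (C p z a j a) * T (w a j.+1) (w a j) (w z j.+1)
     + sc (C p z a j (~~ a)) * T (w a j.+1) (w (~~ a) j) (w z j.+1).
Proof.
move=> jm; rewrite (eq_bigl (fun v : dihedral_ladder => lvl v == j)) => [|v]; last first.
  by rewrite lvl_word ?eqSS 1?eq_sym //; exact: ltnW.
have cE := @chevv_peakE _ dihedral_ladder q j a p z _ jm.
case: (eqVneq j 0%N) => [j0|j0].
  by rewrite sum_lvl_end ?cE; [rewrite j0|left].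
rewrite sum_lvl; last by rewrite lt0n j0 /=; apply: ltnW.
by rewrite !cE; case: (a); rewrite // addrC.
Qed.

Lemma word_relationsP (a : W -> W -> B) :
  word_relations (two_steps (L := dihedral_ladder) a) <-> ladder_relations (L := dihedral_ladder) q sc a.
Proof.
set T := two_steps _.
have lw := lvl_word; have wP := lvl_wordP.
split=> [[up dn pe p1 pj]|[up dn peak]].
  split=> [x y y' z e1 e2 e3|x y y' z e1 e2 e3|x p z e1 e2].
  - have lz := lvl_le z; have [b xE] := wP _ _ (erefl (lvl x)); move: (lvl x) xE e1 => j xE e1.
    rewrite e1 in e2 e3; have [d yE] := wP _ _ e1; have [d' y'E] := wP _ _ e2.
    have [c zE] := wP _ _ e3; rewrite e3 in lz.
    rewrite -/(T x y z) -/(T x y' z) xE yE y'E zE.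
    by case: (eqVneq d' d) => [-> //|ne]; rewrite up //; case: d d' ne {yE y'E} => [] [].
  - have lx := lvl_le x; have [b zE] := wP _ _ (erefl (lvl z)); move: (lvl z) zE e3 => j zE e3.
    rewrite e3 in e1 e2; have [d yE] := wP _ _ e3; have [d' y'E] := wP _ _ e2.
    have [c xE] := wP _ _ e1; rewrite e1 in lx.
    rewrite -/(T x y z) -/(T x y' z) xE yE y'E zE.
    by case: (eqVneq d' d) => [-> //|ne]; rewrite dn //; case: d d' ne {yE y'E} => [] [].
  have lp := lvl_le p; have [k ek] : exists k, lvl x = k by exists (lvl x).
  rewrite ek in e2; have [b xE] := wP _ _ ek.
  have [c zE] := wP _ _ (etrans (esym e1) ek); have [d pE] := wP _ _ e2.
  case: k ek xE zE pE e2 => [|j] ek xE zE pE e2.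
    rewrite big_pred0 => [|v]; last by rewrite ek.
    by rewrite -/(T x p z) xE pE zE; exact: pe.
  rewrite e2 in lp; rewrite -/(T x p z) xE pE zE chevalley_sum //.
  by case: posnP => [->|j0]; [exact: p1|exact: pj].
have pk a' p z j : (j.+1 < m)%N -> T (w a' j.+1) (w p j.+2) (w z j.+1) = _ :=
  fun h => etrans (peak (w a' j.+1) (w p j.+2) (w z j.+1)
    (etrans (lw a' _ (ltnW h)) (esym (lw z _ (ltnW h))))
    (etrans (lw p _ h) (congr1 S (esym (lw a' _ (ltnW h)))))) (chevalley_sum T a' p z h).
split=> [b c d j h|b c d j h|p|a' p z|a' p z j j0 jm].
- by apply: up; rewrite !lw //; lia.
- by apply: dn; rewrite !lw //; lia.
- rewrite [LHS](peak (w false 0) (w p 1) (w false 0)) ?lw //; try lia.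
  by rewrite big_pred0 // => v; rewrite lw.
- by rewrite pk //; exact: (ltnW m3).
by rewrite pk // -[j == _]negbK -lt0n j0.
Qed.

(** With chev_weight_peak, the four combinations of types of the peak and of the
   end of the path give the four families of relations over peaks; those with
   start on level 1 have one term only, and are listed separately since letters
   take the place of words there. *)
Lemma half_rel_words (f : {rmorphism hasse_path_alg R s t -> B}) :
  (forall c, f (gr_scal _ c) = sc c) ->
  (forall b l r, half_rel m (letter s t b) (letter s t (~~ b)) l r -> f l = f r) <->
  word_relations (two_steps (L := dihedral_ladder) (fun x y => f (arrow R s t x y))).
Proof.
move=> fsc; set T := two_steps _.
have fT x y z : f (path2 R s t x y z) = T x y z by rewrite /path2 rmorphM.
have fcT c x : f (gr_scal _ c * x) = sc c * f x by rewrite rmorphM fsc.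
have w1 b : w b 1 = letter s t b by rewrite wordS word0 mulg1.
have w2 b : w b 2 = (letter s t b * letter s t (~~ b))%g by rewrite wordS w1.
have q2 : q 2 = qint R m 2 by [].
have w1f : letter s t false = s by []. have w1t : letter s t true = t by [].
have f0 : f 0 = 0 := rmorph0 f.
have fD x y : f (x + y) = f x + f y := rmorphD f x y.
have fB x y : f (x - y) = f x - f y := rmorphB f x y.
pose fE := (fT, fcT, f0, fB, fD).
split=> [H|[up dn pe p1 pj]].
  have h10 b j : (j <= m - 2)%N ->
      T (w b j) (w b j.+1) (w b j.+2) = T (w b j) (w (~~ b) j.+1) (w b j.+2).
    by move=> h; move: (H b _ _ (rel10 _ _ _ _ _ h)); rewrite !fE; case: b.
  have h11 b j : (j <= m - 2)%N ->
      T (w b j) (w b j.+1) (w (~~ b) j.+2) = T (w b j) (w (~~ b) j.+1) (w (~~ b) j.+2).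
    by move=> h; move: (H b _ _ (rel11 _ _ _ _ _ h)); rewrite !fE; case: b.
  have h12 b j : (j <= m - 2)%N ->
      T (w b j.+2) (w b j.+1) (w b j) = T (w b j.+2) (w (~~ b) j.+1) (w b j).
    by move=> h; move: (H b _ _ (rel12 _ _ _ _ _ h)); rewrite !fE; case: b.
  have h13 b j : (j <= m - 2)%N ->
      T (w b j.+2) (w b j.+1) (w (~~ b) j) = T (w b j.+2) (w (~~ b) j.+1) (w (~~ b) j).
    by move=> h; move: (H b _ _ (rel13 _ _ _ _ _ h)); rewrite !fE; case: b.
  split=> [b c d j h|b c d j h|p|a p z|a p z j j0 jm].
  - have hj : (j <= m - 2)%N by lia.
    by move: (h10 b j hj) (h11 b j hj); case: b c d => [] [] [] /= E E'; rewrite ?E ?E'.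
  - have hj : (j <= m - 2)%N by lia.
    by move: (h12 c j hj) (h13 c j hj); case: b c d => [] [] [] /= E E'; rewrite ?E ?E'.
  - by move: (H p _ _ (rel1 _ _ _ _ _ _)); rewrite !fE w1.
  - rewrite chev_weight_peak; last exact: (ltnW m3).
    move: (H a _ _ (rel2 _ _ _ _ _ _)) (H a _ _ (rel4 _ _ _ _ _ _)) (H a _ _ (rel6 _ _ _ _ _ _)) (H a _ _ (rel7 _ _ _ _ _ _)).
    rewrite !fE !w1 !w2 qn0 qn1 mul0r sub0r !invr1 !mulr1 q2; move: (qint R m 2) => c2.
    by case: a p z => [] [] [] /= e2 e4 e6 e7; rewrite ?rmorph0 ?rmorph1 ?mul0r ?mul1r.
  have h : (2 <= j.+1 <= m.-1)%N by lia.
  move: (H a _ _ (rel3 _ _ _ _ _ h)) (H a _ _ (rel5 _ _ _ _ _ h)) (H a _ _ (rel8 _ _ _ _ _ h)) (H a _ _ (rel9 _ _ _ _ _ h)).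
  rewrite !fE !chev_weight_peak //.
  by case: a p z => [] [] [] /= e3 e5 e8 e9; rewrite ?rmorph0 ?rmorph1 ?mul0r ?mul1r ?addr0 //;
    rewrite mulNr rmorphN mulNr.
move=> b l r.
have pE a p z j : (2 <= j.+1 <= m.-1)%N -> T (w a j.+1) (w p j.+2) (w z j.+1) =
    sc (C p z a j a) * T (w a j.+1) (w a j) (w z j.+1)
    + sc (C p z a j (~~ a)) * T (w a j.+1) (w (~~ a) j) (w z j.+1).
  by move=> h; apply: pj; lia.
have jE j : (j <= m - 2)%N -> (j.+2 <= m)%N by lia.
have iE i : (2 <= i.+1 <= m.-1)%N -> (i.+1 < m)%N by lia.
have h1 : (1 < m)%N by exact: ltnW.
case=> [||[//|i] h||[//|i] h|||[//|i] h|[//|i] h|j /jE h|j /jE h|j /jE h|j /jE h]; rewrite !fE.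
- by rewrite -w1; exact: pe.
- have := p1 b b b; rewrite chev_weight_peak //.
  by rewrite !w1 w2 eqxx qn0 mul0r if_same rmorph0 mul0r.
- have hi := iE _ h; have := pE b b b i h; rewrite !chev_weight_peak //.
  by case: b => /= ->; rewrite rmorph0 mul0r addr0.
- have := p1 b (~~ b) b; rewrite chev_weight_peak //.
  rewrite !w1 w2 q2 negbK qn0 qn1 sub0r invr1 mul0r !mulr1 if_same; move: (qint R m 2) => c.
  by case: b => /= ->.
- have hi := iE _ h; have := pE b (~~ b) b i h; rewrite !chev_weight_peak //.
  by case: b => /= ->; rewrite mulNr rmorphN mulNr.
- have := p1 b b (~~ b); rewrite chev_weight_peak //.
  by rewrite !w1 w2 qn1 invr1 if_same; case: b => /= ->; rewrite rmorph1 mul1r.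
- have := p1 b (~~ b) (~~ b); rewrite chev_weight_peak //.
  by rewrite !w1 w2 qn1 invr1 if_same negbK; case: b => /= ->; rewrite rmorph1 mul1r.
- have hi := iE _ h; have := pE b b (~~ b) i h; rewrite !chev_weight_peak //.
  by case: b => /= ->; rewrite rmorph1 mul1r.
- have hi := iE _ h; have := pE b (~~ b) (~~ b) i h; rewrite !chev_weight_peak //.
  by case: b => /= ->; rewrite rmorph1 mul1r.
- by have := up b b b j h; case: b.
- by have := up b (~~ b) b j h; case: b.
- by have := dn b b b j h; case: b.
by have := dn (~~ b) b b j h; case: b.
Qed.

End Relations.
Section DihedralAlgebra.
Local Notation A := (dihedral_alg R m s t).
Local Notation PA := (hasse_path_alg R s t).
Local Notation pi := (@quot_pi PA (@dihedral_relations R m W s t)).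
Local Notation q := qint_numbers.
Local Notation elt := (path_elt R (Q := hasse_quiver s t)).

Lemma arrowE (i : hasse_arrow s t) : elt (val i).1 [:: i] = arrow R s t (val i).1 (val i).2.
Proof. by rewrite /arrow -surjective_pairing valK. Qed.

Lemma arrow_nadj x y : ~~ hasse_adj s t x y -> arrow R s t x y = 0.
Proof. by move=> h; rewrite /arrow insubF //; apply: negbTE. Qed.

Lemma arrow_evl x y : elt y [::] * arrow R s t x y = arrow R s t x y.
Proof.
rewrite /arrow; case: insubP => [i _ e|_]; last by rewrite mulr0.
have -> : y = walk_end (Q := hasse_quiver s t) x [:: i] by rewrite /= e.
by rewrite path_elt_cat ?cats0 //= e eqxx.
Qed.
Lemma arrow_evr x y : arrow R s t x y * elt x [::] = arrow R s t x y.
Proof.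
rewrite /arrow; case: insubP => [i _ e|_]; last by rewrite mul0r.
by rewrite -{1}[x]/(walk_end (Q := hasse_quiver s t) x [::]) path_elt_cat.
Qed.
Lemma elt0_mul x y : elt x [::] * elt y [::] = if x == y then elt x [::] else 0 :> PA.
Proof.
case: eqVneq => [->|ne]; last by rewrite path_elt_neq //= eq_sym.
by rewrite -{1}[y]/(walk_end (Q := hasse_quiver s t) y [::]) path_elt_cat.
Qed.
Lemma elt0_hom x : gr_proj PA 0 (elt x [::]) = elt x [::].
Proof.
apply: val_inj; apply/funext => -[y p] /=; rewrite /pa_proj_fun /= /path_elt_fun.
by case: ifP => //; case: asboolP => // -[_ ->].
Qed.


Lemma half_rel_relation b l r : half_rel m (letter s t b) (letter s t (~~ b)) l r ->
  @dihedral_relations R m W s t (l - r).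
Proof. by move=> h; exists l, r; split=> //; case: b h; [right|left]. Qed.

Let pi_rmorphism : exists g : {rmorphism PA -> A}, g =1 pi.
Proof.
apply: rmorphism_of => [x y|]; first by rewrite quot_piD quot_piN.
by split=> // x y; rewrite quot_piM.
Qed.

(** The presentation of the dihedral algebra is the presentation by ladder
   relations. *)
Theorem dihedral_ladder_algebra :
  exists LA : ladder_algebra R dihedral_ladder, la_alg LA = A.
Proof.
have [p pE] := pi_rmorphism.
have scE c : p (gr_scal PA c) = gr_scal A c by rewrite pE.
apply: (@ladder_algebra_exists R dihedral_ladder q A
  (fun x => p (elt x [::])) (fun x y => p (arrow R s t x y))).
- by move=> x y; rewrite -rmorphM elt0_mul; case: eqP => _; rewrite ?rmorph0.
- by rewrite -rmorph_sum -(rmorph1 p); congr (p _); rewrite [RHS]pa_one.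
- by move=> x y; rewrite -rmorphM arrow_evl.
- by move=> x y; rewrite -rmorphM arrow_evr.
- by move=> x y h; rewrite arrow_nadj ?rmorph0.
- by move=> x; rewrite pE; apply: etrans (quot_proj_pi (@dihedral_relations_homog R m W s t) _ _) _; congr (pi _); exact: elt0_hom.
- by move=> x y; rewrite pE; apply: etrans (quot_proj_pi (@dihedral_relations_homog R m W s t) _ _) _; congr (pi _); exact: arrow_hom.
- apply/word_relationsP/half_rel_words => // b l r h; rewrite !pE.
  apply: (quot_pi_eq _ _ _).2; apply: ideal_gen_in; exact: half_rel_relation h.
- move=> P P0 PD PZ Pe Pa a; rewrite -(quot_reprK a) -pE.
  apply: (@path_alg_ind R (hasse_quiver s t) (fun x => P (p x))).
  + by rewrite rmorph0.
  + by move=> x y hx hy; rewrite rmorphD; exact: PD.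
  + by move=> c x hx; rewrite rmorphM scE; exact: PZ.
  + exact: Pe.
  by move=> i x hx; rewrite rmorphM arrowE; exact: Pa.
move=> B sc e a scC eM e1 eal ear anadj arel.
have [f [f1 f2 f3]] := @path_alg_lift R (hasse_quiver s t) B sc scC e
  (fun i => a (val i).1 (val i).2) eM e1 (fun i => eal _ _) (fun i => ear _ _).
have fa x y : f (arrow R s t x y) = a x y.
  case: (boolP (hasse_adj s t x y)) => h; last by rewrite arrow_nadj // rmorph0 anadj.
  pose i : hasse_arrow s t := Sub (x, y) h.
  by rewrite -[arrow R s t x y]/(arrow R s t (val i).1 (val i).2) -arrowE; exact: f3 i.
have [|g gE] := @quot_lift PA B (@dihedral_relations R m W s t) f.
  have fae : (fun x y => f (arrow R s t x y)) = a by do 2!apply/funext => ?; exact: fa.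
  have H := (half_rel_words (sc := sc) f1).2; rewrite fae in H.
  have {}H := H ((word_relationsP sc a).2 arel).
  move=> _ [l [r [h ->]]]; rewrite rmorphB; apply/eqP; rewrite subr_eq0; apply/eqP.
  by case: h; [exact: (H false)|exact: (H true)].
exists g; split=> [c|x|x y]; rewrite ?pE; apply: etrans (gE _) _ => //.
exact: f1.
Qed.

End DihedralAlgebra.
End DihedralLadder.

Lemma gr_iso_refl (K : fieldType) (A : gralg K) : gr_iso A A.
Proof. by exists idfun; split=> //; exists idfun. Qed.

Theorem theorem7p6 (R : realType) (m : nat) (hm : (3 <= m)%N)
    (W : finGroupType) (s t : W) (hW : dihedral_coxeter_system m s t) :
  exists E : gralg R,
    [/\ koszul_dual (dihedral_alg R m s t) E,
        gr_iso (dihedral_alg R m s t) E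
      & gr_iso E (quadratic_dual (dihedral_alg R m s t))].
Proof.
have [LA <-] := dihedral_ladder_algebra R hm hW.
exists LA; split; [exact: koszul_dual_self|exact: gr_iso_refl|exact: ladder_algebra_self_dual].
Qed.
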